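(* Let $u$ be a variational solution of the two-phase free boundary problem on $B_1$ and for $0<r<1$ define $$\mathcal{M}(u;r)=\frac1{r^3}\int_{B_r}\Big(|\nabla u|^2-y(\rho_+\chi^+(u)+\rho_-\chi^-(u))\Big)dx\,dy-\frac32\frac1{r^4}\int_{\partial B_r}u^2\,d\mathcal{H}^1.$$ Then $\mathcal{M}(u;\cdot)$ is differentiable almost everywhere with $$\partial_r\mathcal{M}(u;r)=\frac2{r^3}\int_{\partial B_r}\Big(\nabla u\cdot\nu-\frac32\frac ur\Big)^2d\mathcal{H}^1,$$ where $\nu$ is the outward unit normal to $\partial B_r$.
   Context: $B_r$ is the open disk of radius $r$ centered at $0$; $\mathcal{H}^1$ is one-dimensional Hausdorff measure. Let $\rho_+\neq\rho_-$ be positive constants. For $u\in C^0(B_1)$: $\Omega^+(u)=\operatorname{int}\{u\ge0\}$, $\Omega^-(u)=\{u<0\}$, $u_\pm=u$ on $\Omega^\pm(u)$ and $0$ on $\Omega^\mp(u)$, $\chi^\pm(u)$ the indicator of $\Omega^\pm(u)$. A variational solution is $u\in H^1(B_1)\cap C^0(B_1)$ with $u_\pm\in C^2(\Omega^\pm(u))$ such that for all $\phi\in C^1_0(B_1;\mathbb{R}^2)$: $0=\int_{B_1}\big(|\nabla u|^2\nabla\cdot\phi-2D\phi[\nabla u,\nabla u]-(\rho_+\chi^+(u)+\rho_-\chi^-(u))\nabla\cdot(y\phi)\big)dx\,dy$. *)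

(* Defs.v *)
From mathcomp Require Import all_boot all_order all_algebra.
From mathcomp Require Import all_classical all_reals all_analysis.
Set Implicit Arguments. Unset Strict Implicit. Unset Printing Implicit Defensive.
Import Order.TTheory GRing.Theory Num.Theory.
Import numFieldNormedType.Exports.
Local Open Scope classical_set_scope.
Local Open Scope ring_scope.

Section TwoPhase.
Variable R : realType.

Definition leb2 := (@lebesgue_measure R \x @lebesgue_measure R)%E.

Definition ball0 (r : R) : set (R * R) := [set p | p.1 ^+ 2 + p.2 ^+ 2 < r ^+ 2].

Definition e1 : R * R := (1, 0).
Definition e2 : R * R := (0, 1).

Definition dx (f : R * R -> R) : R * R -> R := fun p => 'D_e1 f p.
Definition dy (f : R * R -> R) : R * R -> R := fun p => 'D_e2 f p.

Fixpoint Ck_on (k : nat) (A : set (R * R)) (f : R * R -> R) : Prop :=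
  match k with
  | 0%N => forall p, A p -> {for p, continuous f}
  | k'.+1 => [/\ forall p, A p -> {for p, continuous f},
                 forall p, A p -> derivable f p e1,
                 forall p, A p -> derivable f p e2,
                 Ck_on k' A (dx f) & Ck_on k' A (dy f)]
  end.

Definition support2 {V : zmodType} (f : R * R -> V) : set (R * R) :=
  [set p | f p != 0].
Definition compact_support_in {V : zmodType} (A : set (R * R)) (f : R * R -> V) :=
  compact (closure (support2 f)) /\ closure (support2 f) `<=` A.

Definition test_fun (psi : R * R -> R) : Prop :=
  (forall k, Ck_on k setT psi) /\ compact_support_in (ball0 1) psi.

Definition L2_on (A : set (R * R)) (f : R * R -> R) : Prop :=
  measurable_fun A f /\ leb2.-integrable A (fun p => (f p ^+ 2)%:E).

Definition H1_ball (u : R * R -> R) : Prop :=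
  L2_on (ball0 1) u /\
  exists g1 g2 : R * R -> R,
    [/\ L2_on (ball0 1) g1, L2_on (ball0 1) g2 &
        forall psi, test_fun psi ->
          (\int[leb2]_(p in ball0 1) (u p * dx psi p)
             = - (\int[leb2]_(p in ball0 1) (g1 p * psi p))) /\
          (\int[leb2]_(p in ball0 1) (u p * dy psi p)
             = - (\int[leb2]_(p in ball0 1) (g2 p * psi p)))].

Definition Omega_plus (u : R * R -> R) : set (R * R) :=
  interior [set p | ball0 1 p /\ 0 <= u p].
Definition Omega_minus (u : R * R -> R) : set (R * R) :=
  [set p | ball0 1 p /\ u p < 0].

Definition chi_plus (u : R * R -> R) : R * R -> R := \1_(Omega_plus u).
Definition chi_minus (u : R * R -> R) : R * R -> R := \1_(Omega_minus u).

Definition u_plus (u : R * R -> R) : R * R -> R :=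
  fun p => chi_plus u p * u p.
Definition u_minus (u : R * R -> R) : R * R -> R :=
  fun p => chi_minus u p * u p.

(* Gradient of u: the classical gradient on Omega^+ (of u_+) and on
   Omega^- (of u_-), and 0 on the remaining set B_1 \ (Omega^+ u Omega^-)
   (which is contained in {u = 0}, where the weak gradient vanishes a.e.). *)
Definition grad (u : R * R -> R) (p : R * R) : R * R :=
  if `[< Omega_plus u p >] then (dx (u_plus u) p, dy (u_plus u) p)
  else if `[< Omega_minus u p >] then (dx (u_minus u) p, dy (u_minus u) p)
  else (0, 0).

Definition dot (a b : R * R) : R := a.1 * b.1 + a.2 * b.2.

Definition C10_field (phi : R * R -> R * R) : Prop :=
  Ck_on 1 setT (fun p => (phi p).1) /\ Ck_on 1 setT (fun p => (phi p).2) /\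
  compact_support_in (ball0 1) phi.

Definition divg (phi : R * R -> R * R) (p : R * R) : R :=
  dx (fun q => (phi q).1) p + dy (fun q => (phi q).2) p.

Definition Dphi (phi : R * R -> R * R) (p : R * R) (a b : R * R) : R :=
  dx (fun q => (phi q).1) p * a.1 * b.1 + dy (fun q => (phi q).1) p * a.1 * b.2
  + dx (fun q => (phi q).2) p * a.2 * b.1 + dy (fun q => (phi q).2) p * a.2 * b.2.

Definition div_y (phi : R * R -> R * R) (p : R * R) : R :=
  divg (fun q => (q.2 * (phi q).1, q.2 * (phi q).2)) p.

Definition variational_solution (rhop rhom : R) (u : R * R -> R) : Prop :=
  [/\ H1_ball u,
      (forall p, ball0 1 p -> {for p, continuous u}),
      Ck_on 2 (Omega_plus u) (u_plus u),
      Ck_on 2 (Omega_minus u) (u_minus u) &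
      forall phi, C10_field phi ->
        0 = \int[leb2]_(p in ball0 1)
              (dot (grad u p) (grad u p) * divg phi p
               - 2 * Dphi phi p (grad u p) (grad u p)
               - (rhop * chi_plus u p + rhom * chi_minus u p) * div_y phi p)].

(* Integral over the circle dB_r with respect to H^1 (arc length):
   int_{dB_r} f dH^1 = int_0^{2 pi} f(r cos t, r sin t) r dt. *)
Definition circ_int (r : R) (f : R * R -> R) : R :=
  \int[@lebesgue_measure R]_(t in `[0, 2 * pi]) (f (r * cos t, r * sin t) * r).

Definition Mfun (rhop rhom : R) (u : R * R -> R) (r : R) : R :=
  r ^- 3 * \int[leb2]_(p in ball0 r)
              (dot (grad u p) (grad u p)
               - p.2 * (rhop * chi_plus u p + rhom * chi_minus u p))
  - 3 / 2 * r ^- 4 * circ_int r (fun p => u p ^+ 2).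

End TwoPhase.

(* Main.v *)
(* The idea. Away from {u = 0}, inner variations together with the symmetry of second
   derivatives give (grad u) * Lap u = 0, so u is harmonic there. Testing against truncations
   of u that vanish near {u = 0} (no regularity of the free boundary is needed) yields a
   Caccioppoli estimate and, with radial cut-offs of the fields H x, H u grad u and H u^2 x, three
   identities on almost every disk B_r. Writing F(r) for the integral of F(r cos t, r sin t)
   over [0, 2 pi], they are
     - 3 int_{B_r} rho y = r^2 |grad u|^2(r) - 2 (x . grad u)^2(r) - r^2 (rho y)(r),
     int_{B_r} |grad u|^2 = (u x . grad u)(r),
     int_{B_r} (2 u^2 + 2 u x . grad u) = r^2 u^2(r);
   the last one extends to every r by continuity. Differentiating r^-3 int_{B_r} in polar
   coordinates and substituting them gives the formula. *)
Require Import Defs.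
From mathcomp Require Import all_boot all_order all_algebra.
From mathcomp Require Import all_classical all_reals all_analysis.
From mathcomp Require Import measurable_realfun ring lra.
Set Implicit Arguments. Unset Strict Implicit. Unset Printing Implicit Defensive.
Import Order.TTheory GRing.Theory Num.Theory.
Import numFieldNormedType.Exports.
Local Open Scope classical_set_scope.
Local Open Scope ring_scope.

(** * Polar coordinates *)

Section PolarCoordinates.
Context {R : realType}.
Notation mu := (@lebesgue_measure R).

(** A real-valued integral that diverges takes the default value 0, so every splitting of an
    integral needs integrability first. All integrals involve the pointwise [grad u]; its local
    square integrability comes from the truncated energy identity, whose integrands are continuous.
    That estimate is interior, hence everything happens on disks of radius [c < 1], and [c] tends to
    1 only at the end. The circle term of [Mfun] is not differentiated under the integral sign: the
    third identity turns it into a disk integral. Differentiating at [r] requires this rewriting on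
    a whole neighbourhood of [r], which is why that identity is needed at every radius, whereas the
    other two are only evaluated at [r]. Fields that contain [u] may fail to be C^1 across the zero
    set, and only those are truncated. Nothing is lost in the limit, because [grad u] vanishes at
    every zero of [u] in the disk: a zero inside [Omega_plus] is a local minimum, and elsewhere the
    value is 0 by definition. Cut-offs must be C^1, so the identities first appear with a weight;
    sharp disks come from differentiating the weight [r^2 - |x|^2] in [r], which is possible at
    almost every radius. *)

Lemma open_measurable2 (A : set (R * R)) : open A -> measurable A.
Proof.
move=> oA.
(* The sigma-algebra on the plane is the product one. Rational open boxes form a countable base of
   the product topology, so an open set is a countable union of measurable rectangles. *)
pose I (q : rat * rat * (rat * rat)) : set (R * R) :=
  [set` `](ratr q.1.1 : R), (ratr q.1.2 : R)[] `*` [set` `](ratr q.2.1 : R), (ratr q.2.2 : R)[].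
have -> : A = \bigcup_(q in [set q | I q `<=` A]) I q.
  apply/seteqP; split; last by move=> p [q /= qA /qA].
  move=> [x y] Axy; have : nbhs (x, y) A by exact: open_nbhs_nbhs.
  case=> -[/= P Q] [/= [e e0 eP] [d d0 dQ]] PQ.
  have rat2 (z r : R) : 0 < r -> exists q : rat * rat,
      (z \in `](ratr q.1 : R), (ratr q.2 : R)[) /\
      [set` `](ratr q.1 : R), (ratr q.2 : R)[] `<=` ball z r.
    move=> r0; have /rat_in_itvoo[q1 /[!in_itv]/= /andP[q11 q12]] : z - r < z by rewrite ltrBlDr ltrDl.
    have /rat_in_itvoo[q2 /[!in_itv]/= /andP[q21 q22]] : z < z + r by rewrite ltrDl.
    exists (q1, q2) => /=; rewrite in_itv/= q12 q21; split => // t /=; rewrite in_itv/= => /andP[q1t tq2].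
    by rewrite /ball/= ltr_distlC; apply/andP; split; lra.
  have [q1 [xq1 q1P]] := rat2 x e e0; have [q2 [yq2 q2Q]] := rat2 y d d0.
  exists (q1, q2); last by split.
  by move=> [x' y'] /= [h1 h2]; apply: PQ; split; [exact/eP/q1P|exact/dQ/q2Q].
rewrite bigcup_mkcond; apply: countable_bigcupT_measurable => [|q]; first exact: countableP.
case: ifPn => // _.
exact: measurableX.
Qed.

Lemma continuous_measurable2 (A : set (R * R)) (f : R * R -> R) :
  open A -> {in A, continuous f} -> measurable_fun A f.
Proof.
move=> oA; rewrite -(continuous_open_subspace f oA) => /continuousP cf.
apply: (measurability _ (@RGenOpens.measurableE R)).
move=> _ [_ [a [b ->] <-]].
have /open_subspaceP [V oV VD] := cf _ (@interval_open _ (BRight a) (BLeft b) isT isT).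
rewrite setIC -VD; apply: measurableI; exact: open_measurable2.
Qed.

Lemma ge0_tonelli (f : R * R -> \bar R) :
  measurable_fun [set: R * R] f -> (forall p, 0 <= f p)%E ->
  [/\ (\int[@leb2 R]_p f p = \int[mu]_x \int[mu]_y f (x, y))%E,
      (\int[@leb2 R]_p f p = \int[mu]_y \int[mu]_x f (x, y))%E,
      (\int[mu]_x \int[mu]_y f (x, y) = \int[mu]_y \int[mu]_x f (x, y))%E,
      measurable_fun [set: R] (fun x => \int[mu]_y f (x, y))%E &
      measurable_fun [set: R] (fun y => \int[mu]_x f (x, y))%E].
Proof.
move=> mf f0; split.
- exact (@fubini_tonelli1 _ _ (measurableTypeR R) (measurableTypeR R) R mu mu f mf f0).
- exact (@fubini_tonelli2 _ _ (measurableTypeR R) (measurableTypeR R) R mu mu f mf f0).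
- exact (@fubini_tonelli _ _ (measurableTypeR R) (measurableTypeR R) R mu mu f mf f0).
- exact (@measurable_fun_fubini_tonelli_F _ _ (measurableTypeR R) (measurableTypeR R) R mu f mf f0).
- exact (@measurable_fun_fubini_tonelli_G _ _ (measurableTypeR R) (measurableTypeR R) R mu f mf f0).
Qed.

(** Lebesgue measure coincides with [|a|] times its pushforward along multiplication by [a]: both
    agree on the intervals []x, y]], whose preimages change orientation when [a < 0]. *)
Lemma ge0_integral_scale (a : R) (g : R -> \bar R) : a != 0 ->
  measurable_fun [set: R] g -> (forall x, 0 <= g x)%E ->
  (\int[mu]_x g x = \int[mu]_x (g (a * x)%R * `|a|%:E))%E.
Proof.
move=> a0 mg g0.
have ma : measurable_fun setT ( *%R a : measurableTypeR R -> measurableTypeR R) by exact: mulrl_measurable.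
have na : (0 <= `|a|)%R by [].
rewrite ge0_integralZr//=; last exact: measurableT_comp.
under [X in (_ = X * _)%E]eq_integral do rewrite -[g _]/((g \o ( *%R a)) _).
rewrite -[setT in X in (_ = X * _)%E](preimage_setT ( *%R a)) -(ge0_integral_pushforward ma)//=.
rewrite muleC -(@ge0_integral_mscale _ _ _ _ _ measurableT (NngNum na))//=.
apply: eq_measure_integral => A mA _.
apply: lebesgue_measure_unique => // _ [[x y] _ <-].
rewrite -[RHS]/(`|a|%:E * mu ( *%R a @^-1` [set` `]x, y]]))%E.
have [a_lt0|a_gt0|a_eq0] := ltgtP a 0; last by rewrite a_eq0 eqxx in a0.
  have -> : *%R a @^-1` [set` `]x, y]] = [set` `[y / a, x / a[].
    by apply/seteqP; split => t /=; rewrite !in_itv/= andbC ler_ndivrMr// ltr_ndivlMr// mulrC.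
  rewrite lebesgue_measure_itv lebesgue_measure_itv/= !lte_fin ltr_nM2r ?invr_lt0//.
  rewrite ltr0_norm//; case: ifPn => _; rewrite ?mule0// -!EFinD -EFinM mulNr mulrBr !(mulrC a).
  by rewrite !divfK// opprB.
have -> : *%R a @^-1` [set` `]x, y]] = [set` `]x / a, y / a]].
  by apply/seteqP; split => t /=; rewrite !in_itv/= ltr_pdivrMr// ler_pdivlMr// mulrC.
rewrite lebesgue_measure_itv lebesgue_measure_itv/= !lte_fin ltr_pM2r ?invr_gt0//.
rewrite gtr0_norm//; case: ifPn => _; rewrite ?mule0// -!EFinD -EFinM mulrBr !(mulrC a).
by rewrite !divfK.
Qed.

Lemma ge0_integral_mrestr d (T : measurableType d) (m : {measure set T -> \bar R})
    (D : set T) (mD : measurable D) (f : T -> \bar R) :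
  measurable_fun [set: T] f -> (forall x, 0 <= f x)%E ->
  (\int[mrestr m mD]_x f x = \int[m]_(x in D) f x)%E.
Proof.
move=> mf f0.
rewrite (@ge0_negligible_integral _ _ _ (mrestr m mD) _ (~` D))//=; first last.
  by rewrite /mrestr setICl measure0.
  exact: measurableC.
rewrite setDE setTI setCK; apply: eq_measure_integral => A mA AD.
by rewrite /= /mrestr setIidl.
Qed.

Lemma ge0_integral_pushforwardT d1 d2 (X : measurableType d1) (Y : measurableType d2)
    (phi : X -> Y) (m : {measure set X -> \bar R}) (f : Y -> \bar R) :
  measurable_fun [set: X] phi -> measurable_fun [set: Y] f -> (forall y, 0 <= f y)%E ->
  (\int[pushforward m phi]_y f y = \int[m]_x f (phi x))%E.
Proof. by move=> mphi mf f0; rewrite ge0_integral_pushforward. Qed.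

(** The substitution [x = c - atan t], for a [g] that is only measurable. It is obtained as an
    equality of two measures on the line: the image of Lebesgue measure on the interval under
    [tan (c - x)], and the measure of density [1 / (1 + t^2)]. *)
Lemma ge0_integral_atan (c : R) (g : R -> \bar R) :
  measurable_fun [set: R] g -> (forall x, 0 <= g x)%E ->
  (\int[mu]_(x in `](c - pi / 2)%R, (c + pi / 2)%R[) g x =
   \int[mu]_t (g (c - atan t)%R * ((1 + t ^+ 2)^-1)%:E))%E.
Proof.
move=> mg g0.
have matan : measurable_fun [set: R] (fun t : R => c - atan t).
  apply: measurable_funB => //; apply: continuous_measurable_fun; exact: continuous_atan.
have md : measurable_fun [set: R] (fun t : R => (1 + t ^+ 2)^-1).
  by apply: continuous_measurable_fun; exact: continuous_oneDsqrV.
have d0 (t : R) : 0 < (1 + t ^+ 2)^-1 by rewrite invr_gt0 ltr_pwDl ?sqr_ge0.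
set I := `](c - pi / 2)%R, (c + pi / 2)%R[%classic.
have mI : measurable I by exact: measurable_itv.
pose psi := (fun x : R => tan (c - x)) \_ I.
have Ic x : I x -> c - x \in `](- (pi / 2)), (pi / 2)[.
  by rewrite /I/= !in_itv/= => /andP[? ?]; apply/andP; split; lra.
have mpsi : measurable_fun [set: R] psi.
  have : measurable_fun I (fun x : R => tan (c - x)); last exact: (measurable_restrictT _ mI).1.
  apply: (@open_continuous_measurable_fun R I); first exact: interval_open.
  move=> x /[!inE] Ix; apply: (@continuous_comp _ _ _ (fun x : R => c - x) tan).
    by apply: cvgB; [exact: cvg_cst|exact: cvg_id].
  apply: continuous_tan; rewrite gt_eqF// cos_gt0_pihalf//.
  by have := Ic _ Ix; rewrite in_itv.
(* The region under the graph of the density: projecting its area onto the first axis realises the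
   measure of density [1 / (1 + t^2)] as a pushforward. *)
pose D : set (R * R) := [set p | 0 <= p.2 <= (1 + p.1 ^+ 2)^-1].
have mD : measurable D.
  rewrite [D](_ : _ = (fun p : R * R => p.2) @^-1` [set` `[0, +oo[] `&`
     (fun p : R * R => (1 + p.1 ^+ 2)^-1 - p.2) @^-1` [set` `[0, +oo[]); last first.
    apply/seteqP; split => p /=; rewrite !in_itv/= !andbT subr_ge0.
      by move=> /andP[].
    by move=> [h1 h2]; apply/andP.
  apply: measurableI; rewrite -[X in measurable X]setTI.
    exact: measurable_snd.
  apply: (measurable_funB (measurableT_comp md measurable_fst) measurable_snd) => //.
pose m1 := pushforward (mrestr mu mI) psi.
pose m2 := pushforward (mrestr (mu \x mu)%E mD) (@fst R R).
pose h t := g (c - atan t).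
have mh : measurable_fun [set: R] h by exact: measurableT_comp.
have area (k : R -> \bar R) : measurable_fun [set: R] k -> (forall x, 0 <= k x)%E ->
    (\int[(mu \x mu)%E]_(p in D) k p.1 = \int[mu]_t (k t * ((1 + t ^+ 2)^-1)%:E))%E.
  move=> mk k0.
  have mk1 : measurable_fun [set: R * R] (fun p : R * R => k p.1) by exact: measurableT_comp.
  rewrite integral_mkcond fubini_tonelli1/=; last 2 first.
  - exact: ((measurable_restrictT _ mD).1 (measurable_funTS mk1)).
  - by move=> p; apply: erestrict_ge0.
  apply: eq_integral => t _; rewrite /fubini_F.
  transitivity (\int[mu]_(z in `[0%R, ((1 + t ^+ 2)^-1)%R]) k t)%E.
    by rewrite [RHS]integral_mkcond; apply: eq_integral => z _; rewrite !patchE !mem_setE.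
  rewrite integral_cst; last exact: measurable_itv.
  by rewrite /= lebesgue_measure_itv/= lte_fin d0 oppr0 addr0.
transitivity (\int[m1]_t h t)%E.
  apply/esym/(etrans (ge0_integral_pushforwardT (mrestr mu mI) mpsi mh _)) => [y|]; first exact: g0.
  apply: (etrans (ge0_integral_mrestr mu mI _ _)) => [|x|]; [exact: measurableT_comp|exact: g0|].
  apply: eq_integral => x xI; rewrite /h/= /psi patchE xI tanK ?subKr//.
  by apply: Ic; rewrite inE in xI.
transitivity (\int[m2]_t h t)%E.
  apply: eq_measure_integral => A mA _.
  (* Both measures give []x, y]] the mass [atan y - atan x], and the intervals []-n, n]] exhaust the
     line with finite mass. *)
  refine (@measure_unique _ R _ (@ocitv R) (fun n : nat => [set` `](- n%:R)%R, n%:R%R]]) _ _ _ _ _ _ _ _ A mA) => //.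
  - exact: ocitvI.
  - by move=> i; exact: is_ocitv.
  - apply/seteqP; split => // x _; exists (Num.truncn `|x|).+1 => //=.
    have := truncnS_gt `|x|; rewrite ltr_norml in_itv/= => /andP[-> /ltW].
    by rewrite -natr1.
  - move=> X /ocitvP[->|[[x y] /= xy ->]]; first by rewrite !measure0.
    transitivity (atan y - atan x)%:E.
      rewrite -[LHS]/(mu (psi @^-1` `]x, y] `&` I)).
      rewrite [X in mu X](_ : _ = [set` `[c - atan y, c - atan x[]).
        rewrite lebesgue_measure_itv/= lte_fin ltrD2l ltrN2 lt_atan//.
        by rewrite -EFinB; congr EFin; ring.
      apply/seteqP; split => t /=.
        move=> [+ It]; rewrite /psi patchE mem_set// !in_itv/= => /andP[xt ty].
        have tK := tanK (Ic _ It).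
        have := lt_atan xt; have := le_atan ty; rewrite tK => ? ?; apply/andP; split; lra.
      rewrite in_itv/= => /andP[yt tx].
      have It : I t.
        rewrite /I/= in_itv/=; have := atan_gtNpi2 x; have := atan_ltpi2 y => ? ?.
        by apply/andP; split; lra.
      split => //; rewrite /psi patchE mem_set// in_itv/=.
      have tK := tanK (Ic _ It).
      apply/andP; split.
        by have [//|/le_atan] := ltP x (tan (c - t)); rewrite tK => ?; lra.
      by have [//|/lt_atan] := leP (tan (c - t)) y; rewrite tK => ?; lra.
    transitivity (\int[(mu \x mu)%E]_(p in D) (\1_(`]x, y]%classic) p.1)%:E)%E; last first.
      rewrite -[RHS]/((mu \x mu)%E ((@fst R R) @^-1` `]x, y] `&` D)).
      rewrite -integral_indic//; last first.
        by rewrite -[X in measurable X]setTI; exact: measurable_fst.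
    rewrite (area (fun t => (\1_(`]x, y]%classic) t)%:E)); last 2 first.
    - by apply/measurable_EFinP; exact: measurable_indic.
    - by move=> t; rewrite lee_fin.
    transitivity (\int[mu]_(t in `]x, y]) ((1 + t ^+ 2)^-1)%:E)%E; last first.
      rewrite integral_mkcond; apply: eq_integral => t _; rewrite patchE indicE.
      by case: ifP => _; rewrite ?mul1e ?mul0e.
    rewrite integral_itv_obnd_cbnd; last by apply/measurable_EFinP; exact: measurable_funS md.
    rewrite (@continuous_FTC2 _ _ atan)//.
    - by apply: continuous_in_subspaceT => t ?; exact: continuous_oneDsqrV.
    - split.
      + by move=> t _; exact: derivable_atan.
      + by apply: cvg_at_right_filter; exact: continuous_atan.
      + by apply: cvg_at_left_filter; exact: continuous_atan.
    - by move=> t _; rewrite derive1_atan.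
  - move=> k; rewrite -[X in (X < _)%E]/(mu (psi @^-1` `](- k%:R)%R, k%:R%R] `&` I)).
    have miI : measurable (psi @^-1` `](- k%:R)%R, k%:R%R]).
      by rewrite -[X in measurable X]setTI; exact: mpsi.
    have muI : (mu `](c - pi / 2)%R, (c + pi / 2)%R[%classic < +oo)%E.
      by rewrite lebesgue_measure_itv/=; case: ifPn => // _; rewrite -EFinB ltry.
    by rewrite (le_lt_trans (measureIr mu miI mI)).
have h0 t : (0 <= h t)%E by exact: g0.
have mh1 : measurable_fun [set: R * R] (fun p : R * R => h p.1) by exact: measurableT_comp.
have := ge0_integral_pushforwardT (mrestr (mu \x mu)%E mD) (@measurable_fst _ _ R R) mh h0.
rewrite /m2 => ->.
rewrite -(area _ mh h0).
exact: (ge0_integral_mrestr (mu \x mu)%E mD mh1 (fun p => h0 p.1)).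
Qed.

Lemma ge0_integral_half (g : R -> \bar R) :
  measurable_fun [set: R] g -> (forall x, 0 <= g x)%E ->
  (\int[mu]_x g x = \int[mu]_(x in `]0%R, +oo[) (g x + g (- x)%R))%E.
Proof.
move=> mg g0; have mgN : measurable_fun [set: R] (fun x => g (- x)) by exact: measurableT_comp.
rewrite ge0_integralD//; try exact: measurable_funTS.
rewrite -[in LHS](setUv [set` `]0%R, +oo[]) setCitvr ge0_integral_setU//=; last 2 first.
- exact: measurable_funTS.
- by apply/disj_setPS => x [] /=; rewrite !in_itv/= andbT => /lt_le_trans h /h; rewrite ltxx.
congr (_ + _)%E.
transitivity (\int[mu]_(x in `[0%R, +oo[) g (- x)%R)%E; last first.
  by rewrite integral_itv_obnd_cbnd//; exact: measurable_funTS.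
rewrite ge0_integration_by_substitution0//.
by apply: eq_integral => x _; rewrite opprK.
Qed.

Lemma ge0_integral_scale_half (a : R) (g : R -> \bar R) : 0 < a ->
  measurable_fun [set: R] g -> (forall x, 0 <= g x)%E ->
  (\int[mu]_(x in `]0%R, +oo[) g x = \int[mu]_(x in `]0%R, +oo[) (g (a * x)%R * a%:E))%E.
Proof.
move=> a0 mg g0; rewrite integral_mkcond (@ge0_integral_scale a) ?gt_eqF//; last 2 first.
- by apply/(measurable_restrictT _ _).1 => //; exact: measurable_funTS.
- by move=> x; apply: erestrict_ge0.
rewrite [RHS]integral_mkcond; apply: eq_integral => x _.
rewrite !patchE !mem_setE !in_itv/= !andbT pmulr_rgt0// gtr0_norm//.
by case: ifP => _; rewrite ?mul0e.
Qed.

(* On the upper half-plane substitute x = y t, then y = s / sqrt (1 + t^2), t = tan (pi/2 - theta):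
   this reduces polar coordinates to one-dimensional changes of variables. *)
Lemma ge0_integral_halfplane (F : R * R -> \bar R) :
  measurable_fun [set: R * R] F -> (forall p, 0 <= F p)%E ->
  (\int[mu]_(y in `]0%R, +oo[) \int[mu]_x F (x, y) =
   \int[mu]_(s in `]0%R, +oo[)
     ((\int[mu]_(t in `]0%R, pi[) F (s * cos t, s * sin t)%R) * s%:E))%E.
Proof.
move=> mF F0.
(* [k t] is [cos (atan t)]. Scaling [y = k t * s] turns [y dy] into [k t ^ 2 * s ds], and [k t ^ 2]
   is exactly the weight produced by [ge0_integral_atan], used with centre [pi / 2]. *)
pose k (t : R) := (Num.sqrt (1 + t ^+ 2))^-1.
have k0 t : 0 < k t by rewrite invr_gt0 sqrtr_gt0 ltr_pwDl ?sqr_ge0.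
have k2 t : k t ^+ 2 = (1 + t ^+ 2)^-1.
  by rewrite exprVn sqr_sqrtr// addr_ge0// sqr_ge0.
transitivity (\int[mu]_(y in `]0%R, +oo[) \int[mu]_t (F (y * t, y)%R * y%:E))%E.
  apply: eq_integral => y; rewrite inE/= in_itv/= andbT => y0.
  rewrite (@ge0_integral_scale y) ?gt_eqF//; first by rewrite gtr0_norm.
  exact: measurableT_comp.
transitivity (\int[mu]_t \int[mu]_(y in `]0%R, +oo[) (F (y * t, y)%R * y%:E))%E.
  pose G (p : R * R) := ((fun p : R * R => F (p.1 * p.2, p.1)%R * p.1%:E) \_ [set p : R * R | 0 < p.1]%R p)%E.
  transitivity (\int[mu]_y \int[mu]_t G (y, t))%E.
    rewrite integral_mkcond; apply: eq_integral => y _; rewrite patchE mem_setE in_itv/= andbT.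
    case: ifPn => y0.
      by apply: eq_integral => t _; rewrite /G patchE mem_set.
    rewrite integral0_eq// => t _; rewrite /G patchE memNset//=; exact/negP.
  have mD : measurable [set p : R * R | 0 < p.1].
    rewrite [X in measurable X](_ : _ = (@fst R R) @^-1` [set` `]0, +oo[]).
      by rewrite -[X in measurable X]setTI; exact: measurable_fst.
    by apply/seteqP; split => p /=; rewrite in_itv/= andbT.
  have mG : measurable_fun [set: R * R] G.
    apply: ((measurable_restrictT _ mD).1 (measurable_funTS _)).
    apply: emeasurable_funM; last by apply/measurable_EFinP; exact: measurable_fst.
    apply: (measurableT_comp mF); apply: measurable_fun_pair => //.
    exact: measurable_funM.
  have G0 p : (0 <= G p)%E.
    by apply: erestrict_ge0 => -[x y]/= x0; rewrite mule_ge0// lee_fin ltW.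
  have [_ _ -> _ _] := ge0_tonelli mG G0.
  apply: eq_integral => t _; rewrite [RHS]integral_mkcond; apply: eq_integral => y _.
  rewrite /G !patchE !mem_setE in_itv/= andbT.
  by rewrite [in LHS](_ : ((y, t) \in _) = (0 < y)%R)//; apply/idP/idP; rewrite inE.
have sinat t : sin (atan t) = t * k t.
  by rewrite /k -cos_atan -[X in _ = X * _](atanK t) /tan divfK// cos_atan gt_eqF// k0.
transitivity (\int[mu]_t \int[mu]_(s in `]0%R, +oo[) (F (s * sin (atan t), s * cos (atan t))%R * s%:E * ((1 + t ^+ 2)^-1)%:E))%E.
  apply: eq_integral => t _.
  pose H (y : R) := (((fun y : R => F (y * t, y)%R * y%:E) \_ (`]0%R, +oo[%classic)) y)%E.
  transitivity (\int[mu]_(y in `]0%R, +oo[) H y)%E.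
    by apply: eq_integral => y y0; rewrite /H patchE y0.
  rewrite (ge0_integral_scale_half (k0 t)); last 2 first.
  - apply: ((measurable_restrictT _ (measurable_itv _)).1 (measurable_funTS _)).
    apply: emeasurable_funM; last by apply/measurable_EFinP.
    by apply: (measurableT_comp mF); apply: measurable_fun_pair => //; exact: measurable_funM.
  - by move=> y; rewrite /H patchE; case: ifPn => //; rewrite mem_setE in_itv/= andbT => y0; rewrite mule_ge0// lee_fin ltW.
  apply: eq_integral => s; rewrite mem_setE in_itv/= andbT => s0.
  rewrite /H patchE mem_setE in_itv/= andbT mulr_gt0// -!muleA; congr (F (_, _) * _)%E.
  - by rewrite sinat -mulrA mulrCA [k t * t]mulrC.
  - by rewrite cos_atan mulrC.
  - by rewrite -!EFinM; congr EFin; rewrite mulrAC -expr2 k2 mulrC.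
pose G (p : R * R) := ((fun p : R * R => F (p.2 * sin (atan p.1), p.2 * cos (atan p.1))%R * p.2%:E * ((1 + p.1 ^+ 2)^-1)%:E) \_ [set p : R * R | 0 < p.2]%R p)%E.
transitivity (\int[mu]_t \int[mu]_s G (t, s))%E.
  apply: eq_integral => t _; rewrite integral_mkcond; apply: eq_integral => s _.
  rewrite /G !patchE !mem_setE in_itv/= andbT.
  by rewrite [in RHS](_ : ((t, s) \in _) = (0 < s)%R)//; apply/idP/idP; rewrite inE.
have msin : measurable_fun [set: R] (fun t : R => sin (atan t)).
  by apply: continuous_measurable_fun => t; apply: continuous_comp; [exact: continuous_atan|exact: continuous_sin].
have mcos : measurable_fun [set: R] (fun t : R => cos (atan t)).
  by apply: continuous_measurable_fun => t; apply: continuous_comp; [exact: continuous_atan|exact: continuous_cos].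
have md : measurable_fun [set: R] (fun t : R => (1 + t ^+ 2)^-1).
  by apply: continuous_measurable_fun; exact: continuous_oneDsqrV.
have mD : measurable [set p : R * R | 0 < p.2].
  rewrite [X in measurable X](_ : _ = (@snd R R) @^-1` [set` `]0, +oo[]).
    by rewrite -[X in measurable X]setTI; exact: measurable_snd.
  by apply/seteqP; split => p /=; rewrite in_itv/= andbT.
have mG : measurable_fun [set: R * R] G.
  apply: ((measurable_restrictT _ mD).1 (measurable_funTS _)).
  apply: emeasurable_funM; last by apply/measurable_EFinP; exact: (measurableT_comp md).
  apply: emeasurable_funM; last by apply/measurable_EFinP; exact: measurable_snd.
  apply: (measurableT_comp mF); apply: measurable_fun_pair.
    by apply: measurable_funM => //; exact: (measurableT_comp msin).
  by apply: measurable_funM => //; exact: (measurableT_comp mcos).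
have G0 p : (0 <= G p)%E.
  apply: erestrict_ge0 => -[t s]/= s0.
  by rewrite !mule_ge0// lee_fin ?ltW// invr_gt0 ltr_pwDl ?sqr_ge0.
have [_ _ -> _ _] := ge0_tonelli mG G0.
rewrite [RHS]integral_mkcond; apply: eq_integral => s _; rewrite patchE mem_setE in_itv/= andbT.
case: ifPn => s0; last first.
  by rewrite integral0_eq// => t _; rewrite /G patchE memNset//=; exact/negP.
have -> : `]0%R, pi[%classic = `](pi / 2 - pi / 2)%R, (pi / 2 + pi / 2)%R[%classic :> set R.
  by rewrite subrr -splitr.
have mFs : measurable_fun [set: R] (fun t : R => F (s * cos t, s * sin t)%R).
  apply: (measurableT_comp mF); apply: measurable_fun_pair; apply: measurable_funM => //;
  apply: continuous_measurable_fun; [exact: continuous_cos|exact: continuous_sin].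
rewrite (ge0_integral_atan (pi / 2) mFs)// -ge0_integralZr//; last 3 first.
- apply: emeasurable_funM; last by apply/measurable_EFinP.
  apply: (measurableT_comp mFs); apply: measurable_funB => //.
  by apply: continuous_measurable_fun; exact: continuous_atan.
- by move=> t _; rewrite mule_ge0// lee_fin ltW// invr_gt0 ltr_pwDl ?sqr_ge0.
- by rewrite lee_fin ltW.
apply: eq_integral => t _; rewrite /G patchE mem_set//= muleAC; congr (F (_ * _, _ * _)%R * _ * _)%E.
  by rewrite -cosN opprB cosBpihalf.
by rewrite addrC sinDpihalf cosN.
Qed.

(** The lower half-plane is the image of the upper one under [p |-> - p], which shifts the angle by
    [pi]. After the arctangent substitution with centres [pi / 2] and [pi + pi / 2], the two
    half-turns become integrals over the whole line with the same weight. *)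
Lemma ge0_integral_polar (F : R * R -> \bar R) :
  measurable_fun [set: R * R] F -> (forall p, 0 <= F p)%E ->
  (\int[@leb2 R]_p F p =
   \int[mu]_(s in `]0%R, +oo[)
     ((\int[mu]_(t in `[0%R, (2 * pi)%R]) F (s * cos t, s * sin t)%R) * s%:E))%E.
Proof.
move=> mF F0.
have mFN : measurable_fun [set: R * R] (fun p => F (- p.1, - p.2)).
  apply: (measurableT_comp mF); apply: measurable_fun_pair; exact: measurableT_comp.
have mFs s : measurable_fun [set: R] (fun t : R => F (s * cos t, s * sin t)%R).
  apply: (measurableT_comp mF); apply: measurable_fun_pair; apply: measurable_funM => //;
  apply: continuous_measurable_fun; [exact: continuous_cos|exact: continuous_sin].
have [_ leb2E _ _ mG] := ge0_tonelli mF F0.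
have [_ _ _ _ mGN] := ge0_tonelli mFN (fun p => F0 _).
have mPG (H : R * R -> \bar R) : measurable_fun [set: R * R] H -> (forall p, 0 <= H p)%E ->
    measurable_fun [set` `]0%R, +oo[ : interval R] (fun s => (\int[mu]_(t in `]0%R, pi[) H (s * cos t, s * sin t)%R) * s%:E)%E.
  move=> mH H0; apply: measurable_funTS; apply: emeasurable_funM; last by apply/measurable_EFinP.
  pose K (p : R * R) := ((fun p => H (p.1 * cos p.2, p.1 * sin p.2)%R) \_ (setT `*` `]0%R, pi[%classic) p)%E.
  rewrite [X in measurable_fun _ X](_ : _ = fun s => \int[mu]_t K (s, t))%E.
    have [] // := @ge0_tonelli K; last by move=> p; exact: erestrict_ge0.
    apply: (measurable_restrictT _ _).1; first exact: measurableX.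
    apply: measurable_funTS; apply: (measurableT_comp mH); apply: measurable_fun_pair; apply: measurable_funM => //.
    - by apply: (@measurableT_comp _ _ _ _ _ _ cos) => //; apply: continuous_measurable_fun; exact: continuous_cos.
    - by apply: (@measurableT_comp _ _ _ _ _ _ sin) => //; apply: continuous_measurable_fun; exact: continuous_sin.
  apply/funext => s; rewrite integral_mkcond; apply: eq_integral => t _.
  by rewrite /K !patchE in_setX in_setT.
rewrite leb2E ge0_integral_half//; last by move=> y; apply: integral_ge0.
rewrite ge0_integralD//; last 4 first.
- by move=> y _; exact: integral_ge0.
- exact: measurable_funTS.
- by move=> y _; exact: integral_ge0.
- by apply: measurable_funTS; apply: (measurableT_comp mG).
transitivity (\int[mu]_(y in `]0%R, +oo[) \int[mu]_x F (x, y) +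
   \int[mu]_(y in `]0%R, +oo[) \int[mu]_x F (- x, - y)%R)%E.
  congr (_ + _)%E; apply: eq_integral => y _.
  rewrite (@ge0_integral_scale (-1))//; first by apply: eq_integral => x _; rewrite mulN1r normrN1 mule1.
  exact: measurableT_comp.
rewrite (ge0_integral_halfplane mF)// (ge0_integral_halfplane mFN)// -ge0_integralD//; last 4 first.
- by move=> s; rewrite /= in_itv/= andbT => s0; rewrite mule_ge0 ?integral_ge0// lee_fin ltW.
- exact: mPG.
- by move=> s; rewrite /= in_itv/= andbT => s0; rewrite mule_ge0 ?integral_ge0// lee_fin ltW.
- exact: (mPG (fun p => F (- p.1, - p.2)%R)).
apply: eq_integral => s; rewrite inE/= in_itv/= andbT => s0.
rewrite -ge0_muleDl ?integral_ge0//; congr (_ * _)%E.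
have pi0 := @pi_gt0 R.
have -> : `[0%R, (2 * pi)%R]%classic = `[0%R, pi[%classic `|` `[pi, (2 * pi)%R]%classic :> set R.
  by rewrite -(@itv_bndbnd_setU _ _ (BLeft 0%R) (BLeft pi) (BRight (2 * pi)%R)) ?bnd_simp//; lra.
rewrite ge0_integral_setU//=; last 2 first.
- exact: (measurable_funTS (mFs s)).
- apply/disj_setPS => x [] /=; rewrite !in_itv/= => /andP[_ xpi] /andP[pix _].
  by have := lt_le_trans xpi pix; rewrite ltxx.
congr (_ + _)%E.
  by rewrite integral_itv_obnd_cbnd//; exact: measurable_funTS.
transitivity (\int[mu]_(t in `]pi, (2 * pi)%R[) F (s * cos t, s * sin t)%R)%E; last first.
  rewrite integral_itv_obnd_cbnd; last exact: measurable_funTS.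
  by rewrite integral_itv_bndo_bndc//; exact: measurable_funTS.
have -> : `]0%R, pi[%classic = `](pi / 2 - pi / 2)%R, (pi / 2 + pi / 2)%R[%classic :> set R.
  by rewrite subrr -splitr.
have -> : `]pi, (2 * pi)%R[%classic = `](pi + pi / 2 - pi / 2)%R, (pi + pi / 2 + pi / 2)%R[%classic :> set R.
  by rewrite addrK -addrA -splitr mulr_natl mulr2n.
rewrite (ge0_integral_atan _ (mFs s))// ge0_integral_atan//; last first.
  apply: (measurableT_comp mF); apply: measurable_fun_pair; apply: measurableT_comp => //; apply: measurable_funM => //;
  apply: continuous_measurable_fun; [exact: continuous_cos|exact: continuous_sin].
apply: eq_integral => t _; congr (F (_, _) * _)%E.
  by rewrite -addrA [(pi + _)%R]addrC cosDpi mulrN.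
by rewrite -addrA [(pi + _)%R]addrC sinDpi mulrN.
Qed.

End PolarCoordinates.

(** * Disk integrals as radial integrals, and their derivative in the radius *)

Section PolarIntegration.
Context {R : realType}.
Notation mu := (@lebesgue_measure R).
Notation leb2 := (@leb2 R).
Notation disk := (@Defs.ball0 R).

(** There is neither a division by [2 pi] nor an arc-length factor: [s * cmean f s] is the radial
    density of the integrals of [f] over disks. *)
Definition cmean (f : R * R -> R) (s : R) : R :=
  \int[mu]_(t in `[0, 2 * pi]) f (s * cos t, s * sin t).

Definition pdom : set (R * R) := `]0, +oo[%classic `*` `[0, 2 * pi]%classic.

(** Pull-back to the plane of pairs (radius, angle) with its Jacobian, extended by zero. Keeping it
    on [R * R] makes Fubini's theorem for [leb2] applicable to signed integrands. *)
Definition pback (f : R * R -> R) : R * R -> R :=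
  (fun p => f (p.1 * cos p.2, p.1 * sin p.2) * p.1) \_ pdom.

Lemma mpdom : measurable pdom.
Proof. by apply: measurableX; exact: measurable_itv. Qed.

Lemma mpolar : measurable_fun [set: R * R] (fun p : R * R => (p.1 * cos p.2, p.1 * sin p.2)).
Proof.
apply: measurable_fun_pair; apply: measurable_funM => //.
- by apply: (@measurableT_comp _ _ _ _ _ _ cos) => //; apply: continuous_measurable_fun; exact: continuous_cos.
- by apply: (@measurableT_comp _ _ _ _ _ _ sin) => //; apply: continuous_measurable_fun; exact: continuous_sin.
Qed.

Lemma measurable_pback f : measurable_fun [set: R * R] f -> measurable_fun [set: R * R] (pback f).
Proof.
move=> mf; apply: ((measurable_restrictT _ mpdom).1 (measurable_funTS _)).
apply: measurable_funM => //; exact: (measurableT_comp mf mpolar).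
Qed.

Lemma ge0_integral_pback (f : R * R -> R) : measurable_fun [set: R * R] f -> (forall p, 0 <= f p) ->
  (\int[leb2]_p (f p)%:E = \int[leb2]_p (pback f p)%:E)%E.
Proof.
move=> mf f0.
rewrite ge0_integral_polar; last 2 first.
- exact/measurable_EFinP.
- by move=> p; rewrite lee_fin.
have pb0 p : (0 <= (pback f p)%:E)%E.
  rewrite lee_fin /pback patchE; case: ifPn => //; rewrite inE => -[/=].
  by rewrite in_itv/= andbT => p0 _; rewrite mulr_ge0// ltW.
have mpb := measurable_pback mf.
have [-> _ _ _ _] := ge0_tonelli (proj2 (measurable_EFinP _ _) mpb) pb0.
rewrite integral_mkcond; apply: eq_integral => s _; rewrite patchE.
case: ifPn => s0.
  rewrite -ge0_integralZr//; last 3 first.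
  - apply: measurable_funTS; apply/measurable_EFinP; apply: (measurableT_comp mf).
    apply: measurable_fun_pair; apply: measurable_funM => //; apply: continuous_measurable_fun;
     [exact: continuous_cos|exact: continuous_sin].
  - by move=> t _; rewrite lee_fin.
  - by move: s0; rewrite inE/= in_itv/= andbT lee_fin => /ltW.
  rewrite integral_mkcond; apply: eq_integral => t _; rewrite /comp /pback !patchE.
  by rewrite /pdom in_setX s0/=; case: ifP.
rewrite integral0_eq// => t _; rewrite /comp /pback patchE /pdom in_setX (negPf s0)//.
Qed.

Lemma integrable_pback (f : R * R -> R) : leb2.-integrable [set: R * R] (EFin \o f) ->
  leb2.-integrable [set: R * R] (EFin \o pback f) /\
  (\int[leb2]_p (f p)%:E = \int[leb2]_p (pback f p)%:E)%E.
Proof.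
move=> fi; have mf : measurable_fun [set: R * R] f.
  by apply/measurable_EFinP; exact: measurable_int fi.
have absE p : `|pback f p| = pback (fun p => `|f p|) p.
  rewrite /pback !patchE; case: ifPn; rewrite ?normr0// inE => -[/=].
  by rewrite in_itv/= andbT => p0 _; rewrite normrM (gtr0_norm p0).
have ipb : leb2.-integrable [set: R * R] (EFin \o pback f).
  apply/integrableP; split; first by apply/measurable_EFinP; exact: measurable_pback.
  under eq_integral do rewrite /= absE.
  rewrite -ge0_integral_pback//; last exact: measurableT_comp.
  by have /integrableP[] := fi.
split => //.
rewrite [LHS]integralE [RHS]integralE; congr (_ - _)%E.
- transitivity (\int[leb2]_p (Num.max (f p) 0)%:E)%E.
    by apply: eq_integral => p _; rewrite funeposE EFin_max.
  rewrite ge0_integral_pback; last 2 first.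
  + exact: measurable_maxr.
  + by move=> p; rewrite le_max lexx orbT.
  apply: eq_integral => p _; rewrite funeposE -EFin_max /pback !patchE; case: ifPn; last by rewrite maxxx.
  by rewrite inE => -[/= + _]; rewrite in_itv/= andbT => p0; rewrite maxr_pMl ?mul0r// ltW.
- transitivity (\int[leb2]_p (Num.max (- f p) 0)%:E)%E.
    by apply: eq_integral => p _; rewrite funenegE EFin_max.
  rewrite ge0_integral_pback; last 2 first.
  + by apply: measurable_maxr => //; exact: measurableT_comp.
  + by move=> p; rewrite le_max lexx orbT.
  apply: eq_integral => p _; rewrite funenegE -EFinN -EFin_max /pback !patchE; case: ifPn; last by rewrite oppr0 maxxx.
  by rewrite inE => -[/= + _]; rewrite in_itv/= andbT => p0; rewrite maxr_pMl ?mul0r ?mulNr// ltW.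
Qed.

Lemma open_ball0 (r : R) : open (disk r).
Proof.
pose q (p : R * R) := p.1 ^+ 2 + p.2 ^+ 2.
have cq : continuous q.
  move=> p; apply: cvgD.
    by apply: (@continuous_comp _ _ _ fst (fun x : R => x ^+ 2)); [exact: cvg_fst|exact: exprn_continuous].
  by apply: (@continuous_comp _ _ _ snd (fun x : R => x ^+ 2)); [exact: cvg_snd|exact: exprn_continuous].
have -> : disk r = q @^-1` [set x | x < r ^+ 2] by [].
by apply: open_comp => // p _; exact: cq.
Qed.

Lemma measurable_ball0 (r : R) : measurable (disk r).
Proof. by apply: open_measurable2; exact: open_ball0. Qed.

Lemma ball0_polar (r s t : R) : 0 < r -> 0 < s ->
  disk r (s * cos t, s * sin t) <-> s < r.
Proof.
move=> r0 s0; rewrite /Defs.ball0/=.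
have -> : (s * cos t) ^+ 2 + (s * sin t) ^+ 2 = s ^+ 2.
  by rewrite !exprMn -mulrDr cos2Dsin2 mulr1.
by rewrite ltr_pXn2r// nnegrE ltW.
Qed.

(** Positive and negative parts are scaled separately, so infinite integrals are covered too;
    [polar_ball] needs this at the exceptional radii, where the integral over the circle may
    diverge. *)
Lemma integral_mulr_gt0 d (T : measurableType d) (m : {measure set T -> \bar R}) (D : set T)
    (g : T -> R) (r : R) : measurable D -> measurable_fun D g -> 0 < r ->
  (\int[m]_(x in D) (g x * r)%:E = \int[m]_(x in D) (g x)%:E * r%:E)%E.
Proof.
move=> mD mg r0.
have mP : (r%:E * \int[m]_(x in D) (EFin \o g)^\+ x = \int[m]_(x in D) (EFin \o (fun x => g x * r)%R)^\+ x)%E.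
  rewrite -ge0_integralZl_EFin//; last 2 first.
  - by apply: measurable_funepos; exact/measurable_EFinP.
  - exact: ltW.
  by apply: eq_integral => x _; rewrite !funeposE -!EFin_max -EFinM maxr_pMr ?mulr0 1?mulrC// ltW.
have mN : (r%:E * \int[m]_(x in D) (EFin \o g)^\- x = \int[m]_(x in D) (EFin \o (fun x => g x * r)%R)^\- x)%E.
  rewrite -ge0_integralZl_EFin//; last 2 first.
  - by apply: measurable_funeneg; exact/measurable_EFinP.
  - exact: ltW.
  by apply: eq_integral => x _; rewrite !funenegE -!EFinN -!EFin_max -EFinM maxr_pMr ?mulr0 1?mulrC ?mulNr// ltW.
rewrite [LHS]integralE -mP -mN [in RHS]integralE [RHS]muleC.
have : (0 <= \int[m]_(x in D) (EFin \o g)^\+ x)%E by exact: integral_ge0.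
have : (0 <= \int[m]_(x in D) (EFin \o g)^\- x)%E by exact: integral_ge0.
move: (\int[m]_(x in D) _)%E (\int[m]_(x in D) _)%E => [b| |] [a| |]//= _ _.
- by rewrite -[LHS]/((r * b - r * a)%:E) -[RHS]/((r * (b - a))%:E) mulrBr.
- by rewrite gt0_muley ?lte_fin//= gt0_muleNy ?lte_fin.
- by rewrite !gt0_muley ?lte_fin.
- by rewrite !gt0_muley ?lte_fin//= gt0_muleNy ?lte_fin.
Qed.

Lemma integrable_patch (D : set R) (f : R -> \bar R) : measurable D ->
  mu.-integrable D f <-> mu.-integrable [set: R] (f \_ D).
Proof. by move=> mD; exact (@integrable_mkcond _ (measurableTypeR R) R mu D f mD). Qed.

Lemma ae_imp (P Q : R -> Prop) : (forall x, P x -> Q x) ->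
  {ae mu, forall x, P x} -> {ae mu, forall x, Q x}.
Proof. by move=> PQ; apply: filterS; first exact: (ae_filter_ringOfSetsType mu). Qed.

Lemma ae_and (P Q : R -> Prop) :
  {ae mu, forall x, P x} -> {ae mu, forall x, Q x} -> {ae mu, forall x, P x /\ Q x}.
Proof. by move=> aP aQ; apply: filterI => //; exact: (ae_filter_ringOfSetsType mu). Qed.

Lemma fubini2 (f : R * R -> \bar R) : leb2.-integrable [set: R * R] f ->
  [/\ {ae mu, forall x, mu.-integrable [set: R] (fun y => f (x, y))},
      mu.-integrable [set: R] (fun x => \int[mu]_y f (x, y))%E,
      (\int[mu]_x \int[mu]_y f (x, y) = \int[leb2]_p f p)%E &
      (\int[mu]_y \int[mu]_x f (x, y) = \int[leb2]_p f p)%E].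
Proof.
move=> fi; split.
- exact (@ae_integrable1 _ _ (measurableTypeR R) (measurableTypeR R) R mu mu f fi).
- exact (@integrable_fubini_F _ _ (measurableTypeR R) (measurableTypeR R) R mu mu f fi).
- exact (@integral12_prod_meas1 _ _ (measurableTypeR R) (measurableTypeR R) R mu mu f fi).
- exact (@integral21_prod_meas1 _ _ (measurableTypeR R) (measurableTypeR R) R mu mu f fi).
Qed.

(** Fubini applied to the pull-back of [f] cut off outside the disk: its row at radius [s] is [s]
    times [f] on the circle if [0 < s < c], and zero otherwise. *)
Lemma polar_ball (f : R * R -> R) (c : R) : 0 < c ->
  leb2.-integrable (disk c) (EFin \o f) ->
  [/\ {ae mu, forall s, s \in `]0, c[ ->
        mu.-integrable `[0, 2 * pi] (EFin \o (fun t => f (s * cos t, s * sin t)))},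
      mu.-integrable `]0, c[ (EFin \o (fun s => s * cmean f s)) &
      \int[leb2]_(p in disk c) f p = \int[mu]_(s in `]0, c[) (s * cmean f s)].
Proof.
move=> c0 fi.
have {}fi : leb2.-integrable [set: R * R] (EFin \o (f \_ (disk c))).
  by rewrite -restrict_EFin; apply/integrable_restrict => //; [exact: measurable_ball0|rewrite setTI].
have [pbi intE] := integrable_pback fi.
have rowi s : s \in `]0, c[ -> (EFin \o pback (f \_ (disk c))) \o (fun t => (s, t)) =
   (fun t => (f (s * cos t, s * sin t) * s)%:E) \_ `[0, 2 * pi]%classic.
  rewrite in_itv/= => /andP[s0 sc]; apply/funext => t.
  rewrite /pback /= !patchE in_setX mem_setE in_itv/= andbT s0/=; case: ifP => // _.
  by rewrite mem_set//; apply/(ball0_polar _ c0 s0).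
have row0 s : s \notin `]0, c[ -> (EFin \o pback (f \_ (disk c))) \o (fun t => (s, t)) = cst 0%E.
  rewrite in_itv/= negb_and => h; apply/funext => t.
  rewrite /pback /= !patchE in_setX mem_setE in_itv/= andbT.
  have [s0|//] := boolP (0 < s); case: ifP => //= _.
  rewrite memNset ?mul0r//; move: h; rewrite s0/= => sc; move/(ball0_polar _ c0 s0).
  by rewrite (negPf sc).
have [ae1 Fi FE _] := fubini2 pbi.
have ae2 : {ae mu, forall s, s \in `]0, c[ ->
        mu.-integrable `[0, 2 * pi] (EFin \o (fun t => f (s * cos t, s * sin t)))}.
  apply: ae_imp ae1 => s /= + s0c; have s0 : 0 < s by move: s0c; rewrite in_itv/= => /andP[].
  rewrite -[X in mu.-integrable _ X]/((EFin \o pback (f \_ (disk c))) \o (fun t => (s, t))) rowi//.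
  move=> h0; have h := (integrable_patch _ (measurable_itv _)).2 h0.
  have {h} := @integrableZr _ (measurableTypeR R) R mu _ (measurable_itv _) s^-1 _ h; apply: eq_integrable => [|t _ /=]; first exact: measurable_itv.
  by rewrite -EFinM mulfK// gt_eqF.
pose F s := (\int[mu]_t (pback (f \_ (disk c)) (s, t))%:E)%E.
have mfs s : s \in `]0, c[ -> measurable_fun `[0, 2 * pi] (fun t => f (s * cos t, s * sin t)).
  move=> s0c; have s0 : 0 < s by move: s0c; rewrite in_itv/= => /andP[].
  have mrow : measurable_fun [set: R] ((EFin \o pback (f \_ (disk c))) \o (fun t => (s, t))).
    by apply: measurableT_comp; [exact: measurable_int pbi|exact: measurable_pair1].
  rewrite rowi// in mrow.
  have /measurable_EFinP {mrow} := (measurable_restrictT _ (measurable_itv _)).2 mrow => h.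
  have {h} := measurable_funM h (measurable_cst s^-1); apply: eq_measurable_fun => t _ /=.
  by rewrite mulfK// gt_eqF.
(* This holds for every [s]: if the row integral is infinite, [fine] makes both sides 0. *)
have kE : (fun s => s * cmean f s) \_ `]0, c[%classic = fine \o F.
  apply/funext => s; rewrite patchE /= /F; case: ifPn => [|] s0c.
    have {}s0c : s \in `]0, c[ by rewrite inE in s0c.
    have s0 : 0 < s by move: s0c; rewrite in_itv/= => /andP[].
    have := rowi _ s0c => /(congr1 (fun g => \int[mu]_t g t)%E) /= ->.
    rewrite -integral_mkcond integral_mulr_gt0//; last exact: mfs.
    rewrite /cmean /Rintegral.
    case: (integral _ _ _) => [x| |]/=; rewrite ?mulr0 1?mulrC//.
      by rewrite gt0_mulye.
    by rewrite gt0_mulNye.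
  have {}s0c : s \notin `]0, c[ by apply: contra s0c; rewrite inE.
  by have := row0 _ s0c => /(congr1 (fun g => \int[mu]_t g t)%E) /= ->; rewrite integral0.
have mF : measurable_fun [set: R] (fine \o F).
  by apply: measurableT_comp => //; exact: measurable_int Fi.
have fF s : (`|(fine (F s))%:E| <= `|F s|)%E by case: (F s) => [x||]; rewrite //= ?normr0 ?leey.
have fFi : mu.-integrable [set: R] (EFin \o (fine \o F)).
  have mEF : measurable_fun [set: R] (EFin \o (fine \o F)) by exact/measurable_EFinP.
  exact: (@le_integrable _ (measurableTypeR R) R mu setT measurableT _ F mEF (fun s _ => fF s) Fi).
split => //.
- apply: (integrable_patch _ (measurable_itv _)).2.
  by rewrite restrict_EFin kE.
- rewrite [LHS]Rintegral_mkcond [RHS]Rintegral_mkcond kE /Rintegral; congr fine.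
  rewrite intE -FE; apply: ae_eq_integral => //.
  + exact: measurable_int Fi.
  + by apply/measurable_EFinP.
  + have := integrable_ae measurableT Fi; apply: ae_imp => s /(_ I) Fs _ /=.
    by rewrite fineK.
Qed.

Lemma polar_disk (f : R * R -> R) (c r : R) : 0 < r -> r <= c ->
  leb2.-integrable (disk c) (EFin \o f) ->
  \int[leb2]_(p in disk r) f p = \int[mu]_(s in `]0, r[) (s * cmean f s).
Proof.
move=> r0 rc fi; have [//|_ _ ->//] := @polar_ball f r r0.
apply: integrableS fi; [exact: measurable_ball0..|].
move=> p; rewrite /Defs.ball0/= => /lt_le_trans; apply.
by rewrite ler_sqr// nnegrE ltW// (lt_le_trans r0).
Qed.

(** Lebesgue differentiation of the radial density. Extended by zero to [k'], it is integrable on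
    the line, and its primitive from minus infinity agrees near [r] with the disk integral. *)
Lemma derive_disk (f : R * R -> R) (c : R) : 0 < c ->
  leb2.-integrable (disk c) (EFin \o f) ->
  {ae mu, forall r, r \in `]0, c[ ->
     is_derive r 1 (fun r => \int[leb2]_(p in disk r) f p) (r * cmean f r)}.
Proof.
move=> c0 fi; have [_ ki _] := polar_ball c0 fi.
set k := fun s => s * cmean f s in ki.
pose k' := k \_ `]0, c[%classic.
have k'i : mu.-integrable [set: R] (EFin \o k').
  by rewrite -restrict_EFin; exact: ((integrable_patch _ (measurable_itv _)).1 ki).
have k'i1 y : mu.-integrable `]-oo, y] (EFin \o k') by exact: integrableS k'i.
have lk' : locally_integrable [set: R] k'.
  by apply: open_integrable_locally => //; exact: openT.
have := FTC1Ny k'i1 lk'; apply: ae_imp => r [dF F'] rc.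
have r0c := rc; move: rc; rewrite in_itv/= => /andP[r0 rc].
have -> : r * cmean f r = k' r by rewrite /k' patchE mem_set.
have dk : is_derive r 1 (fun x => \int[mu]_(t in `]-oo, x]) k' t) (k' r).
  by rewrite -F' derive1E; exact/derivableP.
apply: near_eq_is_derive dk; near=> x.
have x0 : 0 < x by near: x; exact: lt_nbhsr.
have xc : x < c by near: x; exact: lt_nbhsl.
rewrite (polar_disk x0 (ltW xc) fi) -Rintegral_itv_bndo_bndc; last exact: integrableS k'i.
rewrite [LHS]Rintegral_mkcond [RHS]Rintegral_mkcond; apply: eq_Rintegral => t _.
rewrite /k' !patchE !mem_setE !in_itv/=; have [tx|_] := ltP t x; last by rewrite andbF.
by rewrite (lt_trans tx xc) andbT.
Unshelve. all: by end_near.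
Qed.

End PolarIntegration.

(** * Radial cut-offs *)

Section Toolbox.
Context d (T : measurableType d) (R : realType) (m : {measure set T -> \bar R}).
Variables (D : set T) (mD : measurable D).

Lemma integrable_le (f g : T -> R) : measurable_fun D f ->
  (forall x, D x -> `|f x| <= g x) -> m.-integrable D (EFin \o g) -> m.-integrable D (EFin \o f).
Proof.
move=> mf fg; apply: le_integrable => //; first exact/measurable_EFinP.
by move=> x Dx /=; rewrite lee_fin (le_trans (fg x Dx))// ler_norm.
Qed.

Lemma integrable_bdM (f h : T -> R) (M : R) : measurable_fun D h ->
  (forall x, D x -> `|h x| <= M) -> m.-integrable D (EFin \o f) ->
  m.-integrable D (EFin \o (fun x => h x * f x)).
Proof.
move=> mh hM fi.
have mf : measurable_fun D f by apply/measurable_EFinP; exact: measurable_int fi.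
apply: (@integrable_le _ (fun x => M * `|f x|)); first exact: measurable_funM.
  by move=> x Dx; rewrite normrM ler_wpM2r// hM.
have := integrableZl mD M (integrable_abse fi); apply: eq_integrable => // x _.
Qed.

Lemma cvg_Rintegral_dom (f_ : nat -> T -> R) (f g : T -> R) :
  (forall n, measurable_fun D (f_ n)) ->
  (forall x, D x -> f_ n x @[n --> \oo] --> f x) ->
  m.-integrable D (EFin \o g) -> (forall n x, D x -> `|f_ n x| <= g x) ->
  m.-integrable D (EFin \o f) /\
  \int[m]_(x in D) f_ n x @[n --> \oo] --> \int[m]_(x in D) f x.
Proof.
move=> mf_ cf gi fg.
have mf : measurable_fun D f by exact: measurable_fun_cvg mf_ cf.
have [|||||fi _ cI] := @dominated_convergence _ _ _ m D mD (fun n => EFin \o f_ n) (EFin \o f) (EFin \o g).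
- by move=> n; exact/measurable_EFinP.
- exact/measurable_EFinP.
- by apply/aeW => x Dx; apply: cvg_EFin; [exact: nearW|exact: cf].
- exact: gi.
- by apply/aeW => x n Dx; rewrite lee_fin fg.
split => //; apply: fine_cvg; rewrite /= fineK; first exact: cI.
exact: integrable_fin_num.
Qed.

End Toolbox.

(** * Rules for directional derivatives *)

Section Calculus.
Context {R : realType} {V : normedModType R}.
Implicit Types (f g : V -> R) (x v : V) (df dg c : R).

Lemma isd_cst c x v : is_derive x v (fun=> c) (0 : R).
Proof. exact: is_derive_cst. Qed.

Lemma isd_add f g x v df dg : is_derive x v f df -> is_derive x v g dg ->
  is_derive x v (fun p => f p + g p) (df + dg).
Proof. exact: is_deriveD. Qed.

Lemma isd_opp f x v df : is_derive x v f df -> is_derive x v (fun p => - f p) (- df).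
Proof. exact: is_deriveN. Qed.

Lemma isd_sub f g x v df dg : is_derive x v f df -> is_derive x v g dg ->
  is_derive x v (fun p => f p - g p) (df - dg).
Proof. by move=> hf hg; apply: isd_add => //; exact: isd_opp. Qed.

Lemma isd_mul f g x v df dg : is_derive x v f df -> is_derive x v g dg ->
  is_derive x v (fun p => f p * g p) (df * g x + f x * dg).
Proof.
by move=> hf hg; apply: is_derive_eq (is_deriveM hf hg) _; rewrite /GRing.scale/= addrC [g x * _]mulrC.
Qed.

(** Passing to the line through [x] makes one-variable results, such as the chain rule, available
    for directional derivatives. *)
Lemma isd_line f x v df :
  is_derive x v f df <-> is_derive (0 : R) (1 : R) (fun h : R => f (h *: v + x)) df.
Proof.
have E : 'D_v f x = 'D_1 (fun h : R => f (h *: v + x)) 0.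
  rewrite /derive; set g1 := fun h => h^-1 *: _; set g2 := fun h => h^-1 *: _.
  suff -> : g1 = g2 by []; apply/funext => h; rewrite /g1 /g2 /=.
  by rewrite addr0 scale0r add0r [_%:A]mulr1.
split => -[d1 d2]; apply: DeriveDef; [exact: (proj1 (derivable1P f x v) d1)|by rewrite -E|exact: (proj2 (derivable1P f x v) d1)|by rewrite E].
Qed.

Lemma isd_comp (h : R -> R) f x v dh df : is_derive (f x) 1 h dh -> is_derive x v f df ->
  is_derive x v (fun p => h (f p)) (dh * df).
Proof.
move=> hh /isd_line hf; apply/isd_line.
apply: (@is_derive1_comp _ h (fun t : R => f (t *: v + x))) => //.
by rewrite scale0r add0r.
Qed.

End Calculus.

Section Cut.
Context {R : realType}.
Implicit Types e t : R.

(* a C^1 regularisation of t |-> max t 0 vanishing for t <= e *)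
Definition scut e t := (Num.max t e - e) ^+ 2 / Num.max t e.
(** For [t > e], [scut e t] equals [t - 2 e + e^2 / t], whose derivative this is. With this rational
    profile the later comparisons between [scut] and [dscut] reduce to polynomial inequalities. *)
Definition dscut e t := 1 - (e / Num.max t e) ^+ 2.

Lemma max_gt0 e t : 0 < e -> 0 < Num.max t e.
Proof. by move=> e0; rewrite lt_max e0 orbT. Qed.

Lemma scut_eq0 e t : t <= e -> scut e t = 0.
Proof. by move=> te; rewrite /scut max_r// subrr expr0n mul0r. Qed.

Lemma dscut_eq0 e t : 0 < e -> t <= e -> dscut e t = 0.
Proof. by move=> e0 te; rewrite /dscut max_r// divff ?gt_eqF// expr1n subrr. Qed.

Lemma scut_ge0 e t : 0 < e -> 0 <= scut e t.
Proof. by move=> e0; rewrite divr_ge0 ?sqr_ge0// ltW// max_gt0. Qed.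

Lemma scut_le e t : 0 < e -> scut e t <= Num.max t 0.
Proof.
move=> e0; have [te|et] := leP t e; first by rewrite scut_eq0// le_max lexx orbT.
have t0 := lt_trans e0 et.
have m0 := max_gt0 t e0; rewrite le_max; apply/orP; left.
rewrite /scut ler_pdivrMr// max_l ?ltW//; nra.
Qed.

Lemma dscut_ge0 e t : 0 < e -> 0 <= dscut e t.
Proof.
move=> e0; have m0 := max_gt0 t e0; rewrite subr_ge0 exprn_ile1// ?divr_ge0// ?(ltW e0) ?(ltW m0)//.
by rewrite ler_pdivrMr// mul1r le_max lexx orbT.
Qed.

Lemma dscut_le1 e t : dscut e t <= 1.
Proof. by rewrite lerBlDr lerDl sqr_ge0. Qed.

Lemma continuous_maxe e : continuous (fun t => Num.max t e).
Proof. by move=> t; apply: continuous_max; [exact: cvg_id|exact: cvg_cst]. Qed.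

Lemma continuous_scut e : 0 < e -> continuous (scut e).
Proof.
move=> e0 t; apply: cvgM; last first.
  by apply: cvgV; [rewrite gt_eqF// max_gt0|exact: continuous_maxe].
by apply: cvgM; (apply: cvgB; [exact: continuous_maxe|exact: cvg_cst]).
Qed.

Lemma continuous_dscut e : 0 < e -> continuous (dscut e).
Proof.
move=> e0 t; apply: cvgB; first exact: cvg_cst.
by apply: cvgM; (apply: cvgM; [exact: cvg_cst|apply: cvgV; [rewrite gt_eqF// max_gt0|exact: continuous_maxe]]).
Qed.

Lemma is_derive_quad (f : R -> R) (a C : R) :
  (forall t, `|f t - f a| <= C * (t - a) ^+ 2) -> is_derive a 1 f 0.
Proof.
move=> fC.
have C0 : 0 <= C by have := fC (a + 1); rewrite addrAC subrr add0r expr1n mulr1; apply: le_trans.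
have h0 : (fun h : R => h^-1 *: (f (h *: 1 + a) - f a)) @ 0^' --> (0 : R).
  apply/cvgr0Pnorm_lt => e e0; near=> h.
  have hn0 : h != 0 by near: h; exact: nbhs_dnbhs_neq.
  rewrite normrM normfV mulrC ltr_pdivrMr ?normr_gt0//.
  have := fC (h *: 1 + a); rewrite addrK /= /GRing.scale/= mulr1 => /le_lt_trans; apply.
  rewrite -normr_id -[h ^+ 2]real_normK ?num_real// expr2 normr_id mulrA ltr_pM2r ?normr_gt0//.
  have : `|h| < e / (C + 1).
    by near: h; apply: dnbhs0_lt; rewrite divr_gt0// ltr_wpDl.
  rewrite ltr_pdivlMr ?ltr_wpDl// => h1; apply: le_lt_trans h1.
  by rewrite mulrC ler_wpM2l// lerDl.
by apply: DeriveDef; [apply/cvg_ex; exists 0|exact/cvg_lim].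
Unshelve. all: by end_near.
Qed.

Lemma is_derive_scut e t : 0 < e -> is_derive t 1 (scut e) (dscut e t).
Proof.
move=> e0; have [te|et|->] := ltgtP t e.
- rewrite dscut_eq0 ?ltW//; have d0 : is_derive t (1 : R) (cst (0 : R)) 0 by exact: is_derive_cst.
  apply: near_eq_is_derive d0.
  by near=> x; rewrite scut_eq0//; apply/ltW; near: x; exact: lt_nbhsl.
- have t0 : 0 < t := lt_trans e0 et.
  have d1 : is_derive t (1 : R) (fun x => (x - e) ^+ 2 * x^-1) (dscut e t).
    have dV : is_derive t (1 : R) (fun x => x^-1) (- t^-2).
      have := @is_deriveV _ id t 1 1 (lt0r_neq0 t0) (is_derive_id _ _).
      by rewrite /GRing.scale/= mulr1.
    have d0 : is_derive t (1 : R) (fun x => x - e) (1 - 0).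
      exact: isd_sub.
    have := isd_mul (isd_mul d0 d0) dV.
    have -> : dscut e t = ((1 - 0) * (t - e) + (t - e) * (1 - 0)) * t^-1 + (t - e) * (t - e) * - t^-2.
      by rewrite /dscut (max_l (ltW et)); field; lra.
    by [].
  apply: near_eq_is_derive d1; near=> x.
  by rewrite /scut max_l// ltW//; near: x; exact: lt_nbhsr.
(* At the junction [t = e] no single formula is valid on a neighbourhood; instead
   [0 <= scut e x <= (x - e)^2 / e] forces a zero derivative. *)
- rewrite dscut_eq0//; apply: (is_derive_quad (C := e^-1)) => x.
  rewrite (scut_eq0 (lexx e)) subr0 ger0_norm ?scut_ge0// mulrC.
  have m0 := max_gt0 x e0; rewrite /scut; apply: ler_pM; rewrite ?sqr_ge0// ?invr_ge0 ?(ltW m0)//.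
    by case: (leP x e) => _; rewrite ?subrr ?expr0n ?sqr_ge0.
  by rewrite lef_pV2// le_max lexx orbT.
Unshelve. all: by end_near.
Qed.

Lemma scut_pos e t : e < t -> scut e t = (t - e) ^+ 2 / t.
Proof. by move=> et; rewrite /scut max_l ?ltW. Qed.

Lemma dscut_pos e t : e < t -> dscut e t = 1 - (e / t) ^+ 2.
Proof. by move=> et; rewrite /dscut max_l ?ltW. Qed.

Lemma cvgV0 : (n.+1%:R^-1 : R) @[n --> \oo] --> (0 : R).
Proof. exact: cvg_harmonic. Qed.

Lemma cvg_scut t : scut n.+1%:R^-1 t @[n --> \oo] --> Num.max t 0.
Proof.
have [t0|t0] := leP t 0.
  apply: cvg_near_cst; apply: nearW => n; rewrite scut_eq0//.
  by rewrite (le_trans t0)// invr_ge0.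
have : (t - n.+1%:R^-1) ^+ 2 / t @[n --> \oo] --> t.
  rewrite [X in _ --> X](_ : t = (t - 0) ^+ 2 / t); last by rewrite subr0 expr2 mulfK// gt_eqF.
  by apply: cvgM; [apply: cvgM; (apply: cvgB; [exact: cvg_cst|exact: cvgV0])|exact: cvg_cst].
apply: cvg_trans; apply: near_eq_cvg; near=> n; rewrite scut_pos//.
near: n; exact: (cvgr_lt _ cvgV0).
Unshelve. all: by end_near.
Qed.

Lemma cvg_dscut t : dscut n.+1%:R^-1 t @[n --> \oo] --> (if 0 < t then 1 else 0 : R).
Proof.
case: ifPn => [t0|]; last first.
  rewrite -leNgt => t0; apply: cvg_near_cst; apply: nearW => n; rewrite dscut_eq0 ?invr_gt0//.
  by rewrite (le_trans t0)// invr_ge0.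
have : 1 - (n.+1%:R^-1 / t) ^+ 2 @[n --> \oo] --> (1 : R).
  rewrite [X in _ --> X](_ : 1 = 1 - (0 / t) ^+ 2); last by rewrite mul0r expr0n subr0.
  apply: cvgB; first exact: cvg_cst.
  by apply: cvgM; (apply: cvgM; [exact: cvgV0|exact: cvg_cst]).
apply: cvg_trans; apply: near_eq_cvg; near=> n; rewrite dscut_pos//.
near: n; exact: (cvgr_lt _ cvgV0).
Unshelve. all: by end_near.
Qed.

End Cut.

Section Radial.
Context {R : realType}.
Notation mu := (@lebesgue_measure R).
Notation leb2 := (@leb2 R).
Notation disk := (@Defs.ball0 R).

Definition qn (p : R * R) : R := p.1 ^+ 2 + p.2 ^+ 2.

Lemma mdisk r : measurable (disk r : set (measurableTypeR R * measurableTypeR R)).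
Proof. exact: measurable_ball0. Qed.

Lemma qn_ge0 p : 0 <= qn p.
Proof. by rewrite addr_ge0// sqr_ge0. Qed.

Lemma qn_polar (s t : R) : qn (s * cos t, s * sin t) = s ^+ 2.
Proof. by rewrite /qn/= !exprMn -mulrDr cos2Dsin2 mulr1. Qed.

Lemma measurable_qn : measurable_fun [set: R * R] qn.
Proof. by apply: measurable_funD; apply: measurable_funX. Qed.

Lemma cmeanZl (f : R * R -> R) (a : R) (r : R) :
  mu.-integrable `[0, 2 * pi] (EFin \o (fun t => f (r * cos t, r * sin t))) ->
  cmean (fun p => a * f p) r = a * cmean f r.
Proof.
by move=> fi; rewrite /cmean RintegralZl.
Qed.

Lemma cmeanD (f g : R * R -> R) (r : R) :
  mu.-integrable `[0, 2 * pi] (EFin \o (fun t => f (r * cos t, r * sin t))) ->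
  mu.-integrable `[0, 2 * pi] (EFin \o (fun t => g (r * cos t, r * sin t))) ->
  cmean (fun p => f p + g p) r = cmean f r + cmean g r.
Proof. by move=> fi gi; rewrite /cmean RintegralD. Qed.

Lemma eq_cmean (f g : R * R -> R) (r : R) :
  (forall t, f (r * cos t, r * sin t) = g (r * cos t, r * sin t)) -> cmean f r = cmean g r.
Proof. by move=> fg; rewrite /cmean; apply: eq_Rintegral => t _. Qed.

(** Dominated convergence along [e = 1 / (n + 1)]: the weights satisfy [0 <= scut <= b] and
    [0 <= dscut <= 1] because [qn] is nonnegative, so [b |P|] and [|Q|] dominate. *)
Lemma radial_limit (P Q : R * R -> R) (c b : R) : 0 < b ->
  leb2.-integrable (disk c) (EFin \o P) -> leb2.-integrable (disk c) (EFin \o Q) ->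
  (forall e, 0 < e -> \int[leb2]_(p in disk c) (scut e (b - qn p) * P p) =
     2 * \int[leb2]_(p in disk c) (dscut e (b - qn p) * Q p)) ->
  \int[leb2]_(p in disk c) (Num.max (b - qn p) 0 * P p) =
     2 * \int[leb2]_(p in disk c) ((if 0 < b - qn p then 1 else 0) * Q p).
Proof.
move=> b0 Pi Qi PQ.
have mD := mdisk c.
have mq : measurable_fun (disk c) (fun p => b - qn p).
  by apply: measurable_funB => //; apply: measurable_funTS; exact: measurable_qn.
have mP : measurable_fun (disk c) P by apply/measurable_EFinP; exact: measurable_int Pi.
have mQ : measurable_fun (disk c) Q by apply/measurable_EFinP; exact: measurable_int Qi.
have eV0 n : 0 < n.+1%:R^-1 :> R by rewrite invr_gt0.
have [||||_ c1] := @cvg_Rintegral_dom _ _ _ leb2 _ mD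
   (fun n p => scut n.+1%:R^-1 (b - qn p) * P p) (fun p => Num.max (b - qn p) 0 * P p)
   (fun p => b * `|P p|).
- move=> n; apply: measurable_funM => //.
  by apply: measurableT_comp mq; apply: continuous_measurable_fun; exact: continuous_scut.
- by move=> p _; apply: cvgM; [exact: cvg_scut|exact: cvg_cst].
- have := integrableZl mD b (integrable_abse Pi); apply: eq_integrable => // p _.
- move=> n p _; rewrite normrM ler_wpM2r// ger0_norm ?scut_ge0// (le_trans (scut_le _ _))//.
  by rewrite ge_max (ltW b0) andbT lerBlDr lerDl qn_ge0.
have [||||_ c2] := @cvg_Rintegral_dom _ _ _ leb2 _ mD
   (fun n p => dscut n.+1%:R^-1 (b - qn p) * Q p) (fun p => (if 0 < b - qn p then 1 else 0) * Q p)
   (fun p => `|Q p|).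
- move=> n; apply: measurable_funM => //.
  by apply: measurableT_comp mq; apply: continuous_measurable_fun; exact: continuous_dscut.
- by move=> p _; apply: cvgM; [exact: cvg_dscut|exact: cvg_cst].
- have := integrable_abse Qi; apply: eq_integrable => // p _.
- by move=> n p _; rewrite normrM ler_piMl// ger0_norm ?dscut_ge0// dscut_le1.
have c3 : (fun n => 2 * \int[leb2]_(p in disk c) (dscut n.+1%:R^-1 (b - qn p) * Q p)) @ \oo -->
    2 * \int[leb2]_(p in disk c) ((if 0 < b - qn p then 1 else 0) * Q p).
  by apply: cvgM; [exact: cvg_cst|exact: c2].
apply: (cvg_unique (@Rhausdorff R) c1).
apply: cvg_trans c3; apply: near_eq_cvg; apply: nearW => n.
by rewrite PQ.
Qed.

Lemma disk_subset (r c : R) : 0 < r -> r <= c -> disk r `<=` disk c.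
Proof.
move=> r0 rc p; rewrite /Defs.ball0/= => /lt_le_trans; apply.
by rewrite ler_sqr// nnegrE ltW// (lt_le_trans r0).
Qed.

Lemma Rintegral_subdisk (g h : R * R -> R) (r c : R) : 0 < r -> r <= c ->
  (forall p, disk r p -> h p = g p) -> (forall p, ~ disk r p -> h p = 0) ->
  \int[leb2]_(p in disk c) h p = \int[leb2]_(p in disk r) g p.
Proof.
move=> r0 rc hg h0; rewrite Rintegral_mkcond [RHS]Rintegral_mkcond.
apply: eq_Rintegral => p _; rewrite !patchE.
have [pr|/negP pr] := boolP (p \in disk r).
  rewrite inE in pr; rewrite hg// mem_set//; exact: disk_subset pr.
by rewrite h0 ?if_same//; rewrite inE in pr.
Qed.

(* Letting e -> 0 gives int_{B_r} (r^2 - |x|^2) P = 2 int_{B_r} Q; differentiate in r. *)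
Lemma radial (P Q : R * R -> R) (c : R) : 0 < c ->
  leb2.-integrable (disk c) (EFin \o P) -> leb2.-integrable (disk c) (EFin \o Q) ->
  (forall e b, 0 < e -> 0 < b -> b < c ^+ 2 ->
     \int[leb2]_(p in disk c) (scut e (b - qn p) * P p) =
     2 * \int[leb2]_(p in disk c) (dscut e (b - qn p) * Q p)) ->
  {ae mu, forall r, r \in `]0, c[ -> \int[leb2]_(p in disk r) P p = cmean Q r}.
Proof.
move=> c0 Pi Qi PQ.
have mD := mdisk c.
have qPi : leb2.-integrable (disk c) (EFin \o (fun p => qn p * P p)).
  apply: (@integrable_bdM _ _ _ leb2 _ mD _ _ (c ^+ 2)) => //.
    by apply: measurable_funTS; exact: measurable_qn.
  by move=> p; rewrite /Defs.ball0/= ger0_norm ?qn_ge0// => /ltW.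
have lim b : 0 < b -> b < c ^+ 2 -> _ := fun b0 bc => radial_limit b0 Pi Qi (fun e e0 => PQ e b e0 b0 bc).
(* The weight [r^2 - |x|^2] is split so that each integrand is free of [r], the form that
   [derive_disk] can differentiate. *)
have key r : r \in `]0, c[ -> r ^+ 2 * \int[leb2]_(p in disk r) P p - \int[leb2]_(p in disk r) (qn p * P p) =
    2 * \int[leb2]_(p in disk r) Q p.
  rewrite in_itv/= => /andP[r0 rc].
  have Pr := integrableS mD (mdisk r) (disk_subset r0 (ltW rc)) Pi.
  have qPr := integrableS mD (mdisk r) (disk_subset r0 (ltW rc)) qPi.
  have r2P : leb2.-integrable (disk r) (EFin \o (fun p => r ^+ 2 * P p)).
    by have := integrableZl (mdisk r) (r ^+ 2) Pr; apply: eq_integrable => //; exact: mdisk.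
  have := lim (r ^+ 2) _ _; rewrite (Rintegral_subdisk (g := fun p => r ^+ 2 * P p - qn p * P p) r0 (ltW rc)); last 2 first.
  - move=> p; rewrite /Defs.ball0/= -subr_gt0 => /ltW pr.
    by rewrite max_l// mulrBl.
  - by move=> p /negP; rewrite /Defs.ball0/= -leNgt -subr_le0 => pr; rewrite max_r// mul0r.
  rewrite (Rintegral_subdisk (g := Q) r0 (ltW rc)); last 2 first.
  - by move=> p; rewrite /Defs.ball0/= -subr_gt0 => ->; rewrite mul1r.
  - by move=> p /negP; rewrite /Defs.ball0/= -leNgt -subr_le0 leNgt => /negPf ->; rewrite mul0r.
  rewrite RintegralB//; last exact: mdisk.
  rewrite RintegralZl//; last exact: mdisk.
  by apply; [rewrite exprn_gt0|rewrite ltr_pXn2r// nnegrE ltW// (lt_trans r0)].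
have [Pae _ _] := polar_ball c0 Pi.
have dA := derive_disk c0 Pi; have dB := derive_disk c0 qPi; have dC := derive_disk c0 Qi.
have := ae_and (ae_and dA dB) (ae_and dC Pae).
apply: ae_imp => r [[hA hB] [hC hP]] rc.
move: (hA rc) (hB rc) (hC rc) (hP rc) => {}hA {}hB {}hC {}hP.
have r0 : 0 < r by move: rc; rewrite in_itv/= => /andP[].
(* The weight vanishes on the circle of radius [r], so the two boundary terms cancel in the
   derivative; [2 r] times the disk integral of [P] remains, against [2 r * cmean Q r]. *)
have hBE : cmean (fun p => qn p * P p) r = r ^+ 2 * cmean P r.
  by rewrite -cmeanZl//; apply: eq_cmean => t; rewrite qn_polar.
have d1 : is_derive r (1 : R) (fun x => x * x) (1 * r + r * 1) by exact: isd_mul.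
have dL := isd_sub (isd_mul d1 hA) hB.
have dR := isd_mul (isd_cst 2 r 1) hC.
have [_ eL] := dL.
have : is_derive r (1 : R) (fun x => 2 * \int[leb2]_(p in disk x) Q p)
   ((1 * r + r * 1) * \int[leb2]_(p in disk r) P p + r * r * (r * cmean P r) - r * cmean (fun p => qn p * P p) r).
  apply: near_eq_is_derive dL; near=> x; rewrite -expr2 key//.
  by rewrite in_itv/=; apply/andP; split; near: x; [apply: lt_nbhsr|apply: lt_nbhsl]; move: rc; rewrite in_itv/= => /andP[].
move=> [_ e1]; move: dR => [_]; rewrite e1 hBE => E.
have : r * (\int[leb2]_(p in disk r) P p - cmean Q r) = 0 by lra.
by move/eqP; rewrite mulf_eq0 gt_eqF//= subr_eq0 => /eqP.
Unshelve. all: by end_near.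
Qed.

End Radial.

(** * Calculus on the disk *)

Section Planar.
Context {R : realType}.
Notation mu := (@lebesgue_measure R).
Notation leb2 := (@leb2 R).
Notation disk := (@Defs.ball0 R).
Notation e1 := (@Defs.e1 R).
Notation e2 := (@Defs.e2 R).
Implicit Types (w v : R * R -> R) (p : R * R) (dw : R).

Definition cdisk (r : R) : set (R * R) := [set p | qn p <= r ^+ 2].

Lemma continuous_qn : continuous (@qn R).
Proof.
move=> p; apply: cvgD.
  by apply: (@continuous_comp _ _ _ fst (fun x : R => x ^+ 2)); [exact: cvg_fst|exact: exprn_continuous].
by apply: (@continuous_comp _ _ _ snd (fun x : R => x ^+ 2)); [exact: cvg_snd|exact: exprn_continuous].
Qed.

Lemma compact_cdisk (r : R) : compact (cdisk r).
Proof.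
apply: (@subclosed_compact _ _ (`[- `|r|, `|r|]%classic `*` `[- `|r|, `|r|]%classic)).
- have -> : cdisk r = (@qn R) @^-1` [set x | x <= r ^+ 2] by [].
  by apply: closed_comp; [move=> p _; exact: continuous_qn|exact: closed_le].
- by apply: compact_setX; exact: segment_compact.
- move=> p; rewrite /cdisk/= => pr.
  have aux (x y : R) : x ^+ 2 + y ^+ 2 <= r ^+ 2 -> x \in `[- `|r|, `|r|].
    move=> xyr; rewrite in_itv/= -ler_norml -ler_sqr ?nnegrE// !real_normK ?num_real//.
    by apply: le_trans xyr; rewrite lerDl sqr_ge0.
  by split; [exact: (aux p.1 p.2)|apply: (aux p.2 p.1); rewrite addrC].
Qed.

Lemma bounded_on (K : set (R * R)) w : compact K -> (forall p, K p -> {for p, continuous w}) ->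
  exists2 M, 0 < M & forall p, K p -> `|w p| <= M.
Proof.
move=> cK cw.
have : compact (w @` K).
  apply: continuous_compact => //; apply: continuous_in_subspaceT => p; rewrite inE; exact: cw.
move=> /compact_bounded[M [_ MP]].
exists (`|M| + 1); first by rewrite ltr_wpDl.
move=> p Kp; apply: (MP (`|M| + 1)); last by exists p.
by rewrite (le_lt_trans (ler_norm _))// ltrDl.
Qed.

Lemma isd_e1 w p dw : is_derive p e1 w dw <-> is_derive p.1 (1 : R) (fun x => w (x, p.2)) dw.
Proof.
rewrite isd_line (isd_line (fun x => w (x, p.2))).
suff -> : (fun h : R => w (h *: e1 + p)) = (fun h : R => w (h *: 1 + p.1, p.2)) by [].
by apply/funext => h; congr w; rewrite [LHS]surjective_pairing; congr (_, _); rewrite /= /GRing.scale/= ?mulr0 ?add0r.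
Qed.

Lemma isd_e2 w p dw : is_derive p e2 w dw <-> is_derive p.2 (1 : R) (fun y => w (p.1, y)) dw.
Proof.
rewrite isd_line (isd_line (fun y => w (p.1, y))).
suff -> : (fun h : R => w (h *: e2 + p)) = (fun h : R => w (p.1, h *: 1 + p.2)) by [].
by apply/funext => h; congr w; rewrite [LHS]surjective_pairing; congr (_, _); rewrite /= /GRing.scale/= ?mulr0 ?add0r.
Qed.

(** The partial derivatives are data instead of [dx w] and [dy w], so that products and compositions
    carry explicit formulas; [C1at_Ck] translates back to the form required of test fields. *)
Definition C1at w w1 w2 p :=
  [/\ is_derive p e1 w (w1 p), is_derive p e2 w (w2 p),
      {for p, continuous w}, {for p, continuous w1} & {for p, continuous w2}].

Lemma C1at_near w w1 w2 v v1 v2 p :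
  (\forall q \near p, [/\ v q = w q, v1 q = w1 q & v2 q = w2 q]) -> C1at w w1 w2 p -> C1at v v1 v2 p.
Proof.
move=> vw [d1 d2 c0 c1 c2].
have [e0 E1 E2] : [/\ v p = w p, v1 p = w1 p & v2 p = w2 p] by exact: nbhs_singleton vw.
have n0 : \near p, w p = v p by apply: filterS vw => q [].
have n1 : \near p, w1 p = v1 p by apply: filterS vw => q [].
have n2 : \near p, w2 p = v2 p by apply: filterS vw => q [].
split.
- by rewrite E1; exact: near_eq_is_derive n0 d1.
- by rewrite E2; exact: near_eq_is_derive n0 d2.
- by rewrite /prop_for /continuous_at e0; apply: cvg_trans c0; exact: near_eq_cvg.
- by rewrite /prop_for /continuous_at E1; apply: cvg_trans c1; exact: near_eq_cvg.
- by rewrite /prop_for /continuous_at E2; apply: cvg_trans c2; exact: near_eq_cvg.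
Qed.

Lemma C1at_cst (c : R) p : C1at (fun=> c) (fun=> 0) (fun=> 0) p.
Proof. by split; [exact: isd_cst|exact: isd_cst|exact: cvg_cst|exact: cvg_cst|exact: cvg_cst]. Qed.

Lemma C1at_fst p : C1at (fun q => q.1) (fun=> 1) (fun=> 0) p.
Proof.
split; [|apply/isd_e2; exact: isd_cst|exact: cvg_fst|exact: cvg_cst|exact: cvg_cst].
by apply/isd_e1 => /=; exact: is_derive_id.
Qed.

Lemma C1at_snd p : C1at (fun q => q.2) (fun=> 0) (fun=> 1) p.
Proof.
split; [apply/isd_e1; exact: isd_cst| |exact: cvg_snd|exact: cvg_cst|exact: cvg_cst].
by apply/isd_e2 => /=; exact: is_derive_id.
Qed.

Lemma C1at_add w w1 w2 v v1 v2 p : C1at w w1 w2 p -> C1at v v1 v2 p ->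
  C1at (fun q => w q + v q) (fun q => w1 q + v1 q) (fun q => w2 q + v2 q) p.
Proof.
move=> [a b c d e] [a' b' c' d' e']; split;
 by [exact: isd_add|exact: isd_add|exact: cvgD|exact: cvgD|exact: cvgD].
Qed.

Lemma C1at_sub w w1 w2 v v1 v2 p : C1at w w1 w2 p -> C1at v v1 v2 p ->
  C1at (fun q => w q - v q) (fun q => w1 q - v1 q) (fun q => w2 q - v2 q) p.
Proof.
move=> [a b c d e] [a' b' c' d' e']; split;
 by [exact: isd_sub|exact: isd_sub|exact: cvgB|exact: cvgB|exact: cvgB].
Qed.

Lemma C1at_mul w w1 w2 v v1 v2 p : C1at w w1 w2 p -> C1at v v1 v2 p ->
  C1at (fun q => w q * v q) (fun q => w1 q * v q + w q * v1 q) (fun q => w2 q * v q + w q * v2 q) p.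
Proof.
move=> [a b c d e] [a' b' c' d' e']; split;
 by [exact: isd_mul|exact: isd_mul|exact: cvgM|apply: cvgD; exact: cvgM|apply: cvgD; exact: cvgM].
Qed.

Lemma C1at_comp (h dh : R -> R) w w1 w2 p :
  (forall t, is_derive t (1 : R) h (dh t)) -> continuous h -> continuous dh -> C1at w w1 w2 p ->
  C1at (fun q => h (w q)) (fun q => dh (w q) * w1 q) (fun q => dh (w q) * w2 q) p.
Proof.
move=> hd ch cdh [a b c d e]; split.
- exact: isd_comp.
- exact: isd_comp.
- by apply: continuous_comp => //; exact: ch.
- by apply: cvgM => //; apply: continuous_comp => //; exact: cdh.
- by apply: cvgM => //; apply: continuous_comp => //; exact: cdh.
Qed.

Lemma C1at_Ck w w1 w2 : (forall p, C1at w w1 w2 p) ->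
  [/\ Ck_on 1 setT w, dx w = w1 & dy w = w2].
Proof.
move=> h; have E1 : dx w = w1 by apply/funext => p; have [[_ <-] _ _ _ _] := h p.
have E2 : dy w = w2 by apply/funext => p; have [_ [_ <-] _ _ _] := h p.
split => //=; rewrite E1 E2; split => p _; have [d1 d2 c0 c1 c2] := h p => //.
Qed.

Lemma leb2_disk_lty (r : R) : (leb2 (disk r) < +oo)%E.
Proof.
have sub : disk r `<=` `[- `|r|, `|r|]%classic `*` `[- `|r|, `|r|]%classic.
  have aux (x y : R) : x ^+ 2 + y ^+ 2 < r ^+ 2 -> x \in `[- `|r|, `|r|].
    move=> xyr; rewrite in_itv/= -ler_norml -ler_sqr ?nnegrE// !real_normK ?num_real//.
    by apply: le_trans (ltW xyr); rewrite lerDl sqr_ge0.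
  by move=> p pr; split; [exact: (aux p.1 p.2)|apply: (aux p.2 p.1); rewrite addrC].
have mI : measurable (`[- `|r|, `|r|]%classic : set (measurableTypeR R)) by exact: measurable_itv.
apply: (@le_lt_trans _ _ (leb2 (`[- `|r|, `|r|]%classic `*` `[- `|r|, `|r|]%classic))).
  by apply: le_measure => //; rewrite inE; [exact: mdisk|exact: measurableX].
have muI : (mu `[(- `|r|)%R, `|r|%R]%classic < +oo)%E.
  by rewrite lebesgue_measure_itv/=; case: ifPn => _; rewrite ?ltry// -EFinB ltry.
by rewrite /leb2 product_measure1E// lte_mul_pinfty// ge0_fin_numE.
Qed.

Lemma bounded_integrable_disk w (r M : R) : measurable_fun (disk r) w ->
  (forall p, disk r p -> `|w p| <= M) -> leb2.-integrable (disk r) (EFin \o w).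
Proof.
move=> mw wM; apply: (@measurable_bounded_integrable _ _ _ leb2 w (disk r) (mdisk r) _ mw).
- exact: leb2_disk_lty.
- exists M; split; first exact: num_real.
  by move=> x Mx p /= pr; rewrite (le_trans (wM p pr))// ltW.
Qed.

Lemma continuous_integrable_disk w (r : R) : (forall p, cdisk r p -> {for p, continuous w}) ->
  leb2.-integrable (disk r) (EFin \o w).
Proof.
move=> cw; have [M _ wM] := bounded_on (@compact_cdisk r) cw.
have sub p : disk r p -> cdisk r p by move=> /ltW.
apply: (@bounded_integrable_disk _ _ M) => [|p /sub]; last exact: wM.
apply: continuous_measurable2; first exact: open_ball0.
by move=> p; rewrite inE => /sub; exact: cw.
Qed.

Lemma deriv_eq0 w dw (dir : R * R) (b : R) p : (forall q, b <= qn q -> w q = 0) -> b < qn p ->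
  is_derive p dir w dw -> dw = 0.
Proof.
move=> w0 bp d.
have n0 : \near p, w p = (fun=> 0) p.
  near=> q; apply: w0; apply/ltW; near: q.
  exact: (cvgr_gt _ (@continuous_qn p) _ bp).
by have [_ <-] := near_eq_is_derive n0 d; have [_ ->] := isd_cst (0 : R) p dir.
Unshelve. all: by end_near.
Qed.

Lemma derivative_itv_integral (f df : R -> R) (a b : R) : a < b ->
  (forall x, is_derive x (1 : R) f (df x)) -> continuous df ->
  (\int[mu]_(x in `[a, b]) (df x)%:E = (f b)%:E - (f a)%:E)%E.
Proof.
move=> ab fd cdf.
have cf x : {for x, continuous f}.
  by apply/differentiable_continuous/derivable1_diffP; case: (fd x).
apply: continuous_FTC2 => //.
- by apply: continuous_in_subspaceT => x _; exact: cdf.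
- split => [x _||]; first by case: (fd x).
    by apply: cvg_at_right_filter; exact: cf.
  by apply: cvg_at_left_filter; exact: cf.
- by move=> x _; rewrite derive1E; case: (fd x).
Qed.

Lemma line_integral_eq0 (f df : R -> R) :
  (forall x, is_derive x (1 : R) f (df x)) -> continuous df ->
  (forall x, 1 <= `|x| -> f x = 0) -> (forall x, 1 <= `|x| -> df x = 0) ->
  (\int[mu]_x (df x)%:E = 0)%E.
Proof.
move=> fd cdf f0 df0; have lt11 : -1 < 1 :> R by lra.
transitivity (\int[mu]_(x in `[(-1)%R, 1%R]) (df x)%:E)%E.
  rewrite [RHS]integral_mkcond; apply: eq_integral => x _; rewrite patchE.
  case: ifPn => //; rewrite mem_setE in_itv/= -ler_norml -ltNge => x1.
  by rewrite df0// ltW.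
rewrite (@derivative_itv_integral f)//.
by rewrite !f0 ?normrN ?normr1// subee.
Qed.

Lemma Rintegral_patch_disk w : (forall p, 1 <= qn p -> w p = 0) -> w \_ (disk 1) = w.
Proof.
move=> w0; apply/funext => p; rewrite patchE; case: ifPn => // /negP; rewrite inE/= /Defs.ball0/= => p1.
by rewrite w0// leNgt; apply/negP; rewrite -[X in _ < X](expr1n _ 2).
Qed.

Lemma fubini_disk w : (forall p, {for p, continuous w}) -> (forall p, 1 <= qn p -> w p = 0) ->
  [/\ leb2.-integrable (disk 1) (EFin \o w),
     (\int[leb2]_(p in disk 1) (w p)%:E = \int[mu]_y \int[mu]_x (w (x, y))%:E)%E &
     (\int[leb2]_(p in disk 1) (w p)%:E = \int[mu]_x \int[mu]_y (w (x, y))%:E)%E].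
Proof.
move=> cw w0; have wi := @continuous_integrable_disk w 1 (fun p _ => cw p).
have wi' : leb2.-integrable [set: R * R] (EFin \o w).
  rewrite -[in X in _ X](Rintegral_patch_disk w0) -restrict_EFin.
  by apply: (integrable_mkcond _ (mdisk 1)).1.
have [_ _ E1 E2] := fubini2 wi'.
have E : (\int[leb2]_(p in disk 1) (w p)%:E = \int[leb2]_p (w p)%:E)%E.
  by rewrite integral_mkcond restrict_EFin Rintegral_patch_disk.
by split => //; rewrite E.
Qed.

Lemma cvg_pairr (x y : R) : (x, z) @[z --> y] --> (x, y).
Proof.
move=> A [[P Q] /= [Px Qy] PQ]; apply: filterS Qy => z Qz; apply: PQ.
by split => //=; exact: nbhs_singleton Px.
Qed.

Lemma cvg_pairl (x y : R) : (z, y) @[z --> x] --> (x, y).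
Proof.
move=> A [[P Q] /= [Px Qy] PQ]; apply: filterS Px => z Pz; apply: PQ.
by split => //=; exact: nbhs_singleton Qy.
Qed.

(** Fubini and the fundamental theorem of calculus on each line. The margin [b < 1] makes the field
    vanish near every point with [qn p >= 1], so its partial derivatives vanish there as well. *)
Lemma Rintegral_divergence (X1 X11 X12 X2 X21 X22 : R * R -> R) (b : R) : b < 1 ->
  (forall p, C1at X1 X11 X12 p) -> (forall p, C1at X2 X21 X22 p) ->
  (forall p, b <= qn p -> X1 p = 0) -> (forall p, b <= qn p -> X2 p = 0) ->
  \int[leb2]_(p in disk 1) (X11 p + X22 p) = 0.
Proof.
move=> b1 C1 C2 X10 X20.
have X110 p : 1 <= qn p -> X11 p = 0.
  by have [d _ _ _ _] := C1 p => /(lt_le_trans b1) bp; exact: deriv_eq0 X10 bp d.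
have X220 p : 1 <= qn p -> X22 p = 0.
  by have [_ d _ _ _] := C2 p => /(lt_le_trans b1) bp; exact: deriv_eq0 X20 bp d.
have c1 p : {for p, continuous X11} by case: (C1 p).
have c2 p : {for p, continuous X22} by case: (C2 p).
have [i1 E1 _] := fubini_disk c1 X110; have [i2 _ E2] := fubini_disk c2 X220.
have q1 (x y : R) : 1 <= `|x| -> 1 <= qn (x, y) /\ 1 <= qn (y, x).
  rewrite -(ler_sqr (x := 1)) ?nnegrE// expr1n real_normK ?num_real// /qn/= => x1.
  by rewrite (le_trans x1) ?lerDl ?sqr_ge0//= (le_trans x1)// lerDr sqr_ge0.
rewrite RintegralD//; last exact: mdisk.
rewrite /Rintegral E1 E2 !integral0_eq ?addr0//.
- move=> x _; apply: (@line_integral_eq0 (fun y => X2 (x, y))) => y.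
  + by have [_ /isd_e2 d _ _ _] := C2 (x, y).
  + by apply: (@continuous_comp _ _ _ (fun y : R => (x : R, y)) X22); [exact: cvg_pairr|exact: c2].
  + by move=> y1; apply: X20; rewrite (le_trans (ltW b1))//; case: (q1 y x).
  + by move=> y1; apply: X220; case: (q1 y x).
- move=> y _; apply: (@line_integral_eq0 (fun x => X1 (x, y))) => x.
  + by have [/isd_e1 d _ _ _ _] := C1 (x, y).
  + by apply: (@continuous_comp _ _ _ (fun x : R => (x, y : R)) X11); [exact: cvg_pairl|exact: c1].
  + by move=> x1; apply: X10; rewrite (le_trans (ltW b1))//; case: (q1 x y).
  + by move=> x1; apply: X110; case: (q1 x y).
Qed.

Lemma mean_value (f df : R -> R) (a h : R) : 0 < h ->
  (forall x, a <= x <= a + h -> is_derive x (1 : R) f (df x)) ->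
  exists2 c, a < c < a + h & f (a + h) - f a = df c * h.
Proof.
move=> h0 fd; have ah : a < a + h by rewrite ltrDl.
have [||c /[!in_itv]/= cI ->] := MVT (f := f) (df := df) ah.
- by move=> x; rewrite in_itv/= => /andP[ax xa]; apply: fd; rewrite !ltW.
- apply: continuous_in_subspaceT => x; rewrite inE/= in_itv/= => xI.
  by apply/differentiable_continuous/derivable1_diffP; case: (fd x xI).
by exists c => //; rewrite addrAC subrr add0r.
Qed.

(** Schwarz's theorem. The second difference of [w] over a square of side [h] equals [h^2] times
    [w12] at one point and [h^2] times [w21] at another; continuity at [p] excludes a gap between
    the two limits. *)
Lemma mixed_partials w w1 w2 w12 w21 (A : set (R * R)) p : open A -> A p ->
  (forall q, A q -> is_derive q e1 w (w1 q)) -> (forall q, A q -> is_derive q e2 w (w2 q)) ->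
  (forall q, A q -> is_derive q e2 w1 (w12 q)) -> (forall q, A q -> is_derive q e1 w2 (w21 q)) ->
  {for p, continuous w12} -> {for p, continuous w21} -> w12 p = w21 p.
Proof.
move=> oA Ap d1 d2 d12 d21 c12 c21; apply/eqP; rewrite -subr_eq0 -normr_eq0; apply/negPn/negP => ne.
set d := `|w12 p - w21 p| in ne; have d0 : 0 < d / 2 by rewrite divr_gt0// lt_def ne normr_ge0.
have : \forall q \near p, [/\ A q, `|w12 p - w12 q| < d / 2 & `|w21 p - w21 q| < d / 2].
  near=> q; split; near: q.
  - exact: open_nbhs_nbhs.
  - by move/cvgrPdist_lt : c12; apply.
  - by move/cvgrPdist_lt : c21; apply.
move=> /nbhs_ballP[r /= r0 rP]; case: p => [x y] in Ap c12 c21 d d0 ne rP *.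
pose h := r / 2; have h0 : 0 < h by rewrite divr_gt0.
have box a b : x <= a <= x + h -> y <= b <= y + h -> ball (x, y) r (a, b).
  move=> /andP[xa ax] /andP[yb by_]; split; rewrite /ball/= ltr_distlC; apply/andP; split; rewrite /h in ax by_; lra.
have AQ a b : x <= a <= x + h -> y <= b <= y + h -> A (a, b).
  by move=> aI bI; have [] := rP _ (box a b aI bI).
have xx : x <= x <= x + h by rewrite lexx lerDl ltW.
have xh : x <= x + h <= x + h by rewrite lexx lerDl ltW.
have yy : y <= y <= y + h by rewrite lexx lerDl ltW.
have yh : y <= y + h <= y + h by rewrite lexx lerDl ltW.
have [a aI E1] : exists2 a, x < a < x + h &
    (w (x + h, y + h) - w (x + h, y)) - (w (x, y + h) - w (x, y)) = (w1 (a, y + h) - w1 (a, y)) * h.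
  apply: (@mean_value (fun s => w (s, y + h) - w (s, y)) (fun s => w1 (s, y + h) - w1 (s, y))) => // s sI.
  by apply: isd_sub; [have /isd_e1 := d1 (s, y + h) (AQ _ _ sI yh)|have /isd_e1 := d1 (s, y) (AQ _ _ sI yy)].
have aI' : x <= a <= x + h by move: aI => /andP[? ?]; rewrite !ltW.
have [b bI E2] : exists2 b, y < b < y + h & w1 (a, y + h) - w1 (a, y) = w12 (a, b) * h.
  apply: (@mean_value (fun s => w1 (a, s)) (fun s => w12 (a, s))) => // s sI.
  by have /isd_e2 := d12 (a, s) (AQ _ _ aI' sI).
have [b' bI' E3] : exists2 b, y < b < y + h &
    (w (x + h, y + h) - w (x, y + h)) - (w (x + h, y) - w (x, y)) = (w2 (x + h, b) - w2 (x, b)) * h.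
  apply: (@mean_value (fun s => w (x + h, s) - w (x, s)) (fun s => w2 (x + h, s) - w2 (x, s))) => // s sI.
  by apply: isd_sub; [have /isd_e2 := d2 (x + h, s) (AQ _ _ xh sI)|have /isd_e2 := d2 (x, s) (AQ _ _ xx sI)].
have bI2 : y <= b' <= y + h by move: bI' => /andP[? ?]; rewrite !ltW.
have [a' aI2 E4] : exists2 a, x < a < x + h & w2 (x + h, b') - w2 (x, b') = w21 (a, b') * h.
  apply: (@mean_value (fun s => w2 (s, b')) (fun s => w21 (s, b'))) => // s sI.
  by have /isd_e1 := d21 (s, b') (AQ _ _ sI bI2).
have E : w12 (a, b) = w21 (a', b').
  have : w12 (a, b) * h * h = w21 (a', b') * h * h by rewrite -E2 -E1 -E4 -E3; ring.
  by move/(mulIf (lt0r_neq0 h0))/(mulIf (lt0r_neq0 h0)).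
have bI3 : y <= b <= y + h by move: bI => /andP[? ?]; rewrite !ltW.
have aI3 : x <= a' <= x + h by move: aI2 => /andP[? ?]; rewrite !ltW.
have [_ B1 _] := rP _ (box a b aI' bI3); have [_ _ B2] := rP _ (box a' b' aI3 bI2).
have : d < d / 2 + d / 2.
  rewrite {1}/d (_ : w12 (x, y) - w21 (x, y) = (w12 (x, y) - w12 (a, b)) - (w21 (x, y) - w21 (a', b'))); last by rewrite E; ring.
  by rewrite (le_lt_trans (ler_normB _ _))// ltrD.
by rewrite -splitr ltxx.
Unshelve. all: by end_near.
Qed.

End Planar.

(** * Continuity in the radius of circle and disk integrals *)

Section RadialContinuity.
Context {R : realType}.
Notation mu := (@lebesgue_measure R).
Notation leb2 := (@leb2 R).
Notation disk := (@Defs.ball0 R).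
Implicit Types (w P : R * R -> R) (p : R * R) (r c : R).

Lemma near_eq_continuous (f g : R -> R) r : (\forall x \near r, f x = g x) ->
  {for r, continuous g} -> {for r, continuous f}.
Proof.
move=> fg cg; rewrite /prop_for /continuous_at (nbhs_singleton fg).
apply: cvg_trans cg; apply: near_eq_cvg.
by apply: filterS fg => x ->.
Qed.

(** A nonzero value would persist on an interval, which has positive measure. *)
Lemma ae_eq0_continuous (h : R -> R) c : {ae mu, forall r, r \in `]0, c[ -> h r = 0} ->
  (forall r, r \in `]0, c[ -> {for r, continuous h}) -> forall r, r \in `]0, c[ -> h r = 0.
Proof.
move=> [N [mN N0 NP]] ch r rc; apply/eqP; apply: contraT => hr; exfalso.
have rc' := rc; rewrite in_itv/= in rc'; have {rc'} /andP[r0 r1] := rc'.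
have : \forall x \near r, h x != 0 /\ x \in `]0, c[.
  near=> x; split; last first.
    by rewrite in_itv/=; apply/andP; split; near: x; [exact: lt_nbhsr|exact: lt_nbhsl].
  rewrite -normr_gt0; near: x; apply: (cvgr_gt `|h r|); last by rewrite normr_gt0.
  by apply: cvg_norm; exact: ch.
case/nbhs_ballP => d /= d0 dh.
have sub : ball r d `<=` N.
  by move=> x /dh [hx xc]; apply: NP => /(_ xc) hx0; rewrite hx0 eqxx in hx.
have : (mu (ball r d) <= mu N)%E by apply: le_measure; rewrite ?inE//; exact: measurable_ball.
rewrite N0 (lebesgue_measure_ball _ (ltW d0)) lee_fin leNgt => /negP; apply.
by rewrite pmulrn_lgt0.
Unshelve. all: by end_near.
Qed.

Lemma continuous_circle w (r t : R) : {for (r * cos t, r * sin t), continuous w} ->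
  {for t, continuous (fun t => w (r * cos t, r * sin t))} /\
  {for r, continuous (fun r => w (r * cos t, r * sin t))}.
Proof.
move=> cw; split.
- apply: (@continuous_comp _ _ _ (fun t => (r * cos t, r * sin t)) w) => // A /nbhs_ballP[e /= e0 eA].
  rewrite nbhs_simpl/=; near=> z; apply: eA; split; near: z.
  + have : (fun z => r * cos z) @ t --> r * cos t.
      by apply: cvgM; [exact: cvg_cst|exact: continuous_cos].
    by apply; exact: nbhsx_ballx.
  + have : (fun z => r * sin z) @ t --> r * sin t.
      by apply: cvgM; [exact: cvg_cst|exact: continuous_sin].
    by apply; exact: nbhsx_ballx.
- apply: (@continuous_comp _ _ _ (fun r => (r * cos t, r * sin t)) w) => // A /nbhs_ballP[e /= e0 eA].
  rewrite nbhs_simpl/=; near=> z; apply: eA; split; near: z.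
  + have : (fun z => z * cos t) @ r --> r * cos t by apply: cvgM; [exact: cvg_id|exact: cvg_cst].
    by apply; exact: nbhsx_ballx.
  + have : (fun z => z * sin t) @ r --> r * sin t by apply: cvgM; [exact: cvg_id|exact: cvg_cst].
    by apply; exact: nbhsx_ballx.
Unshelve. all: by end_near.
Qed.

Lemma disk_circle (r c t : R) : 0 < r -> r < c -> disk c (r * cos t, r * sin t).
Proof. by move=> r0 rc; apply/ball0_polar => //; exact: lt_trans rc. Qed.

Lemma circle_integrable w r : (forall p, disk 1 p -> {for p, continuous w}) -> 0 < r -> r < 1 ->
  mu.-integrable `[0, 2 * pi] (EFin \o (fun t => w (r * cos t, r * sin t))).
Proof.
move=> cw r0 r1; apply: continuous_compact_integrable; first exact: segment_compact.
apply: continuous_subspaceT => t.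
by have [] := @continuous_circle w r t (cw _ (disk_circle t r0 r1)).
Qed.

Lemma cmean_continuous w r : (forall p, disk 1 p -> {for p, continuous w}) -> r \in `]0, 1[ ->
  {for r, continuous (cmean w)}.
Proof.
move=> cw rI; have rI' := rI; rewrite in_itv/= in rI'; have {rI'} /andP[r0 r1] := rI'.
(* An intermediate radius: [w] is bounded on the closed disk of radius [b < 1], and this constant
   dominates the integrands for all radii near [r]. *)
pose b := (1 + r) / 2.
have b0 : 0 < b by rewrite /b; lra.
have b1 : b < 1 by rewrite /b; lra.
have rb : r < b by rewrite /b; lra.
have [p pb|M M0 wM] := bounded_on (@compact_cdisk R b) (w := w).
  apply: cw; move: pb; rewrite /cdisk /Defs.ball0/= expr1n => /le_lt_trans; apply.
  by rewrite exprn_ilt1// ltW.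
have mI : measurable (`[0, 2 * pi]%classic : set (measurableTypeR R)) by exact: measurable_itv.
apply: (@continuity_under_integral R _ _ mu (fun s t => w (s * cos t, s * sin t)) _ mI 0 b _ _ (cst M)).
- move=> s; rewrite /= in_itv/= => /andP[s0 sb]; apply: circle_integrable => //; exact: lt_trans b1.
- apply/aeW => t _ s; rewrite inE/= in_itv/= => /andP[s0 sb].
  by have [] := @continuous_circle w s t (cw _ (disk_circle t s0 (lt_trans sb b1))).
- apply: continuous_compact_integrable; first exact: segment_compact.
  by apply: continuous_subspaceT => t; exact: cst_continuous.
- move=> s; rewrite /= in_itv/= => /andP[s0 sb]; apply/aeW => t _.
  by apply: wM; rewrite /cdisk/= qn_polar ler_sqr ?nnegrE ltW.
- by rewrite inE/= in_itv/= r0 rb.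
Qed.

(** In polar form this is the primitive of an integrable function, hence continuous at every radius,
    whereas [derive_disk] speaks of almost every one. *)
Lemma disk_integral_continuous P c : 0 < c -> leb2.-integrable (disk c) (EFin \o P) ->
  forall r, r \in `]0, c[ -> {for r, continuous (fun r => \int[leb2]_(p in disk r) P p)}.
Proof.
move=> c0 fi r rc; have [_ ki _] := polar_ball c0 fi.
set k := fun s => s * cmean P s in ki.
pose k' := k \_ `]0, c[%classic.
have k'i : mu.-integrable [set: R] (EFin \o k').
  by rewrite -restrict_EFin; exact: ((integrable_patch _ (measurable_itv _)).1 ki).
have ik : mu.-integrable `[0, c] (EFin \o k') by exact: integrableS k'i.
have /(continuous_within_itvP _ c0)[ck _ _] := parameterized_integral_continuous (ltW c0) ik.
apply: near_eq_continuous (ck r rc); rewrite in_itv/= in rc; have /andP[r0 r1] := rc.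
near=> x.
have x0 : 0 < x by near: x; exact: lt_nbhsr.
have xc : x < c by near: x; exact: lt_nbhsl.
rewrite /parameterized_integral (polar_disk x0 (ltW xc) fi) -Rintegral_itv_bndo_bndc; last exact: integrableS k'i.
rewrite [LHS]Rintegral_mkcond [RHS]Rintegral_mkcond; apply: eq_Rintegral => t _.
rewrite /k' !patchE !mem_setE !in_itv/=.
have [tx|_] := ltP t x; last by rewrite !andbF.
rewrite !andbT (lt_trans tx xc) andbT.
by case: (ltP 0 t) => [t0|_]; [rewrite (ltW t0)|rewrite if_same].
Unshelve. all: by end_near.
Qed.

End RadialContinuity.

(** * Variational solutions *)

Section Structure.
Context {R : realType}.
Notation mu := (@lebesgue_measure R).
Notation leb2 := (@leb2 R).
Notation disk := (@Defs.ball0 R).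
Notation e1 := (@Defs.e1 R).
Notation e2 := (@Defs.e2 R).
Implicit Types (u w v : R * R -> R) (p : R * R).

Lemma dx_local (A : set (R * R)) w v : open A -> (forall q, A q -> w q = v q) ->
  forall q, A q -> dx w q = dx v q.
Proof.
move=> oA wv q Aq; apply: near_eq_derive.
by apply: filterS (open_nbhs_nbhs (conj oA Aq)) => x; exact: wv.
Qed.

Lemma dy_local (A : set (R * R)) w v : open A -> (forall q, A q -> w q = v q) ->
  forall q, A q -> dy w q = dy v q.
Proof.
move=> oA wv q Aq; apply: near_eq_derive.
by apply: filterS (open_nbhs_nbhs (conj oA Aq)) => x; exact: wv.
Qed.

Lemma Ck1_C1at (A : set (R * R)) w p : Ck_on 1 A w -> A p -> C1at w (dx w) (dy w) p.
Proof.
move=> /= [c d1 d2 c1 c2] Ap.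
split; [exact/derivableP/d1|exact/derivableP/d2|exact: c|exact: c1|exact: c2].
Qed.

Definition C2at u g1 g2 p := [/\ C1at u g1 g2 p, C1at g1 (dx g1) (dy g1) p, C1at g2 (dx g2) (dy g2) p
  & dy g1 p = dx g2 p].

(** Meant for [v] equal to [u_plus u] or [u_minus u]. On the open phase [A], [u] and its chosen
    gradient coincide with [v] and its partial derivatives, so regularity transfers; the symmetry
    clause is Schwarz's theorem. *)
Lemma Ck2_C2at (A : set (R * R)) u v g1 g2 : open A -> Ck_on 2 A v ->
  (forall q, A q -> u q = v q) -> (forall q, A q -> g1 q = dx v q) -> (forall q, A q -> g2 q = dy v q) ->
  forall p, A p -> C2at u g1 g2 p.
Proof.
move=> oA [c d1 d2 c1 c2] uv E1 E2 p Ap.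
have nA q : A q -> \forall x \near q, A x by move=> Aq; exact: open_nbhs_nbhs.
have Cv q : A q -> C1at v (dx v) (dy v) q.
  move=> Aq; split; [exact/derivableP/d1|exact/derivableP/d2|exact: c| |].
    by case: c1 => + _ _ _ _; apply.
  by case: c2 => + _ _ _ _; apply.
have C1v q : A q -> C1at (dx v) (dx (dx v)) (dy (dx v)) q by move=> Aq; exact: Ck1_C1at c1 Aq.
have C2v q : A q -> C1at (dy v) (dx (dy v)) (dy (dy v)) q by move=> Aq; exact: Ck1_C1at c2 Aq.
have Cu : C1at u g1 g2 p.
  apply: C1at_near (Cv _ Ap); apply: filterS (nA p Ap) => q Aq.
  by split; [exact: uv|exact: E1|exact: E2].
have Cg1 : C1at g1 (dx g1) (dy g1) p.
  apply: C1at_near (C1v _ Ap); apply: filterS (nA p Ap) => q Aq.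
  by split; [exact: E1|exact: dx_local E1 _ Aq|exact: dy_local E1 _ Aq].
have Cg2 : C1at g2 (dx g2) (dy g2) p.
  apply: C1at_near (C2v _ Ap); apply: filterS (nA p Ap) => q Aq.
  by split; [exact: E2|exact: dx_local E2 _ Aq|exact: dy_local E2 _ Aq].
split => //.
rewrite (dy_local oA E1 Ap) (dx_local oA E2 Ap).
apply: (mixed_partials oA Ap (w := v) (w1 := dx v) (w2 := dy v)).
- by move=> q Aq; case: (Cv q Aq).
- by move=> q Aq; case: (Cv q Aq).
- by move=> q Aq; case: (C1v q Aq).
- by move=> q Aq; case: (C2v q Aq).
- by case: (C1v p Ap).
- by case: (C2v p Ap).
Qed.

Lemma isd_min (f df : R -> R) (x r : R) : 0 < r ->
  (forall t, `|x - t| < r -> is_derive t (1 : R) f (df t)) ->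
  (forall t, `|x - t| < r -> f x <= f t) -> df x = 0.
Proof.
move=> r0 fd fm.
have I t : t \in `]x - r, x + r[ -> `|x - t| < r by rewrite in_itv/= ltr_distlC.
have xI : x \in `]x - r, x + r[ by rewrite in_itv/=; apply/andP; split; lra.
have [||||_ <-] := @derive1_at_min R f (x - r) (x + r) x.
- lra.
- by move=> t /I /fd [].
- exact: xI.
- by move=> t /I /fm.
by have [] := fd x (I x xI).
Qed.

Lemma C1at_min (A : set (R * R)) w w1 w2 p : open A -> A p ->
  (forall q, A q -> C1at w w1 w2 q) -> (forall q, A q -> w p <= w q) -> w1 p = 0 /\ w2 p = 0.
Proof.
move=> oA Ap Cw wm.
case: p => [x y] in Ap wm *.
have /nbhs_ballP[r /= r0 rA] : nbhs (x, y) A by exact: open_nbhs_nbhs.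
have x0 (t : R) : `|t - t| < r by rewrite subrr normr0.
have Ax t : `|x - t| < r -> A (t, y) by move=> tr; apply: rA; split; [exact: tr|exact: x0].
have Ay t : `|y - t| < r -> A (x, t) by move=> tr; apply: rA; split; [exact: x0|exact: tr].
split.
- apply: (@isd_min (fun t => w (t, y)) (fun t => w1 (t, y)) x r r0) => t tr.
    by have [/isd_e1] := Cw (t, y) (Ax t tr).
  exact: (wm (t, y) (Ax t tr)).
- apply: (@isd_min (fun t => w (x, t)) (fun t => w2 (x, t)) y r r0) => t tr.
    by have [_ /isd_e2] := Cw (x, t) (Ay t tr).
  exact: (wm (x, t) (Ay t tr)).
Qed.

Definition grad1 u p := (grad u p).1.
Definition grad2 u p := (grad u p).2.

Lemma Omega_plusP u p : Omega_plus u p -> disk 1 p /\ 0 <= u p.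
Proof. by move=> /interior_subset. Qed.

Lemma Omega_plus_pos u p : (forall p, disk 1 p -> {for p, continuous u}) ->
  disk 1 p -> 0 < u p -> Omega_plus u p.
Proof.
move=> cu p1 up; rewrite /Omega_plus /interior/=.
near=> q; split; near: q.
- by apply: open_nbhs_nbhs; split => //; exact: open_ball0.
- by near=> q; apply/ltW; near: q; exact: (cvgr_gt _ (cu p p1)).
Unshelve. all: by end_near.
Qed.

Lemma open_Omega_minus u : (forall p, disk 1 p -> {for p, continuous u}) -> open (Omega_minus u).
Proof.
move=> cu; rewrite openE => p [p1 up]; rewrite /interior/=.
near=> q; split; near: q.
- by apply: open_nbhs_nbhs; split => //; exact: open_ball0.
- exact: (cvgr_lt _ (cu p p1)).
Unshelve. all: by end_near.
Qed.

Lemma compact_support_disk (V : zmodType) (f : R * R -> V) (b : R) : 0 <= b -> b < 1 ->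
  (forall p, b <= qn p -> f p = 0) -> compact_support_in (disk 1) f.
Proof.
move=> b0 b1 f0; pose c := Num.sqrt b; have cE : c ^+ 2 = b by rewrite sqr_sqrtr.
have sub : closure (support2 f) `<=` cdisk c.
  have cl : closed (cdisk c).
    have -> : cdisk c = (@qn R) @^-1` [set x | x <= c ^+ 2] by [].
    by apply: closed_comp; [move=> p _; exact: continuous_qn|exact: closed_le].
  rewrite ((closure_id _).1 cl); apply: closure_subset => p /= fp; rewrite /cdisk/= cE leNgt; apply/negP => bp.
  by move: fp; rewrite /support2/= f0 ?eqxx// ltW.
split.
  apply: (subclosed_compact _ (@compact_cdisk _ c) sub); exact: closed_closure.
move=> p /sub; rewrite /cdisk /Defs.ball0/= cE expr1n => /le_lt_trans; exact.
Qed.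

Section Solution.
Variables (rhop rhom : R) (u : R * R -> R).
Hypothesis usol : variational_solution rhop rhom u.

Let cu p : disk 1 p -> {for p, continuous u}.
Proof. by have [_ + _ _ _] := usol; apply. Qed.

Let u_plusE p : Omega_plus u p -> u p = u_plus u p.
Proof. by move=> pO; rewrite /u_plus /chi_plus indicE mem_set// mul1r. Qed.

Let u_minusE p : Omega_minus u p -> u p = u_minus u p.
Proof. by move=> pO; rewrite /u_minus /chi_minus indicE mem_set// mul1r. Qed.

Let grad_plus p : Omega_plus u p -> grad u p = (dx (u_plus u) p, dy (u_plus u) p).
Proof. by move=> pO; rewrite /grad; case: asboolP. Qed.

Let notplus p : Omega_minus u p -> ~ Omega_plus u p.
Proof. by move=> [_ um] /Omega_plusP [_]; rewrite leNgt um. Qed.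

Let grad_minus p : Omega_minus u p -> grad u p = (dx (u_minus u) p, dy (u_minus u) p).
Proof.
move=> pO; rewrite /grad; case: asboolP => [/(notplus pO)//|_].
by case: asboolP.
Qed.

Lemma sol_C2_plus p : Omega_plus u p -> C2at u (grad1 u) (grad2 u) p.
Proof.
have [_ _ C2 _ _] := usol; apply: (Ck2_C2at _ C2) => //.
- exact: open_interior.
- by move=> q qO; rewrite /grad1 grad_plus.
- by move=> q qO; rewrite /grad2 grad_plus.
Qed.

Lemma sol_C2_minus p : Omega_minus u p -> C2at u (grad1 u) (grad2 u) p.
Proof.
have [_ _ _ C2 _] := usol; apply: (Ck2_C2at _ C2) => //.
- exact: open_Omega_minus.
- by move=> q qO; rewrite /grad1 grad_minus.
- by move=> q qO; rewrite /grad2 grad_minus.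
Qed.

Lemma sol_C2 p : disk 1 p -> u p != 0 -> C2at u (grad1 u) (grad2 u) p.
Proof.
move=> p1; rewrite neq_lt => /orP[um|up]; first exact: sol_C2_minus.
by apply: sol_C2_plus; exact: Omega_plus_pos.
Qed.

(** A zero inside [Omega_plus] is a minimum of [u] on that open set; a zero outside both phases
    falls under the default value of [grad]. Consequently truncating [u] near its zeros loses no
    energy in the limit. *)
Lemma sol_grad0 p : disk 1 p -> u p = 0 -> grad1 u p = 0 /\ grad2 u p = 0.
Proof.
move=> p1 up.
have nOm : ~ Omega_minus u p by move=> [_]; rewrite up ltxx.
have [pO|pO] := pselect (Omega_plus u p); last first.
  by rewrite /grad1 /grad2 /grad; case: asboolP => // _; case: asboolP.
apply: (C1at_min (@open_interior _ _) pO (w := u)).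
- by move=> q /sol_C2_plus [].
- by move=> q /Omega_plusP [_]; rewrite up.
Qed.

Definition rho p := rhop * chi_plus u p + rhom * chi_minus u p.

(** The first variation in coordinates, ready for fields built from cut-offs; the last bracket is
    [div (y X)] expanded by the product rule. *)
Lemma sol_variation (X1 X11 X12 X2 X21 X22 : R * R -> R) (b : R) : 0 <= b -> b < 1 ->
  (forall p, C1at X1 X11 X12 p) -> (forall p, C1at X2 X21 X22 p) ->
  (forall p, b <= qn p -> X1 p = 0) -> (forall p, b <= qn p -> X2 p = 0) ->
  \int[leb2]_(p in disk 1) ((grad1 u p ^+ 2 + grad2 u p ^+ 2) * (X11 p + X22 p)
     - 2 * (X11 p * grad1 u p ^+ 2 + (X12 p + X21 p) * grad1 u p * grad2 u p + X22 p * grad2 u p ^+ 2)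
     - rho p * (X2 p + p.2 * (X11 p + X22 p))) = 0.
Proof.
move=> b0 b1 C1 C2 X10 X20.
have [k1 dx1 dy1] := C1at_Ck C1; have [k2 dx2 dy2] := C1at_Ck C2.
have [_ dx3 _] := C1at_Ck (fun p => C1at_mul (C1at_snd p) (C1 p)).
have [_ _ dy4] := C1at_Ck (fun p => C1at_mul (C1at_snd p) (C2 p)).
have [_ _ _ _ /(_ (fun p => (X1 p, X2 p)))] := usol.
rewrite /C10_field /= => /(_ _)/esym H; rewrite -[RHS]H; last first.
  split; [exact: k1|split; first exact: k2].
  by apply: (compact_support_disk b0 b1) => p bp; rewrite X10// X20.
apply: eq_Rintegral => p _.
rewrite /Dphi /div_y /divg /= dx1 dy1 dx2 dy2 dx3 dy4 /dot -/(grad1 u p) -/(grad2 u p) /rho.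
ring.
Qed.

(** Away from the zeros of [u] the density is locally constant, so it acts as a constant coefficient
    when the first variation is integrated by parts. *)
Lemma same_sign_rho p q : disk 1 p -> disk 1 q -> 0 < u p * u q -> rho q = rho p.
Proof.
move=> p1 q1 pq; rewrite /rho /chi_plus /chi_minus !indicE.
have [up|up|up] := ltgtP (u p) 0; last by rewrite up mul0r ltxx in pq.
- have uq : u q < 0 by move: pq; rewrite nmulr_rgt0.
  have pO : Omega_minus u p by []. have qO : Omega_minus u q by [].
  by rewrite !(mem_set pO) !(mem_set qO) (memNset (notplus pO)) (memNset (notplus qO)).
- have uq : 0 < u q by move: pq; rewrite pmulr_rgt0.
  have pO := Omega_plus_pos cu p1 up; have qO := Omega_plus_pos cu q1 uq.
  have pN : ~ Omega_minus u p by move=> [_]; rewrite ltNge ltW.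
  have qN : ~ Omega_minus u q by move=> [_]; rewrite ltNge ltW.
  by rewrite !(mem_set pO) !(mem_set qO) (memNset pN) (memNset qN).
Qed.

End Solution.
End Structure.

(** * Harmonicity away from the zero set *)

Section Harmonic.
Context {R : realType}.
Notation mu := (@lebesgue_measure R).
Notation leb2 := (@leb2 R).
Notation disk := (@Defs.ball0 R).
Notation e1 := (@Defs.e1 R).
Notation e2 := (@Defs.e2 R).
Implicit Types (u w v : R * R -> R) (p : R * R).

Lemma Rintegral_eq0_continuous w p : (forall q, {for q, continuous w}) -> (forall q, 0 <= w q) ->
  \int[leb2]_(q in disk 1) w q = 0 -> disk 1 p -> w p = 0.
Proof.
move=> cw w0 I0 p1; apply/eqP; rewrite eq_le w0 andbT leNgt; apply/negP => wp.
have iw : leb2.-integrable (disk 1) (EFin \o w) by apply: continuous_integrable_disk => q _; exact: cw.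
have : \forall q \near p, disk 1 q /\ w p / 2 < w q.
  near=> q; split; near: q.
    by apply: open_nbhs_nbhs; split => //; exact: open_ball0.
  by apply: (cvgr_gt _ (cw p)); lra.
case/nbhs_ballP => r /= r0 rA.
pose S : set (R * R) := ball p.1 r `*` ball p.2 r.
have mS : measurable (S : set (measurableTypeR R * measurableTypeR R)).
  by apply: measurableX; exact: measurable_ball.
have SD : S `<=` disk 1 by move=> q /rA [].
have muS : leb2 S = ((r *+ 2) * (r *+ 2))%:E.
  have mb x : mu (ball x r) = (r *+ 2)%:E by rewrite lebesgue_measure_ball// ltW.
  transitivity (mu (ball p.1 r) * mu (ball p.2 r))%E; last by rewrite !mb.
  by apply: product_measure1E; exact: measurable_ball.
have IE : (\int[leb2]_(q in disk 1) (w q)%:E = 0)%E.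
  have F : (\int[leb2]_(q in disk 1) (w q)%:E)%E \is a fin_num := integrable_fin_num (mdisk 1) iw.
  by rewrite -(fineK F) [fine _]I0.
have : (\int[leb2]_(q in S) (cst (w p / 2)%:E q) <= \int[leb2]_(q in disk 1) (w q)%:E)%E.
  apply: (@le_trans _ _ (\int[leb2]_(q in S) (w q)%:E)%E).
    apply: ge0_le_integral => //.
    - by move=> q _; rewrite lee_fin; lra.
    - by apply: (measurable_funS (mdisk 1) SD); exact: measurable_int iw.
    - by move=> q /rA [_ /ltW]; rewrite lee_fin.
  apply: ge0_subset_integral => //; first exact: mdisk.
    exact: measurable_int iw.
  by move=> q _; rewrite lee_fin.
rewrite IE integral_cst// [X in (_ * X)%E](_ : _ = leb2 S)// muS -EFinM lee_fin leNgt => /negP; apply.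
by rewrite !mulr_gt0// ?pmulrn_lgt0//; lra.
Unshelve. all: by end_near.
Qed.

(** Near a point where the cut-off [w] vanishes the product is zero whatever [v] is; this handles
    factors that are controlled only on the disk of the bump. *)
Lemma C1at_mul0 w w1 w2 v v1 v2 p :
  (\forall q \near p, [/\ w q = 0, w1 q = 0 & w2 q = 0]) ->
  C1at (fun q => w q * v q) (fun q => w1 q * v q + w q * v1 q) (fun q => w2 q * v q + w q * v2 q) p.
Proof.
move=> w0; apply: C1at_near (C1at_cst 0 p).
by apply: filterS w0 => q [-> -> ->]; rewrite !mul0r addr0.
Qed.

(** The balls of the product topology are squares; the squared Euclidean distance is polynomial and
    therefore yields a C^1 bump. *)
Definition dist2 p q : R := (q.1 - p.1) * (q.1 - p.1) + (q.2 - p.2) * (q.2 - p.2).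

Lemma dist2_ball p (A : set (R * R)) : (\forall q \near p, A q) ->
  exists2 d, 0 < d & forall q, dist2 p q < d -> A q.
Proof.
move=> /nbhs_ballP[r /= r0 rA]; exists (r ^+ 2); first by rewrite exprn_gt0.
move=> q; rewrite /dist2 -!expr2 => h; apply: rA.
have K (x y : R) : (y - x) ^+ 2 < r ^+ 2 -> ball x r y.
  by rewrite -ltr_sqrt ?exprn_gt0// !sqrtr_sqr (gtr0_norm r0) distrC.
split; apply: K; apply: le_lt_trans h.
- by rewrite lerDl sqr_ge0.
- by rewrite lerDr sqr_ge0.
Qed.

Lemma continuous_dist2 p : continuous (dist2 p).
Proof.
move=> q.
have C1 : C1at (fun q => q.1 - p.1) (fun=> 1 - 0) (fun=> 0 - 0) q.
  exact: C1at_sub (C1at_fst q) (C1at_cst p.1 q).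
have C2 : C1at (fun q => q.2 - p.2) (fun=> 0 - 0) (fun=> 1 - 0) q.
  exact: C1at_sub (C1at_snd q) (C1at_cst p.2 q).
by have [] := C1at_add (C1at_mul C1 C1) (C1at_mul C2 C2).
Qed.

Lemma C1at_bump p (d e : R) q : 0 < e ->
  C1at (fun q => scut e (d - dist2 p q)) (fun q => dscut e (d - dist2 p q) * (- 2 * (q.1 - p.1)))
   (fun q => dscut e (d - dist2 p q) * (- 2 * (q.2 - p.2))) q.
Proof.
move=> e0.
have C1 : C1at (fun q => q.1 - p.1) (fun=> 1 - 0) (fun=> 0 - 0) q.
  exact: C1at_sub (C1at_fst q) (C1at_cst p.1 q).
have C2 : C1at (fun q => q.2 - p.2) (fun=> 0 - 0) (fun=> 1 - 0) q.
  exact: C1at_sub (C1at_snd q) (C1at_cst p.2 q).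
have C3 := C1at_sub (C1at_cst d q) (C1at_add (C1at_mul C1 C1) (C1at_mul C2 C2)).
have := C1at_comp (fun t => is_derive_scut t e0) (continuous_scut e0) (continuous_dscut e0) C3.
apply: C1at_near; near=> z; split; first by [].
- by congr (_ * _); ring.
- by congr (_ * _); ring.
Unshelve. all: by end_near.
Qed.

Section SolutionHarmonic.
Variables (rhop rhom : R) (u : R * R -> R).
Hypothesis usol : variational_solution rhop rhom u.
Notation g1 := (grad1 u).
Notation g2 := (grad2 u).
Notation lap := (fun q => dx g1 q + dy g2 q).

Let cu p : disk 1 p -> {for p, continuous u}.
Proof. by have [_ + _ _ _] := usol; apply. Qed.

Let contA (f g : R * R -> R) p : {for p, continuous f} -> {for p, continuous g} ->
  {for p, continuous (fun q => f q + g q)}.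
Proof. by move=> a b; exact: continuousD a b. Qed.

Let contM (f g : R * R -> R) p : {for p, continuous f} -> {for p, continuous g} ->
  {for p, continuous (fun q => f q * g q)}.
Proof. by move=> a b; exact: continuousM a b. Qed.

Let contC (a : R) (p : R * R) : {for p, continuous (fun=> a)}.
Proof. exact: cst_continuous. Qed.

(* Otherwise the constant-direction field Z * grad u(p0), with Z a bump at p0, contradicts the first
   variation: integrating by parts turns it into 2 Z (grad u(p0) . grad u) Lap u, of constant sign. *)
Lemma sol_grad_lap p0 : disk 1 p0 -> u p0 != 0 ->
  (g1 p0 * g1 p0 + g2 p0 * g2 p0) * lap p0 = 0.
Proof.
move=> p01 u0; apply/eqP; set k0 := (X in X == 0); case: (eqVneq k0 0) => // k00; exfalso.
set a := g1 p0 in k0 k00; set b := g2 p0 in k0 k00.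
(* The factor [k0] fixes the sign: [k p0 = k0^2 > 0], so [k] stays positive near [p0]. *)
pose k q := (a * g1 q + b * g2 q) * lap q * k0.
have ck p : disk 1 p -> u p != 0 -> {for p, continuous k}.
  move=> p1 up; have [[_ _ _ c1 c2] [_ _ _ c11 _] [_ _ _ _ c22] _] := sol_C2 usol p1 up.
  have h1 := @contA _ _ p (@contM _ _ p (@contC a p) c1) (@contM _ _ p (@contC b p) c2).
  exact: (@contM _ _ p (@contM _ _ p h1 (@contA _ _ p c11 c22)) (@contC k0 p)).
have kp0 : 0 < k p0 by rewrite (_ : k p0 = k0 ^+ 2)// exprn_even_gt0.
pose b0 := (1 + qn p0) / 2.
have q01 : qn p0 < 1 by move: p01; rewrite /Defs.ball0/= expr1n.
have q00 := qn_ge0 p0.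
have [d d0 dA] : exists2 d, 0 < d & forall q, dist2 p0 q < d ->
   [/\ disk 1 q, qn q < b0, 0 < u p0 * u q & 0 < k q].
  apply: dist2_ball; near=> q; split; near: q.
  - by apply: open_nbhs_nbhs; split => //; exact: open_ball0.
  - by apply: (cvgr_lt _ (@continuous_qn R p0)); rewrite /b0; lra.
  - apply: (cvgr_gt (u p0 * u p0)); last by rewrite -expr2 exprn_even_gt0.
    by apply: cvgM; [exact: cvg_cst|exact: cu].
  - by apply: (cvgr_gt _ (ck p0 p01 u0)).
(* The bump vanishes as soon as [dist2 p0 q >= d / 2], which leaves a margin inside the disk where
   signs and regularity are under control. *)
pose e := d / 2; have e0 : 0 < e by rewrite /e; lra.
pose Z q := scut e (d - dist2 p0 q).
pose Z1 q := dscut e (d - dist2 p0 q) * (- 2 * (q.1 - p0.1)).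
pose Z2 q := dscut e (d - dist2 p0 q) * (- 2 * (q.2 - p0.2)).
have CZ q : C1at Z Z1 Z2 q by exact: C1at_bump.
have Z0 q : e < dist2 p0 q -> [/\ Z q = 0, Z1 q = 0 & Z2 q = 0].
  by move=> eq; rewrite /Z /Z1 /Z2 scut_eq0 ?dscut_eq0 ?mul0r//; rewrite /e in eq *; lra.
pose r0 := rho rhop rhom u p0.
(* [F1] and [F2] are the coefficients of [Z1] and [Z2] in the first variation along [Z * (a, b)],
   with the density frozen at [r0]. By symmetry of the second derivatives,
   [div F = - 2 (a g1 + b g2) lap - r0 b]. The first variation integrand is therefore
   [div (Z F) + 2 Z (a g1 + b g2) lap], and the last term is [2 / k0] times [V]. *)
pose F1 q := a * (g2 q * g2 q - g1 q * g1 q) - 2 * b * (g1 q * g2 q) - r0 * a * q.2.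
pose F2 q := b * (g1 q * g1 q - g2 q * g2 q) - 2 * a * (g1 q * g2 q) - r0 * b * q.2.
pose h11 := dx g1; pose h12 := dy g1; pose h21 := dx g2; pose h22 := dy g2.
pose F11 q := a * (2 * g2 q * h21 q - 2 * g1 q * h11 q) - 2 * b * (h11 q * g2 q + g1 q * h21 q).
pose F12 q := a * (2 * g2 q * h22 q - 2 * g1 q * h12 q) - 2 * b * (h12 q * g2 q + g1 q * h22 q) - r0 * a.
pose F21 q := b * (2 * g1 q * h11 q - 2 * g2 q * h21 q) - 2 * a * (h11 q * g2 q + g1 q * h21 q).
pose F22 q := b * (2 * g1 q * h12 q - 2 * g2 q * h22 q) - 2 * a * (h12 q * g2 q + g1 q * h22 q) - r0 * b.
have near0 p : d <= dist2 p0 p -> \forall q \near p, [/\ Z q = 0, Z1 q = 0 & Z2 q = 0].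
  move=> dp; near=> q; apply: Z0; near: q.
  by apply: (cvgr_gt _ (@continuous_dist2 p0 p)); rewrite /e; lra.
have inside p : dist2 p0 p < d -> disk 1 p /\ u p != 0.
  by move=> /dA [? _ uu _]; split => //; apply/eqP => up; move: uu; rewrite up mulr0 ltxx.
have CF p : dist2 p0 p < d -> C1at F1 F11 F12 p /\ C1at F2 F21 F22 p.
  move=> /inside [p1 up]; have [_ G1 G2 _] := sol_C2 usol p1 up.
  have G12 := C1at_mul G1 G2; have G11 := C1at_mul G1 G1; have G22 := C1at_mul G2 G2.
  split.
  - have := C1at_sub (C1at_sub (C1at_mul (C1at_cst a p) (C1at_sub G22 G11))
      (C1at_mul (C1at_cst (2 * b) p) G12)) (C1at_mul (C1at_cst (r0 * a) p) (C1at_snd p)).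
    apply: C1at_near; near=> q; split; [by []| |].
    + rewrite /F11 /h11 /h21; move: (g1 q) (g2 q) (dx g1 q) (dx g2 q) => *; ring.
    + rewrite /F12 /h12 /h22; move: (g1 q) (g2 q) (dy g1 q) (dy g2 q) => *; ring.
  - have := C1at_sub (C1at_sub (C1at_mul (C1at_cst b p) (C1at_sub G11 G22))
      (C1at_mul (C1at_cst (2 * a) p) G12)) (C1at_mul (C1at_cst (r0 * b) p) (C1at_snd p)).
    apply: C1at_near; near=> q; split; [by []| |].
    + rewrite /F21 /h11 /h21; move: (g1 q) (g2 q) (dx g1 q) (dx g2 q) => *; ring.
    + rewrite /F22 /h12 /h22; move: (g1 q) (g2 q) (dy g1 q) (dy g2 q) => *; ring.
have CY1 p : C1at (fun q => Z q * F1 q) (fun q => Z1 q * F1 q + Z q * F11 q) (fun q => Z2 q * F1 q + Z q * F12 q) p.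
  by have [/near0|/CF[C1 _]] := leP d (dist2 p0 p); [exact: C1at_mul0|exact: C1at_mul].
have CY2 p : C1at (fun q => Z q * F2 q) (fun q => Z1 q * F2 q + Z q * F21 q) (fun q => Z2 q * F2 q + Z q * F22 q) p.
  by have [/near0|/CF[_ C1]] := leP d (dist2 p0 p); [exact: C1at_mul0|exact: C1at_mul].
have far p : b0 <= qn p -> [/\ Z p = 0, Z1 p = 0 & Z2 p = 0].
  move=> bp; have [|/dA[_]] := leP d (dist2 p0 p); last by rewrite ltNge bp.
  by move=> h; apply: Z0; rewrite /e; lra.
have b01 : b0 < 1 by rewrite /b0; lra.
have b00 : 0 <= b0 by rewrite /b0; lra.
pose div q := Z1 q * F1 q + Z q * F11 q + (Z2 q * F2 q + Z q * F22 q).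
have I1 : \int[leb2]_(p in disk 1) div p = 0.
  by apply: (Rintegral_divergence b01 CY1 CY2) => p /far [-> _ _]; rewrite mul0r.
have CX1 p := C1at_mul (C1at_cst a p) (CZ p).
have CX2 p := C1at_mul (C1at_cst b p) (CZ p).
have fX p : b0 <= qn p -> forall t : R, t * Z p = 0 by move=> /far [-> _ _] t; rewrite mulr0.
have I2 := sol_variation usol b00 b01 CX1 CX2 (fun p h => fX p h a) (fun p h => fX p h b).
pose V q := Z q * k q.
have cV q : {for q, continuous V}.
  have [/near0 n0|/inside[q1 uq]] := leP d (dist2 p0 q); last first.
    by apply: contM; [case: (CZ q)|exact: ck].
  have [_ _ + _ _] := @C1at_mul0 Z Z1 Z2 k k k q n0; exact.
have V0 q : 0 <= V q.
  have [dq|/dA[_ _ _ kq]] := leP d (dist2 p0 q).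
    by rewrite /V; have [|-> _ _] := Z0 q; [rewrite /e; lra|rewrite mul0r].
  by rewrite /V; apply: mulr_ge0; [exact: scut_ge0|exact: ltW].
suff IV : \int[leb2]_(q in disk 1) V q = 0.
  have := Rintegral_eq0_continuous cV V0 IV p01; apply/eqP.
  rewrite gt_eqF// /V mulr_gt0// /Z /dist2 !subrr mul0r addr0 subr0 scut_pos.
    by rewrite divr_gt0// exprn_gt0// /e; lra.
  by rewrite /e; lra.
have cdiv q : {for q, continuous div}.
  by apply: (@contA _ _ q); [case: (CY1 q)|case: (CY2 q)].
have : \int[leb2]_(q in disk 1) (div q + 2 / k0 * V q) = 0.
  rewrite -I2; apply: eq_Rintegral => q _; rewrite /V /div /k /F1 /F2 /F11 /F22.
  have [dq|dq] := leP d (dist2 p0 q).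
    have [|-> -> ->] := Z0 q; first by rewrite /e; lra.
    by rewrite !(mul0r, mulr0, addr0, subr0).
  have [q1 _ uq _] := dA q dq.
  have -> : rho rhop rhom u q = r0 by exact: same_sign_rho.
  have [_ uq0] := inside q dq.
  have [_ _ _ E] := sol_C2 usol q1 uq0; rewrite /h21 -E.
  rewrite -/h12 -/h11 -/h22.
  move: (g1 q) (g2 q) (Z q) (Z1 q) (Z2 q) (h11 q) (h12 q) (h22 q) => x1 x2 z z1 z2 y1 y2 y3.
  by field.
have iV : leb2.-integrable (disk 1) (EFin \o V) by apply: continuous_integrable_disk => q _; exact: cV.
rewrite (@RintegralD _ _ _ leb2 (disk 1) div (fun q => 2 / k0 * V q) (mdisk 1)).
- rewrite I1 add0r RintegralZl//; [|exact: mdisk].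
  by move=> /eqP; rewrite !mulf_eq0 invr_eq0 (negbTE k00) orbF pnatr_eq0 => /eqP.
- by apply: continuous_integrable_disk => q _; exact: cdiv.
- by apply: continuous_integrable_disk => q _; apply: (@contM _ _ q); [exact: contC|exact: cV].
Unshelve. all: by end_near.
Qed.

(** If the Laplacian were nonzero at [p] it would be nonzero nearby; [sol_grad_lap] would then make
    the gradient vanish on a neighbourhood, and with it the Laplacian at [p]. *)
Lemma sol_harmonic p : disk 1 p -> u p != 0 -> dx g1 p + dy g2 p = 0.
Proof.
pose L q := dx g1 q + dy g2 q.
move=> p1 up; apply/eqP/negP => /negP lp.
have [_ [d11 d12 _ c11 _] [d21 d22 _ _ c22] _] := sol_C2 usol p1 up.
have g0 : \forall q \near p, g1 q = 0 /\ g2 q = 0.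
  near=> q.
  have q1 : disk 1 q by near: q; apply: open_nbhs_nbhs; split => //; exact: open_ball0.
  have uq : u q != 0.
    have : 0 < u p * u q.
      near: q; apply: (cvgr_gt (u p * u p)); last by rewrite -expr2 exprn_even_gt0.
      by apply: cvgM; [exact: cvg_cst|exact: cu].
    by move=> h; apply/eqP => u0; move: h; rewrite u0 mulr0 ltxx.
  have lq : L q != 0.
    have : 0 < L p * L q.
      near: q; apply: (cvgr_gt (L p * L p)); last by rewrite -expr2 exprn_even_gt0.
      by apply: cvgM; [exact: cvg_cst|exact: (@contA _ _ p c11 c22)].
    by move=> h; apply/eqP => u0; move: h; rewrite u0 mulr0 ltxx.
  have /eqP := sol_grad_lap q1 uq; rewrite -/(L q) mulf_eq0 (negbTE lq) orbF -!expr2.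
  by rewrite paddr_eq0 ?sqr_ge0// !sqrf_eq0 => /andP[/eqP -> /eqP ->].
move/eqP: lp; apply.
have -> : dx g1 p = 0.
  rewrite -(derive_cst (0 : R) p e1); apply: near_eq_derive.
  by apply: filterS g0 => q [->].
have -> : dy g2 p = 0.
  rewrite -(derive_cst (0 : R) p e2); apply: near_eq_derive.
  by apply: filterS g0 => q [_ ->].
by rewrite addr0.
Unshelve. all: by end_near.
Qed.

End SolutionHarmonic.
End Harmonic.

(** * Truncations away from the zero set *)

Section OddCut.
Context {R : realType}.
Implicit Types e t : R.

(** For [t > e] the quotient of [dscut^2] by [scut] is [(t + e)^2 / t^3], which decreases from the
    value [4 / e] at [t = e]. With [t = e + s] the remaining polynomial has nonnegative
    coefficients. *)
Lemma dscut_sqr_le e t : 0 < e -> dscut e t ^+ 2 <= 4 / e * scut e t.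
Proof.
move=> e0; have [te|et] := leP t e; first by rewrite scut_eq0// dscut_eq0// expr0n mulr0.
have t0 := lt_trans e0 et.
rewrite scut_pos// dscut_pos// -subr_ge0.
have -> : 4 / e * ((t - e) ^+ 2 / t) - (1 - (e / t) ^+ 2) ^+ 2 =
  (t - e) ^+ 2 / (e * t ^+ 4) * (4 * t ^+ 3 - e * (t + e) ^+ 2) by field; rewrite !gt_eqF.
apply: mulr_ge0; first by rewrite divr_ge0 ?sqr_ge0// mulr_ge0 ?exprn_ge0// ltW.
have [s s0 ->] : exists2 s, 0 < s & t = e + s by exists (t - e); lra.
rewrite (_ : _ - _ = 8 * e ^+ 2 * s + 11 * e * s ^+ 2 + 4 * s ^+ 3); last by ring.
by rewrite !addr_ge0// !mulr_ge0 ?exprn_ge0// ltW.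
Qed.

(** This bounds the squared truncation of [u] by the very weight that multiplies the energy density,
    so that the energy can be absorbed. *)
Lemma scut_sqr_le e t : 0 < e -> scut e t ^+ 2 <= t ^+ 2 * dscut e t.
Proof.
move=> e0; have [te|et] := leP t e; first by rewrite scut_eq0// dscut_eq0// expr0n mulr0.
have t0 := lt_trans e0 et.
rewrite scut_pos// dscut_pos// -subr_ge0.
have -> : t ^+ 2 * (1 - (e / t) ^+ 2) - ((t - e) ^+ 2 / t) ^+ 2 =
  (t - e) / t ^+ 2 * (t ^+ 2 * (t + e) - (t - e) ^+ 3) by field; rewrite gt_eqF.
apply: mulr_ge0; first by rewrite divr_ge0 ?sqr_ge0// subr_ge0 ltW.
have [s s0 ->] : exists2 s, 0 < s & t = e + s by exists (t - e); lra.
rewrite (_ : _ - _ = 2 * e ^+ 3 + 5 * e ^+ 2 * s + 4 * e * s ^+ 2); last by ring.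
by rewrite !addr_ge0// !mulr_ge0 ?exprn_ge0// ltW.
Qed.

Lemma dscut_antitone e e' t : 0 < e -> e <= e' -> dscut e' t <= dscut e t.
Proof.
move=> e0 ee; have e'0 := lt_le_trans e0 ee.
have [te|et] := leP t e'; first by rewrite (dscut_eq0 e'0 te) dscut_ge0.
have t0 := lt_trans e'0 et.
rewrite !dscut_pos//; last exact: le_lt_trans et.
rewrite lerD2l lerN2 ler_sqr ?nnegrE ?divr_ge0 ?(ltW e0) ?(ltW e'0) ?(ltW t0)//.
by rewrite ler_wpM2r ?invr_ge0// ltW.
Qed.

(** The odd extension treats both phases at once: [fcut e (u p)] is a C^1 truncation of [u p] that
    vanishes where [|u p| <= e], hence near every zero of [u] in the disk. *)
Definition fcut e t := scut e t - scut e (- t).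
Definition dfcut e t := dscut e t + dscut e (- t).

Lemma fcutN e t : fcut e (- t) = - fcut e t.
Proof. by rewrite /fcut opprK opprB. Qed.

Lemma dfcutN e t : dfcut e (- t) = dfcut e t.
Proof. by rewrite /dfcut opprK addrC. Qed.

Lemma fcut_ge0E e t : 0 < e -> 0 <= t -> fcut e t = scut e t /\ dfcut e t = dscut e t.
Proof.
move=> e0 t0; have te : - t <= e by lra.
by rewrite /fcut /dfcut (scut_eq0 te) (dscut_eq0 e0 te) subr0 addr0.
Qed.

Lemma fcut_eq0 e t : 0 < e -> `|t| <= e -> fcut e t = 0 /\ dfcut e t = 0.
Proof.
rewrite ler_norml => e0 /andP[h1 h2]; have h3 : - t <= e by lra.
by rewrite /fcut /dfcut !scut_eq0// !dscut_eq0// subr0 addr0.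
Qed.

Lemma is_derive_fcut e t : 0 < e -> is_derive t (1 : R) (fcut e) (dfcut e t).
Proof.
move=> e0.
have dN : is_derive t (1 : R) (fun t => - t) (-1 : R) by exact: isd_opp (is_derive_id t 1).
have := isd_sub (is_derive_scut t e0) (isd_comp (is_derive_scut (- t) e0) dN).
by rewrite mulrN1 opprK.
Qed.

Lemma continuous_fcut e : 0 < e -> continuous (fcut e).
Proof.
move=> e0 t; apply: cvgB; first exact: continuous_scut.
by apply: (@continuous_comp _ _ _ -%R (scut e)); [exact: opp_continuous|exact: continuous_scut].
Qed.

Lemma continuous_dfcut e : 0 < e -> continuous (dfcut e).
Proof.
move=> e0 t; apply: cvgD; first exact: continuous_dscut.
by apply: (@continuous_comp _ _ _ -%R (dscut e)); [exact: opp_continuous|exact: continuous_dscut].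
Qed.

Lemma fcut_bounds e t : 0 < e -> [/\ `|fcut e t| <= `|t|, fcut e t ^+ 2 <= t ^+ 2 * dfcut e t & 0 <= dfcut e t <= 1].
Proof.
move=> e0; wlog t0 : t / 0 <= t.
  move=> H; have [/H//|t0] := leP 0 t.
  by have := H (- t); rewrite fcutN dfcutN !normrN !sqrrN; apply; lra.
have [-> ->] := fcut_ge0E e0 t0; split.
- by rewrite !ger0_norm ?scut_ge0// (le_trans (scut_le _ e0))// max_l.
- exact: scut_sqr_le.
- by rewrite dscut_ge0// dscut_le1.
Qed.

Lemma dfcut_antitone e e' t : 0 < e -> e <= e' -> dfcut e' t <= dfcut e t.
Proof. by move=> e0 ee; apply: lerD; exact: dscut_antitone. Qed.

Lemma cvg_fcut t : fcut n.+1%:R^-1 t @[n --> \oo] --> t.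
Proof.
rewrite [X in _ --> X](_ : t = Num.max t 0 - Num.max (- t) 0); last first.
  by case: (leP t 0); case: (leP (- t) 0); lra.
by apply: cvgB; exact: cvg_scut.
Qed.

Lemma cvg_dfcut t : dfcut n.+1%:R^-1 t @[n --> \oo] --> (if t != 0 then 1 else 0 : R).
Proof.
rewrite [X in _ --> X](_ : _ = (if 0 < t then 1 else 0) + (if 0 < - t then 1 else 0)); last first.
  by rewrite oppr_gt0 neq_lt; case: ltgtP => _ /=; lra.
by apply: cvgD; exact: cvg_dscut.
Qed.

End OddCut.

Section Glue.
Context {R : realType}.
Notation mu := (@lebesgue_measure R).
Notation leb2 := (@leb2 R).
Notation disk := (@Defs.ball0 R).
Implicit Types (u w v : R * R -> R) (p : R * R).
Variable (u : R * R -> R) (e b : R).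
Hypotheses (cu : forall p, disk 1 p -> {for p, continuous u}) (e0 : 0 < e) (b1 : b < 1).

Let outside p : (disk 1 p -> u p = 0) ->
  \forall q \near p, b <= qn q \/ (disk 1 q /\ `|u q| <= e).
Proof.
move=> up; have [p1|p1] := pselect (disk 1 p).
  near=> q; right; split.
    by near: q; apply: open_nbhs_nbhs; split => //; exact: open_ball0.
  rewrite ltW//; near: q; apply: (cvgr_lt `|u p|); last by rewrite up// normr0.
  by apply: cvg_norm; exact: cu.
near=> q; left; rewrite ltW//; near: q; apply: (cvgr_gt _ (@continuous_qn R p)).
apply: lt_le_trans b1 _; rewrite leNgt; apply/negP => h; apply: p1.
by rewrite /Defs.ball0/= expr1n.
Unshelve. all: by end_near.
Qed.

(** A point outside the disk has a neighbourhood in [b <= qn q] since [b < 1], and a zero of [u] in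
    the disk has one where [|u q| <= e] by continuity. Thus [w] is locally zero wherever its
    regularity is not given. *)
Lemma glue_C1at w w1 w2 : (forall p, disk 1 p -> u p != 0 -> C1at w w1 w2 p) ->
  (forall p, b <= qn p -> [/\ w p = 0, w1 p = 0 & w2 p = 0]) ->
  (forall p, disk 1 p -> `|u p| <= e -> [/\ w p = 0, w1 p = 0 & w2 p = 0]) ->
  forall p, C1at w w1 w2 p.
Proof.
move=> Cw wb we p; have [[p1 up]|/not_andP pn] := pselect (disk 1 p /\ u p != 0).
  exact: Cw.
have pz : disk 1 p -> u p = 0 by case: pn => // /negP; rewrite negbK => /eqP.
apply: C1at_near (C1at_cst 0 p); apply: filterS (outside pz) => q.
by case=> [/wb|[q1 uq]]; [|exact: we].
Qed.

Lemma glue_continuous w : (forall p, disk 1 p -> u p != 0 -> {for p, continuous w}) ->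
  (forall p, b <= qn p -> w p = 0) -> (forall p, disk 1 p -> `|u p| <= e -> w p = 0) ->
  forall p, {for p, continuous w}.
Proof.
move=> cw wb we p; have [[p1 up]|/not_andP pn] := pselect (disk 1 p /\ u p != 0).
  exact: cw.
have pz : disk 1 p -> u p = 0 by case: pn => // /negP; rewrite negbK => /eqP.
have w0 : \forall q \near p, w q = 0.
  by apply: filterS (outside pz) => q; case=> [/wb|[q1 uq]]; [|exact: we].
have wp := nbhs_singleton w0.
rewrite /prop_for /continuous_at wp; apply: cvg_near_cst; exact: w0.
Qed.

End Glue.

Section Integrals.
Context {R : realType}.
Notation leb2 := (@leb2 R).
Notation disk := (@Defs.ball0 R).
Implicit Types (u w v P Q : R * R -> R) (p : R * R).

Lemma monotone_integrable d (T : measurableType d) (m : {measure set T -> \bar R}) (D : set T)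
    (h : nat -> T -> R) (f : T -> R) (K : R) : measurable D ->
  (forall n, measurable_fun D (h n)) -> (forall n x, D x -> 0 <= h n x) ->
  (forall x, D x -> nondecreasing_seq (h ^~ x)) -> (forall x, D x -> h n x @[n --> \oo] --> f x) ->
  (forall n, (\int[m]_(x in D) (h n x)%:E <= K%:E)%E) ->
  m.-integrable D (EFin \o f).
Proof.
move=> mD mh h0 hm hf hK.
have mf : measurable_fun D f by exact: measurable_fun_cvg mh hf.
have f0 x : D x -> 0 <= f x.
  by move=> Dx; apply: (cvgr_to_ge (hf x Dx)); apply: nearW => n; exact: h0.
have mE n : measurable_fun D (EFin \o h n) by exact/measurable_EFinP.
have pE n x : D x -> (0 <= (EFin \o h n) x)%E by move=> Dx; rewrite lee_fin h0.
have nE x : D x -> nondecreasing_seq (fun n => (EFin \o h n) x).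
  by move=> Dx n k nk; rewrite lee_fin hm.
have cI := @cvg_monotone_convergence _ _ _ m D mD _ mE pE nE.
apply/integrableP; split; first exact/measurable_EFinP.
have -> : (\int[m]_(x in D) `|(EFin \o f) x| = \int[m]_(x in D) limn (fun n => (h n x)%:E))%E.
  apply: eq_integral => x; rewrite inE => Dx; rewrite /= ger0_norm ?f0//.
  apply/esym/cvg_lim => //; apply: cvg_EFin; [exact: nearW|exact: hf].
apply: (@le_lt_trans _ _ K%:E); last exact: ltry.
by apply: (cvge_to_le cI); apply: nearW.
Qed.

Lemma C1at_qcut (e b : R) p : 0 < e ->
  C1at (fun q => scut e (b - qn q)) (fun q => dscut e (b - qn q) * (- 2 * q.1))
   (fun q => dscut e (b - qn q) * (- 2 * q.2)) p.
Proof.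
move=> e0; apply: C1at_near (C1at_bump 0 b p e0); near=> q.
have -> : dist2 0 q = qn q by rewrite /dist2 /qn !subr0 !expr2.
by rewrite !subr0.
Unshelve. all: by end_near.
Qed.

Lemma qcut0 (e b : R) p : 0 < e -> b <= qn p -> scut e (b - qn p) = 0 /\ dscut e (b - qn p) = 0.
Proof. by move=> e0 bp; rewrite scut_eq0 ?dscut_eq0//; lra. Qed.

Lemma continuous_dqcut (e b : R) : 0 < e -> continuous (fun q : R * R => dscut e (b - qn q)).
Proof.
move=> e0 p; apply: (continuous_comp (f := fun q => b - qn q)); last exact: continuous_dscut.
by apply: continuousB; [exact: cst_continuous|exact: continuous_qn].
Qed.

Lemma integrable_qcut (k : R -> R) (M b c : R) P : continuous k -> (forall t, t <= b -> `|k t| <= M) ->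
  leb2.-integrable (disk c) (EFin \o P) ->
  leb2.-integrable (disk c) (EFin \o (fun p => k (b - qn p) * P p)).
Proof.
move=> ck kM; apply: (@integrable_bdM _ _ _ leb2 _ (mdisk c) P (fun p => k (b - qn p)) M).
  apply: measurableT_comp (continuous_measurable_fun ck) _.
  by apply: measurable_funB => //; apply: measurable_funTS; exact: measurable_qn.
by move=> p _; apply: kM; rewrite lerBlDr lerDl qn_ge0.
Qed.

(** The radial weights vanish outside the disk of radius [c], and inside it both terms are
    integrable, so the integral of the difference can be split. *)
Lemma qcut_split (e b c : R) P Q : 0 < e -> 0 < b -> b < c ^+ 2 -> 0 < c -> c <= 1 ->
  leb2.-integrable (disk c) (EFin \o P) -> leb2.-integrable (disk c) (EFin \o Q) ->
  \int[leb2]_(p in disk 1) (scut e (b - qn p) * P p - 2 * (dscut e (b - qn p) * Q p)) = 0 ->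
  \int[leb2]_(p in disk c) (scut e (b - qn p) * P p) = 2 * \int[leb2]_(p in disk c) (dscut e (b - qn p) * Q p).
Proof.
move=> e0 b0 bc c0 c1 Pi Qi.
rewrite (Rintegral_subdisk (g := fun p => scut e (b - qn p) * P p - 2 * (dscut e (b - qn p) * Q p)) c0 c1) //; last first.
  move=> p /negP; rewrite /Defs.ball0/= -leNgt => cp.
  by have [|-> ->] := @qcut0 e b p e0; [exact: ltW (lt_le_trans bc cp)|rewrite !mul0r mulr0 subr0].
have SP : leb2.-integrable (disk c) (EFin \o (fun p => scut e (b - qn p) * P p)).
  apply: (@integrable_qcut _ b) Pi; first exact: continuous_scut.
  by move=> t tb; rewrite ger0_norm ?scut_ge0// (le_trans (scut_le t e0))// ge_max tb ltW.
have DQ : leb2.-integrable (disk c) (EFin \o (fun p => dscut e (b - qn p) * Q p)).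
  apply: (@integrable_qcut _ 1) Qi; first exact: continuous_dscut.
  by move=> t _; rewrite ger0_norm ?dscut_ge0// dscut_le1.
rewrite RintegralB//; [|exact: mdisk|].
  by rewrite RintegralZl//; [|exact: mdisk]; move/eqP; rewrite subr_eq0 => /eqP.
by have := integrableZl (mdisk c) 2 DQ; apply: eq_integrable => //; exact: mdisk.
Qed.

(** Removes the truncation of [u] by dominated convergence while the radial cut-off stays fixed; the
    cut-off itself is removed afterwards, in [radial]. *)
Lemma qcut_limit (e b c : R) (P_ Q_ : nat -> R * R -> R) P Q gP gQ : 0 < e -> 0 < b -> b < c ^+ 2 -> 0 < c -> c <= 1 ->
  (forall n, measurable_fun (disk c) (P_ n)) -> (forall n, measurable_fun (disk c) (Q_ n)) ->
  (forall p, disk c p -> P_ n p @[n --> \oo] --> P p) -> (forall p, disk c p -> Q_ n p @[n --> \oo] --> Q p) ->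
  leb2.-integrable (disk c) (EFin \o gP) -> leb2.-integrable (disk c) (EFin \o gQ) ->
  (forall n p, disk c p -> `|P_ n p| <= gP p) -> (forall n p, disk c p -> `|Q_ n p| <= gQ p) ->
  (forall n, \int[leb2]_(p in disk 1) (scut e (b - qn p) * P_ n p - 2 * (dscut e (b - qn p) * Q_ n p)) = 0) ->
  \int[leb2]_(p in disk c) (scut e (b - qn p) * P p) = 2 * \int[leb2]_(p in disk c) (dscut e (b - qn p) * Q p).
Proof.
move=> e0 b0 bc c0 c1 mP mQ cP cQ iP iQ hP hQ PQ.
have mD := mdisk c.
have mq : measurable_fun (disk c) (fun p => b - qn p).
  by apply: measurable_funB => //; apply: measurable_funTS; exact: measurable_qn.
have {}PQ n : \int[leb2]_(p in disk c) (scut e (b - qn p) * P_ n p) = 2 * \int[leb2]_(p in disk c) (dscut e (b - qn p) * Q_ n p).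
  apply: qcut_split => //.
  - by apply: (@integrable_le _ _ _ leb2 _ mD _ _ (mP n)) iP => p; exact: hP.
  - by apply: (@integrable_le _ _ _ leb2 _ mD _ _ (mQ n)) iQ => p; exact: hQ.
have [||||_ cl1] := @cvg_Rintegral_dom _ _ _ leb2 _ mD
   (fun n p => scut e (b - qn p) * P_ n p) (fun p => scut e (b - qn p) * P p) (fun p => b * gP p).
- move=> n; apply: measurable_funM; last exact: mP.
  by apply: measurableT_comp mq; apply: continuous_measurable_fun; exact: continuous_scut.
- by move=> p cp; apply: cvgM; [exact: cvg_cst|exact: cP].
- by have := integrableZl mD b iP; apply: eq_integrable.
- move=> n p cp; rewrite normrM; apply: ler_pM => //; last exact: hP.
  by rewrite ger0_norm ?scut_ge0// (le_trans (scut_le _ e0))// ge_max (ltW b0) andbT lerBlDr lerDl qn_ge0.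
have [||||_ cl2] := @cvg_Rintegral_dom _ _ _ leb2 _ mD
   (fun n p => dscut e (b - qn p) * Q_ n p) (fun p => dscut e (b - qn p) * Q p) gQ.
- move=> n; apply: measurable_funM; last exact: mQ.
  by apply: measurableT_comp mq; apply: continuous_measurable_fun; exact: continuous_dscut.
- by move=> p cp; apply: cvgM; [exact: cvg_cst|exact: cQ].
- exact: iQ.
- move=> n p cp; rewrite normrM -[leRHS]mul1r; apply: ler_pM => //; last exact: hQ.
  by rewrite ger0_norm ?dscut_ge0// dscut_le1.
have cl3 : (fun n => 2 * \int[leb2]_(p in disk c) (dscut e (b - qn p) * Q_ n p)) @ \oo -->
    2 * \int[leb2]_(p in disk c) (dscut e (b - qn p) * Q p).
  by apply: cvgM; [exact: cvg_cst|exact: cl2].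
apply: (cvg_unique (@Rhausdorff R) cl1).
by apply: cvg_trans cl3; apply: near_eq_cvg; apply: nearW => n; rewrite PQ.
Qed.

End Integrals.

(** * Regularised identities and the Caccioppoli estimate *)

Section SolutionIntegrals.
Context {R : realType}.
Notation leb2 := (@leb2 R).
Notation disk := (@Defs.ball0 R).
Implicit Types (w v P Q : R * R -> R) (p : R * R).
Variables (rhop rhom : R) (u : R * R -> R).
Hypothesis usol : variational_solution rhop rhom u.
Notation g1 := (grad1 u).
Notation g2 := (grad2 u).

Definition gradsq p := grad1 u p ^+ 2 + grad2 u p ^+ 2.
(** This is [x . grad u], the radial derivative multiplied by [|x|]. *)
Definition gradx p := p.1 * grad1 u p + p.2 * grad2 u p.

Lemma sol_continuous p : disk 1 p -> {for p, continuous u}.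
Proof. by have [_ + _ _ _] := usol; apply. Qed.

Lemma gradx_sqr_le p : gradx p ^+ 2 <= qn p * gradsq p.
Proof. by rewrite /gradx /qn /gradsq; move: p.1 p.2 (grad1 u p) (grad2 u p) => a b c d; have := sqr_ge0 (a * d - b * c); nra. Qed.

Lemma gradsq_ge0 p : 0 <= gradsq p.
Proof. by rewrite addr_ge0 ?sqr_ge0. Qed.

Section Regularized.
Variables (d e b : R).
Hypotheses (d0 : 0 < d) (e0 : 0 < e) (b1 : b < 1).
Notation S := (fun q => scut e (b - qn q)).
Notation D := (fun q => dscut e (b - qn q)).
Notation k := (fun q => dfcut d (u q)).
Notation f := (fun q => fcut d (u q)).

Let C1u p : disk 1 p -> u p != 0 -> C1at f (fun q => k q * g1 q) (fun q => k q * g2 q) p.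
Proof.
move=> p1 up; have [Cu _ _ _] := sol_C2 usol p1 up.
apply: C1at_comp Cu; [move=> t; exact: is_derive_fcut|exact: continuous_fcut|exact: continuous_dfcut].
Qed.

Let T1 q := k q * g1 q * S q + f q * (D q * (- 2 * q.1)).
Let T2 q := k q * g2 q * S q + f q * (D q * (- 2 * q.2)).

Let C1T p : disk 1 p -> u p != 0 -> C1at (fun q => f q * S q) T1 T2 p.
Proof. by move=> p1 up; apply: C1at_mul; [exact: C1u|exact: C1at_qcut]. Qed.

Let C1glue v v1 v2 : (forall p, disk 1 p -> u p != 0 -> C1at v v1 v2 p) ->
  forall p, C1at (fun q => f q * S q * v q) (fun q => T1 q * v q + f q * S q * v1 q)
     (fun q => T2 q * v q + f q * S q * v2 q) p.
Proof.
move=> Cv; apply: (glue_C1at sol_continuous d0 b1).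
- by move=> p p1 up; apply: C1at_mul; [exact: C1T|exact: Cv].
- by move=> p bp; rewrite /T1 /T2; have [-> ->] := qcut0 e0 bp; rewrite !(mulr0, mul0r, addr0).
- by move=> p _ up; rewrite /T1 /T2; have [-> ->] := fcut_eq0 d0 up; rewrite !(mulr0, mul0r, addr0).
Qed.

(** Divergence theorem for the field [S f(u) grad u], where the gradient of [S] is [- 2 D x]. The
    term [S f(u) Lap u] drops out: [u] is harmonic where it is nonzero, and [f(u) = 0] elsewhere. *)
Lemma energy_regularized :
  \int[leb2]_(p in disk 1) (S p * (k p * gradsq p) - 2 * (D p * (f p * gradx p))) = 0.
Proof.
have C1 : forall p, disk 1 p -> u p != 0 -> C1at g1 (dx g1) (dy g1) p.
  by move=> p p1 up; have [] := sol_C2 usol p1 up.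
have C2 : forall p, disk 1 p -> u p != 0 -> C1at g2 (dx g2) (dy g2) p.
  by move=> p p1 up; have [] := sol_C2 usol p1 up.
have := Rintegral_divergence b1 (C1glue C1) (C1glue C2).
move=> H; rewrite -[RHS]H; last 2 first.
- by move=> p bp; have [-> _] := qcut0 e0 bp; rewrite mulr0 mul0r.
- by move=> p bp; have [-> _] := qcut0 e0 bp; rewrite mulr0 mul0r.
apply: eq_Rintegral => p; rewrite inE => p1; rewrite /T1 /T2 /gradsq /gradx.
have hl : f p * (dx g1 p + dy g2 p) = 0.
  have [up|up] := eqVneq (u p) 0; last by rewrite (sol_harmonic usol) ?mulr0.
  by rewrite (fcut_eq0 d0 _).1 ?mul0r// up normr0 ltW.
move: hl; move: (f p) (dx g1 p) (dy g2 p) => x y z hl.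
rewrite -[LHS](addr0) -[X in _ + X](mulr0 (S p)) -hl; ring.
Qed.

(** Divergence theorem for the field [S f(u)^2 x]; the first term comes from [div x = 2]. *)
Lemma mass_regularized :
  \int[leb2]_(p in disk 1) (S p * (2 * f p ^+ 2 + 2 * (f p * (k p * gradx p))) - 2 * (D p * (qn p * f p ^+ 2))) = 0.
Proof.
have C1 p : disk 1 p -> u p != 0 -> C1at (fun q => f q * q.1) (fun q => k q * g1 q * q.1 + f q * 1) (fun q => k q * g2 q * q.1 + f q * 0) p.
  by move=> p1 up; apply: C1at_mul; [exact: C1u|exact: C1at_fst].
have C2 p : disk 1 p -> u p != 0 -> C1at (fun q => f q * q.2) (fun q => k q * g1 q * q.2 + f q * 0) (fun q => k q * g2 q * q.2 + f q * 1) p.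
  by move=> p1 up; apply: C1at_mul; [exact: C1u|exact: C1at_snd].
have := Rintegral_divergence b1 (C1glue C1) (C1glue C2).
move=> H; rewrite -[RHS]H; last 2 first.
- by move=> p bp; have [-> _] := qcut0 e0 bp; rewrite mulr0 mul0r.
- by move=> p bp; have [-> _] := qcut0 e0 bp; rewrite mulr0 mul0r.
apply: eq_Rintegral => p _; rewrite /T1 /T2 /gradsq /gradx /qn.
move: (f p) (k p) (S p) (D p) => *; ring.
Qed.

(** Both regularised integrands are continuous on the whole plane, so their integrals are finite
    before anything is known about [gradsq]. *)
Lemma continuous_regularized : (forall p, {for p, continuous (fun q => S q * (k q * gradsq q))}) /\
  (forall p, {for p, continuous (fun q => D q * (f q * gradx q))}).
Proof.
split; apply: (glue_continuous sol_continuous d0 b1).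
- move=> p p1 up; have [[_ _ cup c1 c2] _ _ _] := sol_C2 usol p1 up.
  have [_ _ cS _ _] := C1at_qcut b p e0.
  apply: continuousM cS _; apply: continuousM; last by apply: continuousD; apply: continuousM.
  by apply: continuous_comp cup _; exact: continuous_dfcut.
- by move=> p bp; have [-> _] := qcut0 e0 bp; rewrite mul0r.
- by move=> p _ up; have [_ ->] := fcut_eq0 d0 up; rewrite mul0r mulr0.
- move=> p p1 up; have [[_ _ cup c1 c2] _ _ _] := sol_C2 usol p1 up.
  apply: continuousM; first exact: continuous_dqcut.
  apply: continuousM; first by apply: continuous_comp cup _; exact: continuous_fcut.
  apply: continuousD; apply: continuousM; [exact: cvg_fst|exact: c1|exact: cvg_snd|exact: c2].
- by move=> p bp; have [_ ->] := qcut0 e0 bp; rewrite mul0r.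
- by move=> p _ up; have [-> _] := fcut_eq0 d0 up; rewrite mul0r mulr0.
Qed.

End Regularized.

Lemma sol_measurable_scal (a : R -> R) : continuous a -> measurable_fun (disk 1) (fun p => a (u p)).
Proof.
move=> ca; apply: continuous_measurable2; first exact: open_ball0.
move=> p; rewrite inE => p1; apply: continuous_comp (sol_continuous p1) _; exact: ca.
Qed.

Lemma sol_measurable : measurable_fun (disk 1) u.
Proof. by apply: (sol_measurable_scal (a := id)) => x; exact: cvg_id. Qed.

(** A component of the gradient may be discontinuous at zeros of [u], but it is the pointwise limit
    of the continuous functions [dfcut (1 / (n + 1)) (u p) * g p], since it vanishes at those
    zeros. *)
Let mgrad (g : R * R -> R) : (forall p, disk 1 p -> u p != 0 -> {for p, continuous g}) ->
  (forall p, disk 1 p -> u p = 0 -> g p = 0) -> measurable_fun (disk 1) g.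
Proof.
move=> cg g0; pose h n p := dfcut n.+1%:R^-1 (u p) * g p.
have n0 n : 0 < n.+1%:R^-1 :> R by rewrite invr_gt0.
apply: (@measurable_fun_cvg _ _ _ (disk 1) h) => [n|p p1]; last first.
  have -> : g p = (if u p != 0 then 1 else 0) * g p.
    by case: eqVneq => [up|_]; rewrite ?mul1r// mul0r g0.
  by apply: cvgM; [exact: cvg_dfcut|exact: cvg_cst].
apply: continuous_measurable2; first exact: open_ball0.
move=> p; rewrite inE => p1; have [up|up] := eqVneq (u p) 0; last first.
  have h1 : {for p, continuous (fun q => dfcut n.+1%:R^-1 (u q))}.
    by apply: continuous_comp (sol_continuous p1) _; exact: continuous_dfcut.
  exact: continuousM h1 (cg p p1 up).
have h0 : \forall q \near p, h n q = 0.
  near=> q; rewrite /h; suff /(fcut_eq0 (n0 n))[_ ->] : `|u q| <= n.+1%:R^-1 by rewrite mul0r.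
  rewrite ltW//; near: q; apply: (cvgr_lt `|u p|); last by rewrite up normr0 n0.
  by apply: cvg_norm; exact: sol_continuous.
have hp := nbhs_singleton h0.
rewrite /prop_for /continuous_at hp; apply: cvg_near_cst; exact: h0.
Unshelve. all: by end_near.
Qed.

Lemma measurable_gx : measurable_fun (disk 1) g1.
Proof.
apply: mgrad => [p p1 up|p p1 up]; last by have [] := sol_grad0 usol p1 up.
by have [[_ _ _ + _] _ _ _] := sol_C2 usol p1 up.
Qed.

Lemma measurable_gy : measurable_fun (disk 1) g2.
Proof.
apply: mgrad => [p p1 up|p p1 up]; last by have [] := sol_grad0 usol p1 up.
by have [[_ _ _ _ +] _ _ _] := sol_C2 usol p1 up.
Qed.

Lemma measurable_gradsq : measurable_fun (disk 1) gradsq.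
Proof. by apply: measurable_funD; apply: measurable_funX; [exact: measurable_gx|exact: measurable_gy]. Qed.

Lemma measurable_gradx : measurable_fun (disk 1) gradx.
Proof.
apply: measurable_funD; apply: measurable_funM; [|exact: measurable_gx| |exact: measurable_gy].
- by apply: measurable_funTS; exact: measurable_fst.
- by apply: measurable_funTS; exact: measurable_snd.
Qed.

(* Caccioppoli: absorb half of the energy by AM-GM, using f^2 <= u^2 f' and S'^2 <= (4/e) S *)
Lemma gradsq_integrable (c : R) : 0 < c -> c < 1 -> leb2.-integrable (disk c) (EFin \o gradsq).
Proof.
(* [b] is the midpoint of [c^2] and 1, and [b - c^2 = 2 e]: the radial cut-off is supported inside
   the unit disk and stays away from zero on the disk of radius [c]. *)
move=> c0 c1; pose b := (1 + c ^+ 2) / 2; pose e := (1 - c ^+ 2) / 4.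
have c2 : c ^+ 2 < 1 by rewrite exprn_ilt1// ltW.
have c20 : 0 < c ^+ 2 by rewrite exprn_gt0.
have b1 : b < 1 by rewrite /b; lra.
have b0 : 0 < b by rewrite /b; lra.
have e0 : 0 < e by rewrite /e; lra.
have sub : disk c `<=` disk 1 by apply: disk_subset => //; exact: ltW.
pose r := Num.sqrt b; have rE : r ^+ 2 = b by rewrite sqr_sqrtr ?ltW.
have [M M0 uM] : exists2 M, 0 < M & forall p, qn p <= b -> `|u p| <= M.
  have [p pr|M M0 uM] := bounded_on (@compact_cdisk R r) (w := u).
    apply: sol_continuous; move: pr; rewrite /cdisk /Defs.ball0/= rE expr1n => /le_lt_trans; exact.
  by exists M => // p pb; apply: uM; rewrite /cdisk/= rE.
(* The two cut-off inequalities give [(2 B)^2 <= 2 A m] with [m = 8 / e * u^2], and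
   [2 a m <= (a / 2 + m)^2] yields [2 B <= A / 2 + m]; [K] bounds [m] where [qn p <= b]. *)
pose K := 8 / e * M ^+ 2.
have K0 : 0 <= K by rewrite /K mulr_ge0 ?sqr_ge0// divr_ge0// ltW.
pose A d p := scut e (b - qn p) * (dfcut d (u p) * gradsq p).
pose B d p := dscut e (b - qn p) * (fcut d (u p) * gradx p).
have bound d p : 0 < d -> disk 1 p -> 2 * B d p <= A d p / 2 + K.
  rewrite /Defs.ball0/= expr1n -/(qn p) => d0 p1; rewrite /A /B.
  have [bp|pb] := leP b (qn p).
    by have [-> ->] := qcut0 e0 bp; rewrite !mul0r mulr0 add0r.
  have [_ ff /andP[k0 _]] := fcut_bounds (u p) d0.
  have SS := dscut_sqr_le (b - qn p) e0.
  have S0 := scut_ge0 (b - qn p) e0.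
  have uu := uM p (ltW pb).
  have G0 := gradsq_ge0 p.
  have XX : gradx p ^+ 2 <= gradsq p.
    by apply: le_trans (gradx_sqr_le p) _; rewrite ler_piMl// ltW.
  have UU : u p ^+ 2 <= M ^+ 2 by rewrite -[leLHS]real_normK ?num_real// ler_sqr ?nnegrE// ltW.
  move: (u p) (scut e (b - qn p)) (dscut e (b - qn p)) (fcut d (u p)) (dfcut d (u p)) (gradsq p) (gradx p) => v s D f k g x in ff k0 SS S0 uu G0 XX UU *.
  rewrite /K.
  have H : (2 * (D * (f * x))) ^+ 2 <= 2 * (s * (k * g)) * (8 / e * v ^+ 2).
    have -> : (2 * (D * (f * x))) ^+ 2 = 4 * (D ^+ 2 * (f ^+ 2 * x ^+ 2)) by ring.
    have -> : 2 * (s * (k * g)) * (8 / e * v ^+ 2) = 4 * ((4 / e * s) * (v ^+ 2 * k * g)).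
      by field; rewrite gt_eqF.
    rewrite ler_pM2l//; apply: ler_pM; [exact: sqr_ge0|by apply: mulr_ge0; exact: sqr_ge0|exact: SS|].
    by apply: ler_pM; [exact: sqr_ge0|exact: sqr_ge0|exact: ff|exact: XX].
  have a0 : 0 <= s * (k * g) by rewrite !mulr_ge0.
  have m0 : 0 <= 8 / e * v ^+ 2 by rewrite mulr_ge0 ?sqr_ge0// divr_ge0// ltW.
  have mK : 8 / e * v ^+ 2 <= 8 / e * M ^+ 2 by rewrite ler_wpM2l// divr_ge0// ltW.
  apply: (@le_trans _ _ (s * (k * g) / 2 + 8 / e * v ^+ 2)); last by rewrite lerD2l.
  move: (s * (k * g)) (8 / e * v ^+ 2) (2 * (D * (f * x))) => a m t in H a0 m0 *.
  rewrite -(@ger0_norm _ (a / 2 + m)); last lra.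
  apply: le_trans (ler_norm t) _; rewrite -ler_sqr ?nnegrE//.
  rewrite !real_normK ?num_real//; apply: le_trans H _.
  by rewrite -subr_ge0 (_ : _ - _ = (a / 2 - m) ^+ 2) ?sqr_ge0//; field.
pose L := fine (leb2 (disk 1)).
have intA d : 0 < d -> leb2.-integrable (disk 1) (EFin \o A d).
  move=> d0; apply: continuous_integrable_disk => p _; by have [+ _] := continuous_regularized d0 e0 b1; apply.
have intB d : 0 < d -> leb2.-integrable (disk 1) (EFin \o B d).
  move=> d0; apply: continuous_integrable_disk => p _; by have [_ +] := continuous_regularized d0 e0 b1; apply.
(* The regularised energy identity equates the integrals of [A] and [2 B]. Half of the finite
   integral of [A] is absorbed, and the resulting bound does not depend on the truncation level
   [d]. *)
have AK d : 0 < d -> \int[leb2]_(p in disk 1) A d p <= 2 * (K * L).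
  move=> d0; have := energy_regularized d0 e0 b1.
  have iB2 : leb2.-integrable (disk 1) (EFin \o (fun p => 2 * B d p)).
    by have := integrableZl (mdisk 1) 2 (intB d d0); apply: eq_integrable => //; exact: mdisk.
  have iA2 : leb2.-integrable (disk 1) (EFin \o (fun p => 2^-1 * A d p)).
    by have := integrableZl (mdisk 1) 2^-1 (intA d d0); apply: eq_integrable => //; exact: mdisk.
  have iK : leb2.-integrable (disk 1) (EFin \o (fun=> K)).
    by apply: continuous_integrable_disk => p _; exact: cst_continuous.
  have iAK : leb2.-integrable (disk 1) (EFin \o (fun p => 2^-1 * A d p + K)).
    by have := integrableD (mdisk 1) iA2 iK; apply: eq_integrable => //; exact: mdisk.
  rewrite (@RintegralB _ _ _ leb2 (disk 1) (A d) (fun p => 2 * B d p) (mdisk 1) (intA d d0) iB2) => /eqP.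
  rewrite subr_eq0 => /eqP AB.
  have : \int[leb2]_(p in disk 1) (2 * B d p) <= \int[leb2]_(p in disk 1) (2^-1 * A d p + K).
    apply: (@le_Rintegral _ _ _ leb2 (disk 1) _ _ (mdisk 1) iB2 iAK) => p p1.
    by rewrite [2^-1 * _]mulrC; exact: bound.
  rewrite (@RintegralD _ _ _ leb2 (disk 1) _ _ (mdisk 1) iA2 iK).
  rewrite (@RintegralZl _ _ _ leb2 (disk 1) (A d) 2^-1 (mdisk 1) (intA d d0)).
  rewrite (@Rintegral_cst _ _ _ leb2 (disk 1) (mdisk 1)) -AB -/L; lra.
have n0 n : 0 < n.+1%:R^-1 :> R by rewrite invr_gt0.
have mS : measurable_fun (disk c) gradsq by apply: (measurable_funS (mdisk 1) sub); exact: measurable_gradsq.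
(* As the level decreases, the weights [dfcut] increase to the indicator of [u != 0]; the gradient
   vanishes on the complement, so the limit is [gradsq] itself. *)
apply: (@monotone_integrable _ _ _ leb2 (disk c) (fun n p => dfcut n.+1%:R^-1 (u p) * gradsq p) _ (2 / e * (2 * (K * L))) (mdisk c)).
- move=> n; apply: measurable_funM; last exact: mS.
  by apply: (measurable_funS (mdisk 1) sub); apply: sol_measurable_scal; exact: continuous_dfcut.
- move=> n p _; have [_ _ /andP[k0 _]] := fcut_bounds (u p) (n0 n).
  by rewrite mulr_ge0// gradsq_ge0.
- move=> p _ n k nk; rewrite ler_wpM2r ?gradsq_ge0//; apply: dfcut_antitone => //.
  by rewrite lef_pV2 ?posrE// ler_nat ltnS.
- move=> p pc.
  rewrite [X in _ --> X](_ : gradsq p = (if u p != 0 then 1 else 0) * gradsq p); last first.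
    case: eqVneq => [up|_]; rewrite ?mul1r// mul0r /gradsq.
    by have [-> ->] := sol_grad0 usol (sub _ pc) up; rewrite expr0n addr0.
  by apply: cvgM; [exact: cvg_dfcut|exact: cvg_cst].
move=> n; set d := n.+1%:R^-1; have d0 : 0 < d := n0 n.
have A0 p : 0 <= A d p.
  have [_ _ /andP[k0 _]] := fcut_bounds (u p) d0.
  by apply: mulr_ge0; [exact: scut_ge0|apply: mulr_ge0; [|exact: gradsq_ge0]].
have fin : (\int[leb2]_(p in disk 1) (A d p)%:E)%E \is a fin_num := integrable_fin_num (mdisk 1) (intA d d0).
apply: (@le_trans _ _ (\int[leb2]_(p in disk c) ((2 / e)%:E * (A d p)%:E))%E).
  apply: ge0_le_integral.
  - exact: mdisk.
  - move=> p _; have [_ _ /andP[k0 _]] := fcut_bounds (u p) d0.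
    by rewrite lee_fin mulr_ge0// gradsq_ge0.
  - apply/measurable_EFinP; apply: measurable_funM; last exact: mS.
    by apply: (measurable_funS (mdisk 1) sub); apply: sol_measurable_scal; exact: continuous_dfcut.
  - apply: emeasurable_funM => //; apply: (measurable_funS (mdisk 1) sub); exact: measurable_int (intA d d0).
  move=> p pc; rewrite -EFinM lee_fin /A.
  have [_ _ /andP[k0 _]] := fcut_bounds (u p) d0.
  rewrite mulrA ler_peMl ?mulr_ge0 ?gradsq_ge0//.
  (* With [t = b - qn p > 2 e], the factorisation [2 (t - e)^2 - e t = (2 t - e) (t - 2 e)] gives
     [scut e t >= e / 2], whence the constant [2 / e]. *)
  have tp : 2 * e < b - qn p by move: pc; rewrite /Defs.ball0/= -/(qn p) /e /b; lra.
  rewrite scut_pos; last lra.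
  have t0 : 0 < b - qn p by lra.
  move: (b - qn p) tp t0 => t tp t0.
  rewrite (_ : 2 / e * _ = (2 * (t - e) ^+ 2) / (e * t)); last by field; rewrite !gt_eqF.
  have et : 0 < e * t by rewrite mulr_gt0.
  rewrite (ler_pdivlMr _ _ et) mul1r -subr_ge0.
  rewrite (_ : _ - _ = (2 * t - e) * (t - 2 * e)); last by ring.
  by apply: mulr_ge0; lra.
rewrite ge0_integralZl//; last 4 first.
- exact: mdisk.
- by apply: (measurable_funS (mdisk 1) sub); exact: measurable_int (intA d d0).
- by move=> p _; rewrite lee_fin.
- by rewrite lee_fin divr_ge0// ltW.
rewrite (EFinM (2 / e) (2 * (K * L))); apply: lee_wpmul2l; first by rewrite lee_fin divr_ge0// ltW.
apply: (@le_trans _ _ (\int[leb2]_(p in disk 1) (A d p)%:E)%E); last first.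
  by rewrite -(fineK fin) lee_fin; exact: AK.
apply: ge0_subset_integral.
- exact: mdisk.
- exact: mdisk.
- exact: measurable_int (intA d d0).
- by move=> p _; rewrite lee_fin.
- exact: sub.
Qed.

End SolutionIntegrals.

(** * The radial identities and the monotonicity formula *)

Section Identities.
Context {R : realType}.
Notation mu := (@lebesgue_measure R).
Notation leb2 := (@leb2 R).
Notation disk := (@Defs.ball0 R).
Implicit Types (w v P Q : R * R -> R) (p : R * R).
Variables (rhop rhom : R) (u : R * R -> R).
Hypothesis usol : variational_solution rhop rhom u.
Notation gsq := (gradsq u).
Notation gx := (gradx u).
Notation rho := (rho rhop rhom u).

Lemma gradx_le p : disk 1 p -> `|gx p| <= 1 + gsq p.
Proof.
rewrite /Defs.ball0/= expr1n -/(qn p) => p1.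
have G0 := gradsq_ge0 u p.
have XX : gx p ^+ 2 <= gsq p.
  by apply: le_trans (gradx_sqr_le u p) _; rewrite ler_piMl// ltW.
rewrite -(@ger0_norm _ (1 + gsq p)); last lra.
rewrite -ler_sqr ?nnegrE// !real_normK ?num_real//; nra.
Qed.

Lemma chi_measurable : measurable_fun [set: R * R] (chi_plus u) /\ measurable_fun [set: R * R] (chi_minus u).
Proof.
split; apply: measurable_indic; apply: open_measurable2; first exact: open_interior.
by apply: open_Omega_minus; exact: sol_continuous usol.
Qed.

Lemma rho_measurable : measurable_fun [set: R * R] rho.
Proof.
have [m1 m2] := chi_measurable.
by apply: measurable_funD; apply: measurable_funM.
Qed.

Lemma rho_le p : `|rho p| <= `|rhop| + `|rhom|.
Proof.
rewrite /rho (le_trans (ler_normD _ _))// !normrM lerD// ler_piMr// /chi_plus /chi_minus indicE.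
all: by case: (_ \in _); rewrite ?normr1 ?normr0.
Qed.

Lemma sol_sqr_continuous p : disk 1 p -> {for p, continuous (fun p => u p ^+ 2)}.
Proof. by move=> p1; have cup := sol_continuous usol p1; exact: (continuousM cup cup). Qed.

Section Disk.
Variable c : R.
Hypotheses (c0 : 0 < c) (c1 : c < 1).

Let sub : disk c `<=` disk 1.
Proof. by apply: disk_subset => //; exact: ltW. Qed.

Let mS (f : R * R -> R) : measurable_fun (disk 1) f -> measurable_fun (disk c) f.
Proof. by move=> mf; apply: (measurable_funS (mdisk 1) sub). Qed.

Let mqn : measurable_fun (disk c) (@qn R).
Proof. by apply: measurable_funTS; exact: measurable_qn. Qed.

Let my : measurable_fun (disk c) (fun p : R * R => p.2).
Proof. by apply: measurable_funTS; exact: measurable_snd. Qed.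

Let mu_ : measurable_fun (disk c) u.
Proof. by apply: mS; exact: sol_measurable usol. Qed.

Let mgx : measurable_fun (disk c) gx.
Proof. by apply: mS; exact: measurable_gradx usol. Qed.

Let mgsq : measurable_fun (disk c) gsq.
Proof. by apply: mS; exact: measurable_gradsq usol. Qed.

Let qn1 p : disk c p -> qn p <= 1.
Proof. by move=> /sub; rewrite /Defs.ball0/= expr1n => /ltW. Qed.

Let igsq : leb2.-integrable (disk c) (EFin \o gsq).
Proof. exact: gradsq_integrable usol _ c0 c1. Qed.

Let icst (a : R) : leb2.-integrable (disk c) (EFin \o (fun=> a)).
Proof. by apply: continuous_integrable_disk => p _; exact: cst_continuous. Qed.

Let igx : leb2.-integrable (disk c) (EFin \o gx).
Proof.
apply: (@integrable_le _ _ _ leb2 _ (mdisk c) gx (fun p => 1 + gsq p) mgx).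
  by move=> p /sub; exact: gradx_le.
by have := integrableD (mdisk c) (icst 1) igsq; apply: eq_integrable => //; exact: mdisk.
Qed.

Let ubound : exists2 M, 0 < M & forall p, disk c p -> `|u p| <= M.
Proof.
have [p pc|M M0 uM] := bounded_on (@compact_cdisk R c) (w := u).
  apply: (sol_continuous usol); move: pc; rewrite /cdisk /Defs.ball0/= expr1n => /le_lt_trans; apply.
  by rewrite exprn_ilt1// ltW.
by exists M => // p /ltW pc; exact: uM.
Qed.

Let iugx : leb2.-integrable (disk c) (EFin \o (fun p => u p * gx p)).
Proof.
have [M M0 uM] := ubound.
exact: (@integrable_bdM _ _ _ leb2 _ (mdisk c) gx u M mu_ uM igx).
Qed.

Let iu2 : leb2.-integrable (disk c) (EFin \o (fun p => u p ^+ 2)).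
Proof.
have [M M0 uM] := ubound.
apply: (@bounded_integrable_disk _ _ _ (M ^+ 2)); first exact: measurable_funX.
by move=> p pc; rewrite normrX ler_sqr ?nnegrE// ?uM// ltW.
Qed.

Let irho : leb2.-integrable (disk c) (EFin \o (fun p => rho p * p.2)).
Proof.
apply: (@bounded_integrable_disk _ _ _ (`|rhop| + `|rhom|)).
  by apply: measurable_funM => //; apply: measurable_funTS; exact: rho_measurable.
move=> p pc; rewrite normrM -[leRHS]mulr1; apply: ler_pM => //; first exact: rho_le.
have := qn1 pc; rewrite /qn => h.
by rewrite -[leRHS](ger0_norm ler01) -ler_sqr ?nnegrE// !real_normK ?num_real// expr1n; have := sqr_ge0 p.1; lra.
Qed.

Let igx2 : leb2.-integrable (disk c) (EFin \o (fun p => gx p ^+ 2)).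
Proof.
apply: (@integrable_le _ _ _ leb2 _ (mdisk c) _ gsq) => //; first exact: measurable_funX.
move=> p pc; rewrite ger0_norm ?sqr_ge0//; apply: le_trans (gradx_sqr_le u p) _.
by rewrite ler_piMl ?gradsq_ge0// qn1.
Qed.

Let iqn (f : R * R -> R) : leb2.-integrable (disk c) (EFin \o f) ->
  leb2.-integrable (disk c) (EFin \o (fun p => qn p * f p)).
Proof.
apply: (@integrable_bdM _ _ _ leb2 _ (mdisk c) f _ 1) => // p /qn1.
by rewrite ger0_norm// qn_ge0.
Qed.

Let iZ (a : R) (f : R * R -> R) : leb2.-integrable (disk c) (EFin \o f) ->
  leb2.-integrable (disk c) (EFin \o (fun p => a * f p)).
Proof. by move=> fi; have := integrableZl (mdisk c) a fi; apply: eq_integrable => //; exact: mdisk. Qed.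

Let iD (f g : R * R -> R) : leb2.-integrable (disk c) (EFin \o f) -> leb2.-integrable (disk c) (EFin \o g) ->
  leb2.-integrable (disk c) (EFin \o (fun p => f p + g p)).
Proof. by move=> fi gi; have := integrableD (mdisk c) fi gi; apply: eq_integrable => //; exact: mdisk. Qed.

Let iB (f g : R * R -> R) : leb2.-integrable (disk c) (EFin \o f) -> leb2.-integrable (disk c) (EFin \o g) ->
  leb2.-integrable (disk c) (EFin \o (fun p => f p - g p)).
Proof. by move=> fi gi; have := integrableB (mdisk c) fi gi; apply: eq_integrable => //; exact: mdisk. Qed.

Let n0 n : 0 < n.+1%:R^-1 :> R. Proof. by rewrite invr_gt0. Qed.

Let bc1 b : b < c ^+ 2 -> b < 1.
Proof. by move=> /lt_trans; apply; rewrite exprn_ilt1// ltW. Qed.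

Let mdf n : measurable_fun (disk c) (fun p => dfcut n.+1%:R^-1 (u p)).
Proof. by apply: mS; apply: (sol_measurable_scal usol); exact: continuous_dfcut. Qed.

Let mf n : measurable_fun (disk c) (fun p => fcut n.+1%:R^-1 (u p)).
Proof. by apply: mS; apply: (sol_measurable_scal usol); exact: continuous_fcut. Qed.

Let cvg_dfcutM (g : R * R -> R) p : (u p = 0 -> g p = 0) ->
  dfcut n.+1%:R^-1 (u p) * g p @[n --> \oo] --> g p.
Proof.
move=> g0; rewrite [X in _ --> X](_ : g p = (if u p != 0 then 1 else 0) * g p).
  by apply: cvgM; [exact: cvg_dfcut|exact: cvg_cst].
by case: eqVneq => [/g0 ->|_]; rewrite ?mul1r ?mulr0.
Qed.

(** The truncated integrands are dominated by their limits, [gsq] and [|u gx|]. Only the Caccioppoli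
    estimate makes these integrable. *)
Lemma energy_radial :
  {ae mu, forall r, r \in `]0, c[ -> \int[leb2]_(p in disk r) gsq p = cmean (fun p => u p * gx p) r}.
Proof.
apply: (radial c0 igsq iugx) => e b e0 b0 bc.
apply: (@qcut_limit _ e b c (fun n p => dfcut n.+1%:R^-1 (u p) * gsq p) (fun n p => fcut n.+1%:R^-1 (u p) * gx p)
  _ _ gsq (fun p => `|u p * gx p|)) => //.
- exact: ltW.
- by move=> n; exact: measurable_funM.
- by move=> n; exact: measurable_funM.
- move=> p pc; apply: cvg_dfcutM => up; have [g1 g2] := sol_grad0 usol (sub pc) up.
  by rewrite /gradsq g1 g2 expr0n addr0.
- by move=> p pc; apply: cvgM; [exact: cvg_fcut|exact: cvg_cst].
- by have := integrable_abse iugx; apply: eq_integrable => //; exact: mdisk.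
- move=> n p _; have [_ _ /andP[k0 k1]] := fcut_bounds (u p) (n0 n).
  by rewrite ger0_norm ?mulr_ge0 ?gradsq_ge0// ler_piMl ?gradsq_ge0.
- move=> n p _; have [f1 _ _] := fcut_bounds (u p) (n0 n).
  by rewrite !normrM ler_wpM2r.
- by move=> n; apply: (energy_regularized usol) => //; exact: bc1.
Qed.

Lemma mass_radial :
  {ae mu, forall r, r \in `]0, c[ -> \int[leb2]_(p in disk r) (2 * u p ^+ 2 + 2 * (u p * gx p)) =
     cmean (fun p => qn p * u p ^+ 2) r}.
Proof.
have iP : leb2.-integrable (disk c) (EFin \o (fun p => 2 * u p ^+ 2 + 2 * (u p * gx p))).
  by apply: iD; exact: iZ.
have iQ : leb2.-integrable (disk c) (EFin \o (fun p => qn p * u p ^+ 2)) by exact: iqn.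
apply: (radial c0 iP iQ) => e b e0 b0 bc.
apply: (@qcut_limit _ e b c
  (fun n p => 2 * fcut n.+1%:R^-1 (u p) ^+ 2 + 2 * (fcut n.+1%:R^-1 (u p) * (dfcut n.+1%:R^-1 (u p) * gx p)))
  (fun n p => qn p * fcut n.+1%:R^-1 (u p) ^+ 2) _ _
  (fun p => 2 * u p ^+ 2 + 2 * `|u p * gx p|) (fun p => qn p * u p ^+ 2)) => //.
- exact: ltW.
- move=> n; apply: measurable_funD; apply: measurable_funM => //; first exact: measurable_funX.
  by apply: measurable_funM => //; exact: measurable_funM.
- by move=> n; apply: measurable_funM => //; exact: measurable_funX.
- move=> p pc; apply: cvgD; apply: cvgM; try exact: cvg_cst.
    by apply: cvgM; exact: cvg_fcut.
  apply: cvgM; first exact: cvg_fcut.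
  apply: cvg_dfcutM => up; have [g1 g2] := sol_grad0 usol (sub pc) up.
  by rewrite /gradx g1 g2 !mulr0 addr0.
- move=> p pc; apply: cvgM; first exact: cvg_cst.
  by apply: cvgM; exact: cvg_fcut.
- apply: iD; first exact: iZ.
  by apply: iZ; have := integrable_abse iugx; apply: eq_integrable => //; exact: mdisk.
- move=> n p _; have [f1 f2 /andP[k0 k1]] := fcut_bounds (u p) (n0 n).
  have ff : fcut n.+1%:R^-1 (u p) ^+ 2 <= u p ^+ 2 by rewrite (le_trans f2)// ler_piMr ?sqr_ge0.
  apply: (le_trans (ler_normD _ _)); apply: lerD; first by rewrite normrM !ger0_norm ?sqr_ge0// ler_pM2l.
  rewrite !normrM (@ger0_norm _ 2)// ler_wpM2l//; apply: ler_pM => //.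
  by rewrite (ger0_norm k0) ler_piMl.
- move=> n p _; have [f1 f2 /andP[k0 k1]] := fcut_bounds (u p) (n0 n).
  have ff : fcut n.+1%:R^-1 (u p) ^+ 2 <= u p ^+ 2 by rewrite (le_trans f2)// ler_piMr ?sqr_ge0.
  by rewrite normrM !ger0_norm ?qn_ge0 ?sqr_ge0// ler_wpM2l ?qn_ge0.
- by move=> n; apply: (mass_regularized usol) => //; exact: bc1.
Qed.

(** The field [S x] is C^1 regardless of [u], so no truncation occurs. In dimension two the terms
    where [S] is not differentiated lose the energy, [2 |grad u|^2 - 2 |grad u|^2 = 0], and keep
    [- 3 rho y]: one [y] from the second component of the field, two from [y div x]. *)
Lemma variation_radial :
  {ae mu, forall r, r \in `]0, c[ -> \int[leb2]_(p in disk r) (- 3 * (rho p * p.2)) =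
     cmean (fun p => qn p * gsq p - 2 * gx p ^+ 2 - qn p * (rho p * p.2)) r}.
Proof.
have iP : leb2.-integrable (disk c) (EFin \o (fun p => - 3 * (rho p * p.2))) by exact: iZ.
have iQ : leb2.-integrable (disk c) (EFin \o (fun p => qn p * gsq p - 2 * gx p ^+ 2 - qn p * (rho p * p.2))).
  by apply: iB; [apply: iB; [exact: iqn|exact: iZ]|exact: iqn].
apply: (radial c0 iP iQ) => e b e0 b0 bc.
apply: qcut_split => //; first exact: ltW.
have C1 p := C1at_mul (C1at_qcut b p e0) (C1at_fst p).
have C2 p := C1at_mul (C1at_qcut b p e0) (C1at_snd p).
rewrite -[RHS](sol_variation usol (ltW b0) (bc1 bc) C1 C2).
- apply: eq_Rintegral => p _; rewrite /gradsq /gradx /qn; ring.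
- by move=> p bp; have [-> _] := qcut0 e0 bp; rewrite mul0r.
- by move=> p bp; have [-> _] := qcut0 e0 bp; rewrite mul0r.
Qed.

Let circ_lin (a1 a2 a3 : R) (f1 f2 f3 : R * R -> R) r :
  mu.-integrable `[0, 2 * pi] (EFin \o (fun t => f1 (r * cos t, r * sin t))) ->
  mu.-integrable `[0, 2 * pi] (EFin \o (fun t => f2 (r * cos t, r * sin t))) ->
  mu.-integrable `[0, 2 * pi] (EFin \o (fun t => f3 (r * cos t, r * sin t))) ->
  mu.-integrable `[0, 2 * pi] (EFin \o (fun t => (fun p => a1 * f1 p + a2 * f2 p + a3 * f3 p) (r * cos t, r * sin t))) /\
  cmean (fun p => a1 * f1 p + a2 * f2 p + a3 * f3 p) r = a1 * cmean f1 r + a2 * cmean f2 r + a3 * cmean f3 r.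
Proof.
have mI : measurable (`[0, 2 * pi]%classic : set (measurableTypeR R)) by exact: measurable_itv.
have Z (a : R) (f : R * R -> R) : mu.-integrable `[0, 2 * pi] (EFin \o (fun t => f (r * cos t, r * sin t))) ->
    mu.-integrable `[0, 2 * pi] (EFin \o (fun t => (fun p => a * f p) (r * cos t, r * sin t))).
  by move=> fi; have := integrableZl mI a fi; apply: eq_integrable => //; exact: mI.
have S (f g : R * R -> R) : mu.-integrable `[0, 2 * pi] (EFin \o (fun t => f (r * cos t, r * sin t))) ->
    mu.-integrable `[0, 2 * pi] (EFin \o (fun t => g (r * cos t, r * sin t))) ->
    mu.-integrable `[0, 2 * pi] (EFin \o (fun t => (fun p => f p + g p) (r * cos t, r * sin t))).
  by move=> fi gi; have := integrableD mI fi gi; apply: eq_integrable => //; exact: mI.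
move=> i1 i2 i3; have j1 := Z a1 _ i1; have j2 := Z a2 _ i2; have j3 := Z a3 _ i3.
have j12 := S (fun p => a1 * f1 p) (fun p => a2 * f2 p) j1 j2.
split; first exact: (S (fun p => a1 * f1 p + a2 * f2 p) (fun p => a3 * f3 p) j12 j3).
rewrite (@cmeanD _ (fun p => a1 * f1 p + a2 * f2 p) (fun p => a3 * f3 p) r j12 j3).
by rewrite (@cmeanD _ (fun p => a1 * f1 p) (fun p => a2 * f2 p) r j1 j2) !cmeanZl.
Qed.

(** Both sides of the almost-everywhere identity are continuous in the radius. Validity at all radii
    is what permits replacing the circle integral in [Mfun] on a neighbourhood of [r]. *)
Lemma mass_radial_everywhere r : r \in `]0, c[ ->
  \int[leb2]_(p in disk r) (2 * u p ^+ 2 + 2 * (u p * gx p)) = r ^+ 2 * cmean (fun p => u p ^+ 2) r.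
Proof.
move=> rc; have cu2 : forall p, disk 1 p -> {for p, continuous (fun p => qn p * u p ^+ 2)}.
  by move=> p p1; exact: (continuousM (@continuous_qn R p) (sol_sqr_continuous p1)).
have iP : leb2.-integrable (disk c) (EFin \o (fun p => 2 * u p ^+ 2 + 2 * (u p * gx p))).
  by apply: iD; exact: iZ.
pose h r := \int[leb2]_(p in disk r) (2 * u p ^+ 2 + 2 * (u p * gx p)) - cmean (fun p => qn p * u p ^+ 2) r.
have h0 : h r = 0.
  apply: (@ae_eq0_continuous R h c) rc; first by apply: ae_imp mass_radial => s + sc; rewrite /h => /(_ sc) ->; rewrite subrr.
  move=> s sc; apply: continuousB; first exact: (disk_integral_continuous c0 iP sc).
  apply: cmean_continuous => //; move: sc; rewrite !in_itv/= => /andP[-> /lt_trans]; exact.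
move/eqP: h0; rewrite subr_eq0 => /eqP ->.
move: rc; rewrite in_itv/= => /andP[r0 rc].
rewrite -cmeanZl; first by apply: eq_cmean => t; rewrite qn_polar.
apply: (circle_integrable (w := fun p => u p ^+ 2)) => //; last exact: lt_trans c1.
exact: sol_sqr_continuous.
Qed.

Lemma sol_monotonicity_disk : {ae mu, forall r, r \in `]0, c[ ->
  derivable (Mfun rhop rhom u) r 1 /\
  derive1 (Mfun rhop rhom u) r = 2 / r ^+ 3 * circ_int r (fun p =>
     (dot (grad u p) (r^-1 *: p) - 3 / 2 * u p / r) ^+ 2)}.
Proof.
have iE : leb2.-integrable (disk c) (EFin \o (fun p => 2 * u p ^+ 2 + 2 * (u p * gx p))).
  by apply: iD; exact: iZ.
have iDr : leb2.-integrable (disk c) (EFin \o (fun p => gsq p - rho p * p.2)) by exact: iB.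
have [ic1 _ _] := polar_ball c0 igsq; have [ic2 _ _] := polar_ball c0 igx2.
have [ic3 _ _] := polar_ball c0 iugx; have [ic4 _ _] := polar_ball c0 irho.
have H1 := ae_and (ae_and ic1 ic2) (ae_and ic3 ic4).
have H2 := ae_and (ae_and energy_radial variation_radial) (ae_and (derive_disk c0 iDr) (derive_disk c0 iE)).
apply: ae_imp (ae_and H1 H2) => r [[[h1 h2] [h3 h4]] [[HB HA] [dD dE]]] rc.
move: {h1 h2 h3 h4 HA HB dD dE} (h1 rc) (h2 rc) (h3 rc) (h4 rc) (HA rc) (HB rc) (dD rc) (dE rc) => h1 h2 h3 h4 HA HB dD dE.
have rc' := rc; rewrite in_itv/= in rc'; have {rc'} /andP[r0 rlc] := rc'.
have h5 s : 0 < s -> s < c -> mu.-integrable `[0, 2 * pi] (EFin \o (fun t => (fun p => u p ^+ 2) (s * cos t, s * sin t))).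
  move=> s0 sc; apply: (circle_integrable (w := fun p => u p ^+ 2)) => //; last exact: lt_trans c1.
  exact: sol_sqr_continuous.
have sub_r := disk_subset r0 (ltW rlc).
have ir (f : R * R -> R) : leb2.-integrable (disk c) (EFin \o f) -> leb2.-integrable (disk r) (EFin \o f).
  exact: integrableS (mdisk c) (mdisk r) sub_r.
set f1 := cmean gsq r in h1.
set D := fun x : R => \int[leb2]_(p in disk x) (gsq p - rho p * p.2) in dD.
set E := fun x : R => \int[leb2]_(p in disk x) (2 * u p ^+ 2 + 2 * (u p * gx p)) in dE.
have dV : is_derive r (1 : R) (fun x => x^-1) (- (r^-1 * r^-1)).
  have := is_deriveV (f := id) (lt0r_neq0 r0) (is_derive_id r (1 : R)).
  by rewrite /GRing.scale/= mulr1 -exprVn.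
have d2 := isd_mul dV dV; have d3 := isd_mul d2 dV; have d5 := isd_mul d3 d2.
have dM := isd_sub (isd_mul d3 dD) (isd_mul (isd_mul (isd_cst (3 / 2) r 1) d5) dE).
(* Since [E x = x^2 * cmean u^2] and the circle integral of [u^2] is [x * cmean u^2], the boundary
   term is [3 / 2 * x^-5 * E x]. Both terms are now powers of [x] times disk integrals that are
   differentiable at [r]. *)
have ME : \forall x \near r,
    x^-1 * x^-1 * x^-1 * D x - 3 / 2 * (x^-1 * x^-1 * x^-1 * (x^-1 * x^-1)) * E x = Mfun rhop rhom u x.
  near=> x; apply/esym.
  have x0 : 0 < x by near: x; exact: lt_nbhsr.
  have xc : x < c by near: x; exact: lt_nbhsl.
  rewrite /E mass_radial_everywhere ?in_itv/= ?x0//.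
  rewrite /Mfun /circ_int RintegralZr; [|exact: measurable_itv|exact: h5].
  rewrite -/(cmean (fun p => u p ^+ 2) x); congr (_ - _).
    rewrite -!exprVn; congr (_ * _); first by rewrite !exprS expr0; ring.
    by apply: eq_Rintegral => p _; rewrite /dot /gradsq /rho; ring.
  by field; rewrite gt_eqF.
have [dMr eMr] := near_eq_is_derive ME dM.
split; first exact: dMr.
rewrite derive1E eMr.
have h5r := h5 r r0 rlc.
have [j1 e1] := (@circ_lin (r ^+ 2) (- 2) (- r ^+ 2) gsq (fun p => gx p ^+ 2) (fun p => rho p * p.2) r h1 h2 h4).
have [j2 e2] := (@circ_lin (r ^- 2) (- 3 * r ^- 2) (9 / 4 * r ^- 2) (fun p => gx p ^+ 2) (fun p => u p * gx p) (fun p => u p ^+ 2) r h2 h3 h5r).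
have [j3 e3] := (@circ_lin 1 (- 1) 0 gsq (fun p => rho p * p.2) (fun p => rho p * p.2) r h1 h4 h4).
have [j4 e4] := (@circ_lin 2 2 0 (fun p => u p ^+ 2) (fun p => u p * gx p) (fun p => u p * gx p) r h5r h3 h3).
move: e1 e2 e3 e4.
set F1 := cmean gsq r; set F2 := cmean (fun p => gx p ^+ 2) r; set F3 := cmean (fun p => u p * gx p) r.
set F4 := cmean (fun p => rho p * p.2) r; set F5 := cmean (fun p => u p ^+ 2) r => e1 e2 e3 e4.
have E1 : cmean (fun p => qn p * gsq p - 2 * gx p ^+ 2 - qn p * (rho p * p.2)) r = r ^+ 2 * F1 - 2 * F2 - r ^+ 2 * F4.
  transitivity (r ^+ 2 * F1 + - 2 * F2 + - r ^+ 2 * F4); last by ring.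
  by rewrite -e1; apply: eq_cmean => t; rewrite qn_polar; ring.
have E3 : cmean (fun p => gsq p - rho p * p.2) r = F1 - F4.
  transitivity (1 * F1 + - 1 * F4 + 0 * F4); last by ring.
  by rewrite -e3; apply: eq_cmean => t; ring.
have E4 : cmean (fun p => 2 * u p ^+ 2 + 2 * (u p * gx p)) r = 2 * F5 + 2 * F3.
  transitivity (2 * F5 + 2 * F3 + 0 * F3); last by ring.
  by rewrite -e4; apply: eq_cmean => t; ring.
(* With normal [x / r], the square is [r^-2 (gx^2 - 3 u gx + 9 / 4 u^2)]; the last factor [r] is the
   arc length. *)
have E2 : circ_int r (fun p => (dot (grad u p) (r^-1 *: p) - 3 / 2 * u p / r) ^+ 2) =
    (r ^- 2 * F2 - 3 * r ^- 2 * F3 + 9 / 4 * r ^- 2 * F5) * r.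
  transitivity ((r ^- 2 * F2 + - 3 * r ^- 2 * F3 + 9 / 4 * r ^- 2 * F5) * r); last by ring.
  rewrite -e2 /circ_int -RintegralZr; [|exact: measurable_itv|exact: j2].
  apply: eq_Rintegral => t _; congr (_ * _).
  rewrite /dot /gradx /=.
  change (r^-1 *: (r * cos t)) with (r^-1 * (r * cos t)); change (r^-1 *: (r * sin t)) with (r^-1 * (r * sin t)).
  rewrite -/(grad1 u _) -/(grad2 u _).
  move: (grad1 u _) (grad2 u _) (u _) => x y z; field; exact: lt0r_neq0.
have ER : E r = r ^+ 2 * F5 by exact: mass_radial_everywhere.
have I4 : \int[leb2]_(p in disk r) (- 3 * (rho p * p.2)) = - 3 * \int[leb2]_(p in disk r) (rho p * p.2).
  by rewrite RintegralZl//; [exact: mdisk|exact: ir].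
have DR : D r = F3 - \int[leb2]_(p in disk r) (rho p * p.2).
  by rewrite /D RintegralB ?HB//; [exact: mdisk|exact: ir|exact: ir].
(* The energy identity has turned the Dirichlet part of [D r] into [F3]. Substituting the variation
   identity for the bulk term [3 r^-4 I] cancels [F1] and [F4], which leaves
   [2 r^-4 (F2 - 3 F3 + 9 / 4 F5)], the desired square. *)
rewrite I4 E1 in HA; rewrite E2 E3 E4 ER DR.
move: HA; move: (\int[leb2]_(p in disk r) (rho p * p.2)) => I HA.
have -> : I = - (r ^+ 2 * F1 - 2 * F2 - r ^+ 2 * F4) / 3 by rewrite -HA; field.
by field; exact: lt0r_neq0.
Unshelve. all: by end_near.
Qed.

End Disk.

Lemma sol_monotonicity : {ae mu, forall r, r \in `]0, 1[ ->
  derivable (Mfun rhop rhom u) r 1 /\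
  derive1 (Mfun rhop rhom u) r = 2 / r ^+ 3 * circ_int r (fun p =>
     (dot (grad u p) (r^-1 *: p) - 3 / 2 * u p / r) ^+ 2)}.
Proof.
pose P r := derivable (Mfun rhop rhom u) r 1 /\
  derive1 (Mfun rhop rhom u) r = 2 / r ^+ 3 * circ_int r (fun p =>
     (dot (grad u p) (r^-1 *: p) - 3 / 2 * u p / r) ^+ 2).
(* Radii increasing to 1, with [n.+2] so that already [c 0 = 1 / 2] is positive; the exceptional set
   is contained in a countable union of null sets. *)
pose c n : R := 1 - n.+2%:R^-1.
have c0 n : 0 < c n by rewrite /c subr_gt0 invf_lt1// ltr1n.
have c1 n : c n < 1 by rewrite /c ltrBlDr ltrDl invr_gt0.
have : mu.-negligible (\bigcup_n ~` [set r | r \in `]0, c n[ -> P r]).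
  by apply: negligible_bigcup => n; exact: (sol_monotonicity_disk (c0 n) (c1 n)).
apply: negligibleS => r /= nP; apply: contrapT => rN; apply: nP.
rewrite in_itv/= => /andP[r0 r1].
have [n nr] : exists n, r < c n.
  have d0 : 0 < 1 - r by lra.
  have [N _ NP] := cvgr_lt _ (@cvgV0 R) _ d0.
  by exists N; have := NP N.+1 (leqnSn N); rewrite /c ltrBrDr -ltrBrDl.
apply: contrapT => nPr; apply: rN; exists n => //= h; apply: nPr; apply: h.
by rewrite in_itv/= r0.
Qed.

End Identities.

Theorem theorem3p10 (R : realType) (rhop rhom : R) (u : R * R -> R) :
  0 < rhop -> 0 < rhom -> rhop != rhom ->
  variational_solution rhop rhom u ->
  {ae @lebesgue_measure R, forall r : R, r \in `]0, 1[ ->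
     derivable (Mfun rhop rhom u) r 1 /\
     derive1 (Mfun rhop rhom u) r =
       2 / r ^+ 3 * circ_int r (fun p =>
         (dot (grad u p) (r^-1 *: p) - 3 / 2 * u p / r) ^+ 2)}.
Proof. by move=> _ _ _; exact: sol_monotonicity. Qed.
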